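(* Let $\Pi(z)$ be a canonical product of genus one. Then $$ \sigma(\Pi)+\alpha(\Pi)=2\max\{\gamma_+(\Pi),\gamma_-(\Pi)\}+\alpha(\Pi^{-1}), $$ as an equality in $[0,+\infty]$; that is, if one of the two sides is finite, then the other is finite as well and the two sides are equal.
   Context: A canonical product of genus one is an entire function $\Pi(z)=\prod_k E(z/z_k)$, where $E(z)=(1-z)e^z$ and $\{z_k\}$ is a (finite or infinite) sequence of nonzero complex numbers with $\sum_k|z_k|^{-2}<\infty$; the $z_k$ are the zeros of $\Pi$, listed with multiplicity. $\gamma_+(\Pi)$ (respectively $\gamma_-(\Pi)$) is the sum $\sum|\mathrm{Im}(z_k^{-1})|$ over the zeros $z_k$ of $\Pi$ (with multiplicity) lying in the upper (respectively lower) half-plane. For an entire function $f$, $M(r,f)=\max_{|z|=r}|f(z)|$ and $\sigma(f)=\limsup_{r\to\infty}\frac{\log M(r,f)}{r}$. Moreover $$\alpha(f)=\frac1\pi\int_{-\infty}^{\infty}\frac{\log^+|f(t)|}{t^2}\,dt,\qquad \alpha(f^{-1})=\frac1\pi\int_{-\infty}^{\infty}\frac{\log^-|f(t)|}{t^2}\,dt,$$ where $\log^+x=\max(\log x,0)$ and $\log^-x=\max(-\log x,0)$. All these quantities are allowed to equal $+\infty$. *)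

(* Defs.v *)
From HB Require Import structures.
From mathcomp Require Import all_boot all_order all_algebra.
From mathcomp Require Import all_classical all_reals all_analysis.
From mathcomp Require Import complex.

Set Implicit Arguments.
Unset Strict Implicit.
Unset Printing Implicit Defensive.

Import Order.TTheory GRing.Theory Num.Theory.
Import numFieldNormedType.Exports.

Local Open Scope classical_set_scope.
Local Open Scope ring_scope.

(* The real-valued modulus; [`|z|] on R[i] is R[i]-valued. *)
Definition cmod (R : realType) (z : R[i]) : R := ComplexField.Normc.normc z.

Definition cexp (R : realType) (z : R[i]) : R[i] :=
  Complex (expR (complex.Re z) * cos (complex.Im z))
          (expR (complex.Re z) * sin (complex.Im z)).

Definition primary_factor (R : realType) (z : R[i]) : R[i] := (1 - z) * cexp z.

(* A finite or infinite sequence of complex numbers is a function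
   [z : nat -> R[i]] together with a length [N : option nat] ([None] when the
   sequence is infinite); only the values [z k] with [in_range N k] matter. *)
Definition in_range (N : option nat) (k : nat) : bool :=
  if N is Some n then (k < n)%N else true.

Definition genus_one_zeros (R : realType) (N : option nat) (z : nat -> R[i])
    : Prop :=
  (forall k, in_range N k -> z k != 0) /\
  (\sum_(k <oo | in_range N k) (cmod (z k) ^- 2)%:E < +oo)%E.

Definition canonical_product (R : realType) (N : option nat) (z : nat -> R[i])
    (x : R[i]) : R[i] :=
  lim ((fun n : nat =>
    \prod_(0 <= k < n | in_range N k) primary_factor (x / z k) : R[i]^o)
    @ \oo).

(* [z] lists the zeros of [canonical_product N z] with multiplicity. *)
Definition gamma_plus (R : realType) (N : option nat) (z : nat -> R[i])
    : \bar R :=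
  (\sum_(k <oo | in_range N k && (0 < complex.Im (z k))%R)
     `|complex.Im ((z k)^-1)|%:E)%E.

Definition gamma_minus (R : realType) (N : option nat) (z : nat -> R[i])
    : \bar R :=
  (\sum_(k <oo | in_range N k && (complex.Im (z k) < 0)%R)
     `|complex.Im ((z k)^-1)|%:E)%E.

Definition max_modulus (R : realType) (f : R[i] -> R[i]) (r : R) : \bar R :=
  ereal_sup [set (cmod (f z))%:E | z in [set z : R[i] | cmod z = r]].

Definition sigma (R : realType) (f : R[i] -> R[i]) : \bar R :=
  limf_esup (fun r : R => lne (max_modulus f r) / r%:E)%E (pinfty_nbhs R).

(* [lne 0 = -oo], so [log_minus 0 = +oo]. *)
Definition log_plus (R : realType) (x : R) : \bar R := maxe (lne x%:E) 0%E.
Definition log_minus (R : realType) (x : R) : \bar R := maxe (- lne x%:E)%E 0%E.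

Definition alpha (R : realType) (f : R[i] -> R[i]) : \bar R :=
  ((pi^-1)%:E *
   \int[lebesgue_measure]_(t in setT)
     (log_plus (cmod (f (t%:C)%C)) / (t ^+ 2)%:E))%E.

(* This is alpha(f^{-1}); it is not [alpha (fun z => (f z)^-1)] literally
   because [0^-1 = 0] in R[i]. *)
Definition alpha_inv (R : realType) (f : R[i] -> R[i]) : \bar R :=
  ((pi^-1)%:E *
   \int[lebesgue_measure]_(t in setT)
     (log_minus (cmod (f (t%:C)%C)) / (t ^+ 2)%:E))%E.

(* Main.v *)
Require Import Defs.
From HB Require Import structures.
From mathcomp Require Import all_boot all_order all_algebra.
From mathcomp Require Import all_classical all_reals all_analysis.
From mathcomp Require Import complex measurable_realfun.
From mathcomp Require Import ring lra.

(* Write q_k = p_k + i m_k for the reciprocals of the zeros, A_k = |q_k|^2 and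
   Q for the sum of the A_k. With theta(X) = (X - 1)/2 - (log X)/2 >= 0,
   log|Pi(z)| = Q|z|^2/2 - sum_k theta(|1 - z q_k|^2), so that everything becomes a
   sum of nonnegative terms that may be integrated factor by factor.

   Let Pi* be the product with all zeros reflected into the lower half plane, so
   that |Pi*| = |Pi| on the real axis. Carleman's identity for one factor gives, after
   summation, alpha_s(1/Pi) - alpha_s(Pi) = log|Pi*(is)| / s, where alpha_s truncates
   t^-2 to t^-2 - (t^2 + s^2)^-1. Letting s go to infinity this bounds alpha(Pi) by
   alpha(1/Pi) + gamma_+ + gamma_-; and if sigma(Pi) and alpha(Pi) are finite, the bound
   that Jensen's formula gives for the number of zeros makes the right hand side finite.

   When all the terms are finite, log|Pi*(is)| / s tends to
   kappa = alpha(1/Pi) - alpha(Pi). Poisson's formula extends the upper bound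
   kappa s + o(|z|) to the whole upper half plane, and
   log|Pi(z)| - log|Pi*(z)| <= 2 gamma_+ Im z there, while Jensen's formula for
   circles of radius epsilon Y about iY finds points near iY where log|Pi| is at least
   (kappa + 2 gamma_+ - o(1)) Y. The lower half plane is symmetric, hence
   sigma(Pi) = kappa + 2 max(gamma_+, gamma_-). *)

Set Implicit Arguments.
Unset Strict Implicit.
Unset Printing Implicit Defensive.
Import Order.TTheory GRing.Theory Num.Theory.
Import numFieldNormedType.Exports.
Import ComplexField.Normc.
Local Open Scope classical_set_scope.
Local Open Scope ring_scope.

(** Every quantity may be infinite and log |Pi| changes sign, so nothing may be cancelled or
    integrated termwise before it is known to be finite. This is what [theta] is for: with
    nonnegative summands, Tonelli's theorem and monotone convergence apply without further
    hypotheses, and the identities are written as equalities between sums of nonnegative terms. The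
    price is the quadratic [Q |z|^2 / 2], which is not integrable against a Poisson kernel. It is
    integrable against the difference of two such kernels, at heights [s1 < s2], which decays like
    t^-4. The truncation of t^-2 in the overview is the limit [s1 -> 0] of this difference, and the
    Poisson bound at height [s1] comes from [s2 -> oo]. Circle means are replaced by means over the
    vertices of regular n-gons, where the product of the values of a linear factor is [a^n - b^n];
    the error, summed over all factors, stays bounded as n grows. Near a zero no pointwise lower
    bound for log |Pi| can hold, which is why the lower estimates only produce some point of an
    annulus. *)

Lemma ge0_continuous_FTC2T (R : realType) (f F : R -> R) (l m : R) :
  (forall x, 0 <= f x) -> continuous f -> (forall x : R, is_derive x 1 F (f x)) ->
  F x @[x --> +oo] --> l -> F x @[x --> -oo] --> m ->
  (\int[lebesgue_measure]_x (f x)%:E = (l - m)%:E)%E.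
Proof.
move=> f0 cf dF Fl Fm.
have mf : measurable_fun [set: R] f by exact: continuous_measurable_fun.
have half (g G : R -> R) (k : R) : (forall x, 0 <= g x) -> continuous g ->
    (forall x : R, is_derive x 1 G (g x)) -> G x @[x --> +oo] --> k ->
    (\int[lebesgue_measure]_(x in `[0%R, +oo[) (g x)%:E = k%:E - (G 0)%:E)%E.
  move=> g0 cg dG Gk; apply: (@ge0_continuous_FTC2y _ g G 0 k) => //.
  - exact: continuous_subspaceT.
  - apply: cvg_at_right_filter; apply: differentiable_continuous.
    by apply/derivable1_diffP; have := dG 0 => -[].
  - by move=> x _; rewrite derive1E; have := dG x => -[].
rewrite -(setUv (`[0, +oo[%classic : set R)) ge0_integral_setU//=; last 4 first.
- exact: measurableC.
- by rewrite setUv; exact/measurable_EFinP.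
- by move=> x _; rewrite lee_fin.
- exact/disj_setPCl.
rewrite (half f F l)//.
rewrite setCitvr integral_itv_bndo_bndc//; last exact/measurable_EFinP/measurable_funTS.
have := @ge0_integration_by_substitutionNy R f 0.
rewrite oppr0 => -> //; last exact: continuous_subspaceT.
have dN (x : R) : is_derive x 1 (fun x => - F (- x)) ((f \o -%R) x).
  have dFx := dF (- x).
  have -> : (f \o -%R) x = - (f (- x) * -1) by rewrite /= ; ring.
  apply: is_deriveN; exact: (is_derive1_comp (f := F) (g := -%R)).
rewrite (half _ _ (- m) _ _ dN).
- by rewrite oppr0 -EFinB -EFinB -EFinD; congr EFin; ring.
- by move=> x; exact: f0.
- move=> x; apply: continuous_comp; [exact: opp_continuous | exact: cf].
- by apply: cvgN; exact/cvgNy_compNP.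
Qed.

(** * Integrals against the Cauchy kernel *)

Section CauchyKernel.
Context {R : realType}.
Implicit Types a c d e k s t x : R.

Lemma sqrD_gt0 c e x : 0 < e -> 0 < (x - c) ^+ 2 + e ^+ 2.
Proof. by move=> e0; rewrite ltr_wpDl ?sqr_ge0 ?exprn_gt0. Qed.

Lemma is_derive_ln_quad c e x : 0 < e ->
  is_derive x 1 (fun t => ln ((t - c) ^+ 2 + e ^+ 2))
    (2 * (x - c) / ((x - c) ^+ 2 + e ^+ 2)).
Proof.
move=> e0; have X0 := sqrD_gt0 c x e0.
have dg : is_derive x 1 (fun t => (t - c) ^+ 2 + e ^+ 2) (2 * (x - c)).
  apply: is_derive_eq; rewrite /GRing.scale /=; ring.
apply: is_derive_eq.
  exact: (is_derive1_comp (f := @ln R) (g := fun t => (t - c) ^+ 2 + e ^+ 2)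
          (is_derive1_ln X0) dg).
by rewrite mulrC.
Qed.

Lemma is_derive_atan_affine c e x : e != 0 ->
  is_derive x 1 (fun t => atan ((t - c) / e)) (e / ((x - c) ^+ 2 + e ^+ 2)).
Proof.
move=> e0.
have dg : is_derive x 1 (fun t => (t - c) / e) e^-1.
  apply: is_derive_eq; rewrite /GRing.scale /=; ring.
apply: is_derive_eq.
field.
have : 0 < (x - c) ^+ 2 + e ^+ 2 by rewrite ltr_wpDl ?sqr_ge0 ?exprn_even_gt0 ?e0.
by move=> /lt0r_neq0 h; rewrite e0 h.
Qed.

Lemma cvgy_atan_affine c e : 0 < e -> atan ((t - c) / e) @[t --> +oo] --> pi / 2.
Proof.
move=> e0; have h : (t - c) / e @[t --> +oo] --> +oo.
  apply: gt0_cvgMly; first by rewrite invr_gt0.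
  exact: cvg_addrr.
have := cvg_comp _ (@atan R) h (@cvgy_atan R). exact.
Qed.

Lemma cvgNy_atan_affine c e : 0 < e -> atan ((t - c) / e) @[t --> -oo] --> - (pi / 2).
Proof.
move=> e0; apply/cvgNy_compNP.
have -> : (fun t => atan ((t - c) / e)) \o -%R = (fun t => - atan ((t - (- c)) / e)).
  by apply/funext => t /=; rewrite -atanN; congr atan; ring.
by apply: cvgN; exact: cvgy_atan_affine.
Qed.

Lemma cvgy_invB d : (t - d)^-1 @[t --> +oo] --> (0 : R).
Proof.
apply/gtr0_cvgV0; last exact: cvg_addrr.
near=> t; rewrite subr_gt0; near: t; apply: nbhs_pinfty_gt; exact: num_real.
Unshelve. all: by end_near. Qed.

Lemma cvgy_ln_quad_ratio c d e k : 0 < e -> 0 < k ->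
  ln ((t - c) ^+ 2 + e ^+ 2) - ln ((t - d) ^+ 2 + k ^+ 2) @[t --> +oo] --> (0 : R).
Proof.
move=> e0 k0; have v0 := @cvgy_invB d.
pose P (v : R) := (1 + 2 * (d - c) * v + ((d - c) ^+ 2 + e ^+ 2) * (v * v))
  / (1 + k ^+ 2 * (v * v)).
have cP : P ((t - d)^-1) @[t --> +oo] --> (1 : R).
  rewrite (_ : 1 = (1 + 2 * (d - c) * 0 + ((d - c) ^+ 2 + e ^+ 2) * (0 * 0))
    / (1 + k ^+ 2 * (0 * 0))); last by rewrite !mulr0 !addr0 divr1.
  pose proof (cvgM v0 v0) as vv.
  pose proof (cvgD (cvgD (cvg_cst (1 : R)) (cvgM (cvg_cst (2 * (d - c))) v0))
                  (cvgM (cvg_cst ((d - c) ^+ 2 + e ^+ 2)) vv)) as cN.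
  pose proof (cvgD (cvg_cst (1 : R)) (cvgM (cvg_cst (k ^+ 2)) vv)) as cD.
  by apply: (cvgM cN (cvgV _ cD)); rewrite !mulr0 addr0 oner_eq0.
rewrite -(@ln1 R).
apply: (cvg_trans _ (continuous_cvg _ (continuous_ln (@ltr01 R)) cP)).
apply: near_eq_cvg; near=> t.
have td : t - d != 0.
  rewrite subr_eq0 gt_eqF//; near: t; apply: nbhs_pinfty_gt; exact: num_real.
have h1 := sqrD_gt0 c t e0; have h2 := sqrD_gt0 d t k0.
rewrite /= -ln_div ?posrE//; congr ln; rewrite /P; field.
by rewrite td (lt0r_neq0 h2).
Unshelve. all: by end_near. Qed.

Lemma cvgNy_ln_quad_ratio c d e k : 0 < e -> 0 < k ->
  ln ((t - c) ^+ 2 + e ^+ 2) - ln ((t - d) ^+ 2 + k ^+ 2) @[t --> -oo] --> (0 : R).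
Proof.
move=> e0 k0; apply/cvgNy_compNP.
have -> : (fun t => ln ((t - c) ^+ 2 + e ^+ 2) - ln ((t - d) ^+ 2 + k ^+ 2)) \o -%R =
    (fun t => ln ((t - (- c)) ^+ 2 + e ^+ 2) - ln ((t - (- d)) ^+ 2 + k ^+ 2)).
  by apply/funext => t /=; congr (ln _ - ln _); ring.
exact: cvgy_ln_quad_ratio.
Qed.

End CauchyKernel.

Section CauchyIntegrals.
Context {R : realType}.
Implicit Types a c d e k s t x : R.
Local Notation mu := (@lebesgue_measure R).

Lemma continuous_inv_quad c e : 0 < e -> continuous (fun t => ((t - c) ^+ 2 + e ^+ 2)^-1).
Proof.
move=> e0 t; apply: cvgV; first by rewrite lt0r_neq0 ?sqrD_gt0.
have h : {for t, continuous (fun t => (t - c) ^+ 2 + e ^+ 2)}.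
  apply: differentiable_continuous; apply/derivable1_diffP; exact: ex_derive.
exact: h.
Qed.

(* The partial fractions of the integrand degenerate when [a = 0] and [e = s]. *)
Lemma integral_cauchy_conv a e s : 0 < e -> 0 < s ->
  (\int[mu]_t (((t - a) ^+ 2 + e ^+ 2)^-1 * ((t - 0) ^+ 2 + s ^+ 2)^-1)%:E =
   (pi * (e + s) / (e * s * (a ^+ 2 + (e + s) ^+ 2)))%:E)%E.
Proof.
move=> e0 s0.
have X0 x := sqrD_gt0 a x e0; have Y0 x := sqrD_gt0 0 x s0.
have cf : continuous (fun t => ((t - a) ^+ 2 + e ^+ 2)^-1 * ((t - 0) ^+ 2 + s ^+ 2)^-1).
  by move=> t; apply: cvgM; exact: continuous_inv_quad.
have f0 x : 0 <= ((x - a) ^+ 2 + e ^+ 2)^-1 * ((x - 0) ^+ 2 + s ^+ 2)^-1.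
  by rewrite mulr_ge0 ?invr_ge0 ?ltW.
have es0 : a ^+ 2 + (e + s) ^+ 2 != 0.
  by rewrite lt0r_neq0// ltr_wpDl ?sqr_ge0// exprn_gt0// addr_gt0.
have [D0|D0] := eqVneq (a ^+ 2 + (e - s) ^+ 2) 0.
  have [a0 es] : a = 0 /\ e = s.
    have := D0 => /eqP; rewrite paddr_eq0 ?sqr_ge0// !sqrf_eq0 subr_eq0.
    by move=> /andP[/eqP -> /eqP ->].
  subst a; subst e.
  pose F t := (2 * s ^+ 2)^-1 * (t * ((t - 0) ^+ 2 + s ^+ 2)^-1 + s^-1 * atan ((t - 0) / s)).
  have limY : (fun t : R => t * ((t - 0) ^+ 2 + s ^+ 2)^-1) @ +oo --> (0 : R).
    pose proof (@cvgy_invB R 0) as v0.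
    have z : 1 + s ^+ 2 * (0 * 0) != 0 by rewrite !mulr0 addr0 oner_eq0.
    pose proof (cvgM v0 (cvgV z (cvgD (cvg_cst (1 : R)) (cvgM (cvg_cst (s ^+ 2)) (cvgM v0 v0))))) as H.
    rewrite !mul0r in H.
    apply: (cvg_trans _ H); apply: near_eq_cvg; near=> t => /=.
    have t0 : t != 0.
      by rewrite gt_eqF//; near: t; apply: nbhs_pinfty_gt; exact: num_real.
    have := lt0r_neq0 (Y0 t); rewrite !subr0 => h.
    change (t^-1 / (1 + s ^+ 2 * ((t - 0)^-1 * (t - 0)^-1)) = t / (t ^+ 2 + s ^+ 2)); by rewrite subr0; field; rewrite t0 h.
  have limNY : (fun t : R => t * ((t - 0) ^+ 2 + s ^+ 2)^-1) @ -oo --> (0 : R).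
    apply/cvgNy_compNP.
    have -> : (fun t : R => t * ((t - 0) ^+ 2 + s ^+ 2)^-1) \o -%R =
       (fun t : R => - (t * ((t - 0) ^+ 2 + s ^+ 2)^-1)).
      by apply/funext => t /=; rewrite !subr0 sqrrN mulNr.
    pose proof (cvgN limY) as H; by apply: (cvg_trans H); rewrite oppr0.
  have dF (x : R) : is_derive x 1 F
      (((x - 0) ^+ 2 + s ^+ 2)^-1 * ((x - 0) ^+ 2 + s ^+ 2)^-1).
    have h3 := is_derive_atan_affine 0 x (lt0r_neq0 s0).
    have dX : is_derive x 1 (fun t => (t - 0) ^+ 2 + s ^+ 2) (2 * (x - 0)).
      by apply: is_derive_eq; rewrite /GRing.scale /=; ring.
    have h4 := is_deriveV (f := fun t => (t - 0) ^+ 2 + s ^+ 2) (lt0r_neq0 (Y0 x)) dX.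
    rewrite /F; apply: is_derive_eq; rewrite /GRing.scale /=; field.
    have := lt0r_neq0 (Y0 x); rewrite !subr0 => h.
    by rewrite (lt0r_neq0 s0) h.
  have Fy : F x @[x --> +oo] --> (2 * s ^+ 2)^-1 * (0 + s^-1 * (pi / 2)).
    by apply: cvgMr; apply: cvgD; [exact: limY|apply: cvgMr; exact: cvgy_atan_affine].
  have FNy : F x @[x --> -oo] --> (2 * s ^+ 2)^-1 * (0 + s^-1 * (- (pi / 2))).
    by apply: cvgMr; apply: cvgD; [exact: limNY|apply: cvgMr; exact: cvgNy_atan_affine].
  rewrite (ge0_continuous_FTC2T f0 cf dF Fy FNy).
  congr EFin; field; by rewrite (lt0r_neq0 s0) lt0r_neq0 // addr_gt0.
pose D := (a ^+ 2 + (e + s) ^+ 2) * (a ^+ 2 + (e - s) ^+ 2).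
pose F t := a / D * (ln ((t - 0) ^+ 2 + s ^+ 2) - ln ((t - a) ^+ 2 + e ^+ 2))
  + (a ^+ 2 + e ^+ 2 - s ^+ 2) / (D * s) * atan ((t - 0) / s)
  + (a ^+ 2 + s ^+ 2 - e ^+ 2) / (D * e) * atan ((t - a) / e).
have dF (x : R) : is_derive x 1 F
    (((x - a) ^+ 2 + e ^+ 2)^-1 * ((x - 0) ^+ 2 + s ^+ 2)^-1).
  have h1 := is_derive_ln_quad 0 x s0; have h2 := is_derive_ln_quad a x e0.
  have h3 := is_derive_atan_affine 0 x (lt0r_neq0 s0).
  have h4 := is_derive_atan_affine a x (lt0r_neq0 e0).
  rewrite /F; apply: is_derive_eq; rewrite /GRing.scale /= /D; field.
  have := Y0 x; rewrite subr0 => /lt0r_neq0 ->.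
  by rewrite (lt0r_neq0 s0) (lt0r_neq0 e0) D0 es0 (lt0r_neq0 (X0 _)).
have Fy : F x @[x --> +oo] -->
    a / D * 0 + (a ^+ 2 + e ^+ 2 - s ^+ 2) / (D * s) * (pi / 2)
      + (a ^+ 2 + s ^+ 2 - e ^+ 2) / (D * e) * (pi / 2).
  by apply: cvgD; [apply: cvgD|]; apply: cvgMr;
    [exact: cvgy_ln_quad_ratio|exact: cvgy_atan_affine..].
have FNy : F x @[x --> -oo] -->
    a / D * 0 + (a ^+ 2 + e ^+ 2 - s ^+ 2) / (D * s) * (- (pi / 2))
      + (a ^+ 2 + s ^+ 2 - e ^+ 2) / (D * e) * (- (pi / 2)).
  by apply: cvgD; [apply: cvgD|]; apply: cvgMr;
    [exact: cvgNy_ln_quad_ratio|exact: cvgNy_atan_affine..].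
rewrite (ge0_continuous_FTC2T f0 cf dF Fy FNy).
congr EFin; rewrite /D; field.
by rewrite (lt0r_neq0 s0) (lt0r_neq0 e0) D0 es0.
Unshelve. all: by end_near. Qed.

Lemma integral_cauchy s : 0 < s ->
  (\int[mu]_t ((t ^+ 2 + s ^+ 2)^-1)%:E = (pi / s)%:E)%E.
Proof.
move=> s0.
have dF (x : R) : is_derive x 1 (fun t => s^-1 * atan ((t - 0) / s)) ((x ^+ 2 + s ^+ 2)^-1).
  have h3 := is_derive_atan_affine 0 x (lt0r_neq0 s0).
  apply: is_derive_eq; rewrite /GRing.scale /= subr0; field.
  have := sqrD_gt0 0 x s0; rewrite subr0 => /lt0r_neq0 ->.
  by rewrite (lt0r_neq0 s0).
pose proof (cvgMr (a := s^-1) (cvgy_atan_affine 0 s0)) as Fy.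
pose proof (cvgMr (a := s^-1) (cvgNy_atan_affine 0 s0)) as FNy.
have cf : continuous (fun t => (t ^+ 2 + s ^+ 2)^-1).
  have := @continuous_inv_quad 0 s s0.
  by rewrite (_ : (fun t => _) = (fun t => (t ^+ 2 + s ^+ 2)^-1))//; apply/funext => t; rewrite subr0.
rewrite (ge0_continuous_FTC2T _ cf dF Fy FNy).
  by congr EFin; field; rewrite lt0r_neq0.
by move=> x; rewrite invr_ge0 addr_ge0 ?sqr_ge0.
Qed.

(** The right hand side is the difference of the values of [pi / s * Re (i s - a)^2] at [s1] and
    [s2], as Poisson's formula predicts for this harmonic function. *)
Lemma integral_sqr_cauchyB a s1 s2 : 0 < s1 -> s1 < s2 ->
  (\int[mu]_t ((t - a) ^+ 2 * ((t ^+ 2 + s1 ^+ 2)^-1 - (t ^+ 2 + s2 ^+ 2)^-1))%:E =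
   (pi * (s2 - s1 + a ^+ 2 * (s1^-1 - s2^-1)))%:E)%E.
Proof.
move=> s10 s12; have s20 := lt_trans s10 s12.
pose F t := s2 * atan ((t - 0) / s2) - s1 * atan ((t - 0) / s1)
  - a * (ln ((t - 0) ^+ 2 + s1 ^+ 2) - ln ((t - 0) ^+ 2 + s2 ^+ 2))
  + a ^+ 2 * (s1^-1 * atan ((t - 0) / s1) - s2^-1 * atan ((t - 0) / s2)).
have dF (x : R) : is_derive x 1 F
   ((x - a) ^+ 2 * ((x ^+ 2 + s1 ^+ 2)^-1 - (x ^+ 2 + s2 ^+ 2)^-1)).
  have h1 := is_derive_atan_affine 0 x (lt0r_neq0 s10).
  have h2 := is_derive_atan_affine 0 x (lt0r_neq0 s20).
  have h3 := is_derive_ln_quad 0 x s10; have h4 := is_derive_ln_quad 0 x s20.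
  rewrite /F; apply: is_derive_eq; rewrite /GRing.scale /= !subr0; field.
  have := sqrD_gt0 0 x s10; rewrite subr0 => /lt0r_neq0 ->.
  have := sqrD_gt0 0 x s20; rewrite subr0 => /lt0r_neq0 ->.
  by rewrite (lt0r_neq0 s10) (lt0r_neq0 s20).
have Fy : F x @[x --> +oo] --> s2 * (pi / 2) - s1 * (pi / 2) - a * 0
    + a ^+ 2 * (s1^-1 * (pi / 2) - s2^-1 * (pi / 2)).
  apply: cvgD; [apply: cvgB; [apply: cvgB|]|apply: cvgMr; apply: cvgB]; apply: cvgMr;
    first [exact: cvgy_atan_affine|exact: cvgy_ln_quad_ratio].
have FNy : F x @[x --> -oo] --> s2 * (- (pi / 2)) - s1 * (- (pi / 2)) - a * 0
    + a ^+ 2 * (s1^-1 * (- (pi / 2)) - s2^-1 * (- (pi / 2))).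
  apply: cvgD; [apply: cvgB; [apply: cvgB|]|apply: cvgMr; apply: cvgB]; apply: cvgMr;
    first [exact: cvgNy_atan_affine|exact: cvgNy_ln_quad_ratio].
have c0 s : 0 < s -> continuous (fun t => (t ^+ 2 + s ^+ 2)^-1).
  move=> s0; have := @continuous_inv_quad 0 s s0.
  by rewrite (_ : (fun t => _) = (fun t => (t ^+ 2 + s ^+ 2)^-1))//; apply/funext => t; rewrite subr0.
have cf : continuous (fun t => (t - a) ^+ 2 * ((t ^+ 2 + s1 ^+ 2)^-1 - (t ^+ 2 + s2 ^+ 2)^-1)).
  move=> t; apply: cvgM; last by apply: cvgB; exact: c0.
  have h : {for t, continuous (fun t => (t - a) ^+ 2)}.
    apply: differentiable_continuous; apply/derivable1_diffP; exact: ex_derive.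
  exact: h.
rewrite (ge0_continuous_FTC2T _ cf dF Fy FNy).
  by congr EFin; field; rewrite !lt0r_neq0.
move=> x; rewrite mulr_ge0 ?sqr_ge0// subr_ge0 lef_pV2 ?posrE.
- by rewrite lerD2l ler_pXn2r ?nnegrE ?ltW.
- by have := sqrD_gt0 0 x s20; rewrite subr0.
- by have := sqrD_gt0 0 x s10; rewrite subr0.
Qed.

End CauchyIntegrals.

Lemma measurable_fun_invr_ge0 d (T : measurableType d) (R : realType) (f : T -> R) :
  measurable_fun setT f -> (forall x, 0 <= f x) ->
  measurable_fun setT (fun x => (f x)^-1).
Proof.
move=> mf f0; rewrite (_ : (fun x => _) = (fun x => f x `^ (-1))).
  exact (measurableT_comp (measurable_powR (-1)) mf).
by apply/funext => x; rewrite powR_inv1.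
Qed.

Section LogIntegral.
Context {R : realType}.
Implicit Types a b B s t x y : R.
Local Notation mu := (@lebesgue_measure R).

Lemma integral_quad_inv a t b B : 0 <= b -> b < B -> t != a ->
  (\int[mu]_(y in `[b, B]) (y * ((t - a) ^+ 2 + y ^+ 2)^-1)%:E =
   (2^-1 * (ln ((t - a) ^+ 2 + B ^+ 2) - ln ((t - a) ^+ 2 + b ^+ 2)))%:E)%E.
Proof.
move=> b0 bB ta.
have X0 y : 0 < (t - a) ^+ 2 + y ^+ 2.
  by rewrite ltr_pwDl ?sqr_ge0// exprn_even_gt0//= subr_eq0.
have dF (y : R) : is_derive y 1 (fun y => 2^-1 * ln ((t - a) ^+ 2 + y ^+ 2))
    (y * ((t - a) ^+ 2 + y ^+ 2)^-1).
  have dg : is_derive y 1 (fun y => (t - a) ^+ 2 + y ^+ 2) (2 * y).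
    by apply: is_derive_eq; rewrite /GRing.scale /=; ring.
  have dl := is_derive1_comp (f := @ln R) (g := fun y => (t - a) ^+ 2 + y ^+ 2)
    (is_derive1_ln (X0 y)) dg.
  have := is_deriveZ (2^-1) dl; rewrite /GRing.scale /= => dz.
  by apply: is_derive_eq; field; rewrite lt0r_neq0.
have cX y : {for y, continuous (fun y => (t - a) ^+ 2 + y ^+ 2)}.
  apply: differentiable_continuous; apply/derivable1_diffP; exact: ex_derive.
rewrite (@continuous_FTC2 _ _ (fun y => 2^-1 * ln ((t - a) ^+ 2 + y ^+ 2)) b B)//.
- by rewrite -EFinB -mulrBr.
- apply: continuous_subspaceT => y; apply: cvgM; first exact: cvg_id.
  by apply: cvgV; [rewrite lt0r_neq0|exact: cX].
- have dc (y : R) : {for y, continuous (fun y => 2^-1 * ln ((t - a) ^+ 2 + y ^+ 2))}.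
    by apply: differentiable_continuous; apply/derivable1_diffP; case: (dF y).
  split.
  + by move=> y _; case: (dF y).
  + by apply: cvg_at_right_filter; exact: dc.
  + by apply: cvg_at_left_filter; exact: dc.
- by move=> y _; rewrite derive1E; case: (dF y).
Qed.

Lemma integral_cauchy_sum a s b B : 0 < s -> 0 <= b -> b < B ->
  (\int[mu]_(y in `[b, B]) (pi / s * ((y + s) * (a ^+ 2 + (y + s) ^+ 2)^-1))%:E =
   (pi / s * (2^-1 * (ln (a ^+ 2 + (B + s) ^+ 2) - ln (a ^+ 2 + (b + s) ^+ 2))))%:E)%E.
Proof.
move=> s0 b0 bB.
pose F y := pi / s * (2^-1 * ln (a ^+ 2 + (y + s) ^+ 2)).
have X0 y : b <= y -> 0 < a ^+ 2 + (y + s) ^+ 2.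
  by move=> by_; rewrite ltr_wpDl ?sqr_ge0// exprn_gt0//; lra.
have dX (y : R) : is_derive y 1 (fun y => a ^+ 2 + (y + s) ^+ 2) (2 * (y + s)).
  by apply: is_derive_eq; rewrite /GRing.scale /=; ring.
have dF (y : R) : b <= y ->
  is_derive y 1 F (pi / s * ((y + s) * (a ^+ 2 + (y + s) ^+ 2)^-1)).
  move=> by_; have := is_derive1_comp (f := @ln R) (g := fun y => a ^+ 2 + (y + s) ^+ 2)
    (is_derive1_ln (X0 y by_)) (dX y) => dl.
  have := is_deriveZ (2^-1) dl; rewrite /GRing.scale /= => dz.
  have := is_deriveZ (pi / s) dz; rewrite /GRing.scale /= => dz2.
  by apply: is_derive_eq; field; rewrite !lt0r_neq0// X0.
have cX (y : R) : {for y, continuous (fun y => a ^+ 2 + (y + s) ^+ 2)}.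
  by apply: differentiable_continuous; apply/derivable1_diffP; case: (dX y).
rewrite (@continuous_FTC2 _ _ F b B)//.
- by rewrite -EFinB /F -!mulrBr.
- apply: (@continuous_in_subspaceT _ _ _ _) => y; rewrite inE/= in_itv/= => /andP[by_ _].
  apply: cvgM; first exact: cvg_cst.
  apply: cvgM; first by apply: cvgD; [exact: cvg_id|exact: cvg_cst].
  by apply: cvgV; [rewrite lt0r_neq0// X0|exact: cX].
- have dc (y : R) : b <= y -> {for y, continuous F}.
    by move=> by_; apply: differentiable_continuous; apply/derivable1_diffP; case: (dF y by_).
  split.
  + by move=> y; rewrite in_itv/= => /andP[by_ _]; case: (dF y (ltW by_)).
  + by apply: cvg_at_right_filter; exact: dc.
  + by apply: cvg_at_left_filter; exact: dc (ltW bB).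
- by move=> y; rewrite in_itv/= => /andP[by_ _]; rewrite derive1E; case: (dF y (ltW by_)).
Qed.

(** Half the difference of the logarithms is the integral of [y / ((t - a)^2 + y^2)] for [y] from
    [b] to [B]. Tonelli's theorem exchanges the two integrals, and the integral in [t] is a
    convolution of two Cauchy kernels. *)
Lemma integral_log_cauchy a s b B : 0 < s -> 0 <= b -> b < B ->
  (\int[mu]_t (2^-1 * (ln ((t - a) ^+ 2 + B ^+ 2) - ln ((t - a) ^+ 2 + b ^+ 2))
      * (t ^+ 2 + s ^+ 2)^-1)%:E =
   (pi / s * (2^-1 * (ln (a ^+ 2 + (B + s) ^+ 2) - ln (a ^+ 2 + (b + s) ^+ 2))))%:E)%E.
Proof.
move=> s0 b0 bB.
(* The interval is open at [b] so that [y > 0] on it even when [b = 0]. *)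
pose D := `]b, B]%classic : set R.
have mD : measurable D by exact: measurable_itv.
pose h (p : measurableTypeR R * measurableTypeR R) : \bar R :=
  (p.2 * ((p.1 - a) ^+ 2 + p.2 ^+ 2)^-1 * (p.1 ^+ 2 + s ^+ 2)^-1 * \1_D p.2)%:E.
have h0 p : (0 <= h p)%E.
  rewrite /h lee_fin indicE; case: (boolP (p.2 \in D)); last by rewrite mulr0.
  rewrite inE /D /= in_itv /= => /andP[bp _].
  have p0 : 0 <= p.2 by rewrite ltW// (le_lt_trans b0).
  by rewrite mulr1; do 2?apply: mulr_ge0 => //; rewrite invr_ge0 addr_ge0 ?sqr_ge0.
have m1 : measurable_fun setT (fst : measurableTypeR R * measurableTypeR R -> measurableTypeR R).
  exact: measurable_fst.
have m2 : measurable_fun setT (snd : measurableTypeR R * measurableTypeR R -> measurableTypeR R).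
  exact: measurable_snd.
have mh : measurable_fun setT h.
  apply/measurable_EFinP; apply: measurable_funM; last first.
    exact: measurableT_comp m2.
  apply: measurable_funM; [apply: measurable_funM => //|]; apply: measurable_fun_invr_ge0.
  - apply: measurable_funD; apply: measurable_funX => //.
    exact: measurable_funB.
  - by move=> p; rewrite addr_ge0 ?sqr_ge0.
  - by apply: measurable_funD => //; apply: measurable_funX.
  - by move=> p; rewrite addr_ge0 ?sqr_ge0.
have hD t y : (h (t, y) = (fun y => ((t ^+ 2 + s ^+ 2)^-1 *
    (y * ((t - a) ^+ 2 + y ^+ 2)^-1))%:E) \_ D y)%E.
  rewrite patchE /h /= indicE; case: (boolP (y \in D)) => _; last by rewrite mulr0.
  by congr EFin; rewrite mulr1 mulrC.
have mq t : measurable_fun setT (fun y : R => y * ((t - a) ^+ 2 + y ^+ 2)^-1).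
  apply: measurable_funM => //; apply: measurable_fun_invr_ge0 => [|y].
    by apply: measurable_funD => //; exact: measurable_funX.
  by rewrite addr_ge0 ?sqr_ge0.
transitivity (\int[mu]_t \int[mu]_y h (t, y))%E.
  apply: ae_eq_integral => //.
  - apply/measurable_EFinP; apply: measurable_funM; last first.
      apply: measurable_fun_invr_ge0 => [|x]; last by rewrite addr_ge0 ?sqr_ge0.
      by apply: measurable_funD => //; exact: measurable_funX.
    apply: measurable_funM => //; apply: measurable_funB; apply: measurableT_comp => //;
      apply: measurable_funD => //; apply: measurable_funX; exact: measurable_funB.
  - exact: (measurable_fun_fubini_tonelli_F h).
  (* For [b = 0] and [t = a] the inner integral diverges whereas [ln 0] is 0, so the integrands
     agree only almost everywhere. *)
  - exists [set a]; split; [exact: measurable_set1|exact: lebesgue_measure_set1|].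
    move=> t /= ht; apply: contrapT => /eqP ta; apply: ht => _.
    under [RHS]eq_integral do rewrite hD.
    rewrite -integral_mkcond integral_itv_obnd_cbnd; last first.
      by apply/measurable_EFinP/measurable_funTS/measurable_funM.
    under [RHS]eq_integral do rewrite EFinM.
    rewrite ge0_integralZl_EFin//.
    + by rewrite integral_quad_inv// -EFinM mulrC.
    + by move=> y; rewrite /= in_itv /= => /andP[by_ _];
        rewrite lee_fin mulr_ge0 ?invr_ge0 ?addr_ge0 ?sqr_ge0// (le_trans b0).
    + apply/measurable_EFinP; apply: measurable_funTS; apply: mq.
    + by rewrite invr_ge0 addr_ge0 ?sqr_ge0.
rewrite (fubini_tonelli h)//.
rewrite -integral_cauchy_sum// -integral_itv_obnd_cbnd; last first.
  apply/measurable_EFinP/measurable_funTS/measurable_funM => //.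
  apply: measurable_funM; first exact: measurable_funD.
  apply: measurable_fun_invr_ge0 => [|y]; last by rewrite addr_ge0 ?sqr_ge0.
  by apply: measurable_funD => //; apply: measurable_funX; exact: measurable_funD.
rewrite [RHS]integral_mkcond; apply: eq_integral => y _.
rewrite patchE; case: ifPn => [|yD]; last first.
  by rewrite integral0_eq// => t _; rewrite hD patchE (negbTE yD).
rewrite inE /D /= in_itv /= => /andP[by_ yB].
have y0 : 0 < y by exact: le_lt_trans by_.
have yD : y \in D by rewrite inE /D /= in_itv /= by_ yB.
transitivity (\int[mu]_t (y%:E *
    (((t - a) ^+ 2 + y ^+ 2)^-1 * ((t - 0) ^+ 2 + s ^+ 2)^-1)%:E))%E.
  by apply: eq_integral => t _; rewrite hD patchE yD -EFinM subr0; congr EFin; ring.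
rewrite ge0_integralZl_EFin//.
- rewrite integral_cauchy_conv// -EFinM; congr EFin; field.
  by rewrite !lt0r_neq0// ltr_wpDl ?sqr_ge0// exprn_gt0// addr_gt0.
- by move=> t _; rewrite lee_fin mulr_ge0// invr_ge0 addr_ge0 ?sqr_ge0.
- apply/measurable_EFinP/measurable_funM; apply: measurable_fun_invr_ge0 => [|t];
    rewrite ?addr_ge0 ?sqr_ge0//; apply: measurable_funD => //; apply: measurable_funX;
    exact: measurable_funB.
- exact: ltW.
Qed.

End LogIntegral.

(** * A single primary factor *)

Section Theta.
Context {R : realType}.
Implicit Types X : R.

(* [-log |E(w)| = theta (|1 - w|^2) - |w|^2 / 2]; unlike [-log |E(w)|], theta is nonnegative. *)
Definition rtheta X : R := (X - 1) / 2 - ln X / 2.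

(** Since [ln 0] is 0, the value at a zero of the factor has to be imposed; with +oo the potential
    becomes -oo there, like log |Pi|. *)
Definition theta X : \bar R := if X <= 0 then +oo%E else (rtheta X)%:E.

Lemma ln_leB1 X : 0 < X -> ln X <= X - 1.
Proof. by move=> X0; rewrite -[in ln X](subrK 1 X) addrC le_ln1Dx//; lra. Qed.

Lemma ln_ge1BV X : 0 < X -> 1 - X^-1 <= ln X.
Proof.
move=> X0; have : 0 < X^-1 by rewrite invr_gt0.
by move=> /ln_leB1; rewrite lnV// => h; lra.
Qed.

Lemma rtheta_ge0 X : 0 < X -> 0 <= rtheta X.
Proof. by move=> /ln_leB1 h; rewrite /rtheta; lra. Qed.

Lemma theta_pos X : 0 < X -> theta X = (rtheta X)%:E.
Proof. by move=> X0; rewrite /theta leNgt X0. Qed.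

Lemma theta_ge0 X : (0 <= theta X)%E.
Proof. 
by rewrite /theta; case: ifPn => //; rewrite -ltNge => X0; rewrite lee_fin rtheta_ge0.
 Qed.

Lemma theta1 : theta 1 = 0%E.
Proof. by rewrite theta_pos// /rtheta ln1 subrr !mul0r subr0. Qed.

(** The second order vanishing at [X = 1] is what lets the boundary term at a small height disappear
    in the limit. *)
Lemma rtheta_le X : 0 < X -> rtheta X <= (X - 1) ^+ 2 / (2 * X).
Proof.
move=> X0; have := ln_ge1BV X0; rewrite /rtheta => h.
have -> : (X - 1) ^+ 2 / (2 * X) = (X - 1) / 2 - (1 - X^-1) / 2.
  by field; rewrite lt0r_neq0.
lra.
Qed.

Lemma measurable_fun_theta d (T : measurableType d) (f : T -> R) :
  measurable_fun setT f -> measurable_fun setT (fun x => theta (f x)).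
Proof.
move=> mf; apply: measurable_fun_ifT; first exact: measurable_fun_ler.
  exact: measurable_cst.
apply/measurable_EFinP; apply: measurable_funB.
  by apply: measurable_funM => //; exact: measurable_funB.
by apply: measurable_funM => //; exact: measurableT_comp.
Qed.

End Theta.

(** * Carleman's identity for one factor *)

Section FactorIdentity.
Context {R : realType}.
Implicit Types a b c p m s t x y A B : R.
Local Notation mu := (@lebesgue_measure R).

Definition cauchyB s1 s2 t : R := (t ^+ 2 + s1 ^+ 2)^-1 - (t ^+ 2 + s2 ^+ 2)^-1.

Lemma cauchy_gt0 s t : 0 < s -> 0 < (t ^+ 2 + s ^+ 2)^-1.
Proof. by move=> s0; rewrite invr_gt0 ltr_wpDl ?sqr_ge0 ?exprn_gt0. Qed.

Lemma cauchyB_ge0 s1 s2 t : 0 < s1 -> s1 < s2 -> 0 <= cauchyB s1 s2 t.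
Proof.
move=> s10 s12; have s20 := lt_trans s10 s12.
rewrite subr_ge0 lef_pV2 ?posrE ?ltr_wpDl ?sqr_ge0 ?exprn_gt0//.
by rewrite lerD2l ler_pXn2r ?nnegrE ?ltW.
Qed.

Lemma measurable_cauchy s : measurable_fun setT (fun t => (t ^+ 2 + s ^+ 2)^-1).
Proof.
apply: measurable_fun_invr_ge0 => [|x]; last by rewrite addr_ge0 ?sqr_ge0.
by apply: measurable_funD => //; exact: measurable_funX.
Qed.

Lemma measurable_cauchyB s1 s2 : measurable_fun setT (cauchyB s1 s2).
Proof. by apply: measurable_funB; exact: measurable_cauchy. Qed.

(* The squared modulus [|1 - (x + i y)(p + i m)|^2]. *)
Definition dist2 p m x y : R := (1 - p * x + m * y) ^+ 2 + (m * x + p * y) ^+ 2.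

Lemma dist2E p m x y : dist2 p m x y =
  1 - 2 * p * x + 2 * m * y + (p ^+ 2 + m ^+ 2) * (x ^+ 2 + y ^+ 2).
Proof. by rewrite /dist2; ring. Qed.

Lemma dist2_ge0 p m x y : 0 <= dist2 p m x y.
Proof. by rewrite addr_ge0 ?sqr_ge0. Qed.

(** For [m >= 0] the zero of the factor, if there is one, lies in the closed lower half plane. *)
Lemma dist2_gt0 p m x y : 0 <= m -> 0 < y -> 0 < dist2 p m x y.
Proof.
move=> m0 y0; rewrite lt0r dist2_ge0 andbT /dist2.
rewrite paddr_eq0 ?sqr_ge0// !sqrf_eq0; apply/negP => /andP[/eqP h1 /eqP h2].
(* For [z = x + i y] and [q = p + i m] this is the imaginary part of [z] times the conjugate of
   [1 - z q], that is, [y + m |z|^2]. *)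
have : (1 + m * y) * y + m * x ^+ 2 = 0.
  have -> : (1 + m * y) * y + m * x ^+ 2 = (1 - p * x + m * y) * y + x * (m * x + p * y) by ring.
  by rewrite h1 h2 mul0r mulr0 addr0.
apply/eqP; rewrite gt_eqF//.
have := mulr_ge0 m0 (sqr_ge0 x); have := mulr_ge0 (mulr_ge0 m0 (ltW y0)) (ltW y0).
nra.
Qed.


(** Serves to let the auxiliary height [B] go to infinity in [integral_theta_quad], where the
    quantity to be shown zero does not depend on [B]. *)
Lemma eq0_le_inv (d K B0 : R) : 0 < B0 -> (forall B, B0 <= B -> `|d| <= K / B) -> d = 0.
Proof.
move=> B00 h; apply/eqP; apply: contrapT => /negP d0.
have dp : 0 < `|d| by rewrite normr_gt0.
have K0 : 0 <= K by have := le_trans (normr_ge0 d) (h B0 (lexx _)); rewrite pmulr_lge0 ?invr_gt0.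
have t0 : 0 < (K + 1) / `|d| by rewrite divr_gt0// ltr_wpDl.
have Bp : 0 < B0 + (K + 1) / `|d| by rewrite addr_gt0.
have : B0 <= B0 + (K + 1) / `|d| by rewrite lerDl ltW.
move=> /h; rewrite ler_pdivlMr// mulrDr (mulrC `|d| (_ / _)) divfK ?gt_eqF//.
by have := mulr_gt0 dp B00; lra.
Qed.

Lemma ln_quad_bounds a s B : 0 < s -> 1 <= B ->
  0 <= 2^-1 * ln (a ^+ 2 + (B + s) ^+ 2) - ln B <= (2 * s + s ^+ 2 + a ^+ 2) / 2 / B.
Proof.
move=> s0 B1; have B0 : 0 < B by lra.
have Bs : 0 < B + s by lra.
have X0 : 0 < a ^+ 2 + (B + s) ^+ 2 by rewrite ltr_wpDl ?sqr_ge0// exprn_gt0.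
have -> : 2^-1 * ln (a ^+ 2 + (B + s) ^+ 2) - ln B =
    2^-1 * ln ((a ^+ 2 + (B + s) ^+ 2) / B ^+ 2).
  by rewrite ln_div ?posrE ?exprn_gt0// lnXn// -mulr_natr; field.
apply/andP; split.
  rewrite mulr_ge0 ?invr_ge0// ln_ge0// ler_pdivlMr ?exprn_gt0// mul1r.
  by have := sqr_ge0 a; nra.
have : ln ((a ^+ 2 + (B + s) ^+ 2) / B ^+ 2) <= (a ^+ 2 + (B + s) ^+ 2) / B ^+ 2 - 1.
  by rewrite ln_leB1// divr_gt0// exprn_gt0.
move=> h; apply: (@le_trans _ _ (2^-1 * ((a ^+ 2 + (B + s) ^+ 2) / B ^+ 2 - 1))).
  by rewrite ler_pM2l.
have -> : (a ^+ 2 + (B + s) ^+ 2) / B ^+ 2 - 1 = (2 * s + s ^+ 2 / B + a ^+ 2 / B) / B.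
  by field; rewrite gt_eqF.
rewrite mulrA (mulrC 2^-1) ler_pM2r ?invr_gt0// ler_pM2r ?invr_gt0//.
have V1 : B^-1 <= 1 by rewrite invf_le1.
have := ler_pM2l; have := sqr_ge0 s; have := sqr_ge0 a; nra.
Qed.

(* Subtracting the logarithm of the quadratic at a large height [B] leaves an absolutely
   convergent integral, whose error term is at most [(t - a)^2 / (2 B^2)]. *)
Lemma integral_theta_quad a b A s1 s2 : 0 < A -> 0 <= b -> 0 < s1 -> s1 < s2 ->
  (\int[mu]_t (theta (A * ((t - a) ^+ 2 + b ^+ 2)) * (cauchyB s1 s2 t)%:E) =
   (A / 2 * (pi * (s2 - s1 + a ^+ 2 * (s1^-1 - s2^-1)))
    - pi / s1 * (2^-1 * ln (a ^+ 2 + (b + s1) ^+ 2))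
    + pi / s2 * (2^-1 * ln (a ^+ 2 + (b + s2) ^+ 2))
    - pi * (s1^-1 - s2^-1) * (ln A / 2 + 1 / 2 - A * b ^+ 2 / 2))%:E)%E.
Proof.
move=> A0 b0 s10 s12; have s20 := lt_trans s10 s12.
pose X y t := (t - a) ^+ 2 + y ^+ 2.
pose N := cauchyB s1 s2.
pose C s t := (t ^+ 2 + s ^+ 2)^-1.
pose E := [set: R] `\ a.
have mE : measurable E by exact: measurableD.
have X0 y t : E t -> 0 < X y t.
  move=> [_ /eqP ta]; rewrite ltr_pwDl ?sqr_ge0// exprn_even_gt0//= subr_eq0.
  by apply/eqP => ta'; rewrite ta' eqxx in ta.
have N0 t : 0 <= N t by exact: cauchyB_ge0.
have C0 s t : 0 < s -> 0 <= C s t by move=> s0; exact/ltW/cauchy_gt0.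
have mN : measurable_fun setT N by exact: measurable_cauchyB.
have mC s : measurable_fun setT (C s) by exact: measurable_cauchy.
have mX y : measurable_fun setT (X y).
  by apply: measurable_funD => //; apply: measurable_funX; exact: measurable_funB.
have mlnX y : measurable_fun setT (fun t => ln (X y t)) by exact: measurableT_comp.
have msq : measurable_fun setT (fun t : R => (t - a) ^+ 2).
  by apply: measurable_funX; exact: measurable_funB.
pose I_ (f : R -> R) := (\int[mu]_(t in E) (f t)%:E)%E.
have addE (f g : R -> R) : measurable_fun setT f -> measurable_fun setT g ->
    (forall t, E t -> 0 <= f t) -> (forall t, E t -> 0 <= g t) ->
    (I_ (fun t => (f t + g t)%R) = I_ f + I_ g)%E.
  move=> mf mg f0 g0; rewrite -ge0_integralD//.
  - exact/measurable_EFinP/measurable_funTS.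
  - exact/measurable_EFinP/measurable_funTS.
have mulE (k : R) (f : R -> R) : 0 <= k -> measurable_fun setT f ->
    (forall t, E t -> 0 <= f t) -> (I_ (fun t => (k * f t)%R) = k%:E * I_ f)%E.
  move=> k0 mf f0; rewrite -ge0_integralZl_EFin//.
  exact/measurable_EFinP/measurable_funTS.
have fullE (f : R -> R) v : measurable_fun setT f ->
    (\int[mu]_t (f t)%:E = v)%E -> I_ f = v.
  move=> mf <-; rewrite /I_ integral_setD1//.
  exact/measurable_EFinP/measurable_funTS.
have eqE (f g : R -> R) : (forall t, E t -> f t = g t) -> I_ f = I_ g.
  by move=> fg; apply: eq_integral => t; rewrite inE => /fg ->.
(* Differences are integrated by cancelling a finite summand, so that only nonnegative functions are
   ever integrated. *)
have subE (f g h : R -> R) (u v : R) : measurable_fun setT f -> measurable_fun setT g ->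
    (forall t, E t -> 0 <= f t) -> (forall t, E t -> 0 <= g t) ->
    (forall t, E t -> f t + g t = h t) -> I_ g = u%:E -> I_ h = v%:E ->
    I_ f = (v - u)%:E.
  move=> mf mg f0 g0 fgh gu hv.
  have := addE _ _ mf mg f0 g0; rewrite (eqE _ h)// hv gu => hh.
  have fi : I_ f = (I_ f + u%:E - u%:E)%E by rewrite addeK.
  by rewrite fi -hh EFinB.
have iC s : 0 < s -> I_ (C s) = (pi / s)%:E.
  by move=> s0; apply: fullE => //; exact: integral_cauchy.
have iN : I_ N = (pi / s1 - pi / s2)%:E.
  apply: (subE _ (C s2) (C s1)) => //; rewrite ?iC//.
  - by move=> t _; exact: C0.
  - by move=> t _; rewrite /N /cauchyB /C subrK.
set M2 := pi * (s2 - s1 + a ^+ 2 * (s1^-1 - s2^-1)).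
have i2 : I_ (fun t => (t - a) ^+ 2 * N t) = M2%:E.
  apply: fullE; first exact: measurable_funM.
  exact: integral_sqr_cauchyB.
have M20 : 0 <= M2.
  apply: mulr_ge0; first exact: pi_ge0.
  apply: addr_ge0; first by rewrite subr_ge0 ltW.
  by rewrite mulr_ge0 ?sqr_ge0// subr_ge0 lef_pV2 ?posrE// ltW.
pose phi B t := 2^-1 * (ln (X B t) - ln (X b t)).
have phi0 B t : b < B -> E t -> 0 <= phi B t.
  move=> bB Et; rewrite mulr_ge0 ?invr_ge0// subr_ge0 ler_ln ?posrE ?X0// lerD2l.
  by rewrite ler_pXn2r ?nnegrE ?(le_trans b0 (ltW bB))// ltW.
have mphi B : measurable_fun setT (phi B).
  by apply: measurable_funM => //; exact: measurable_funB.
pose LL s B := 2^-1 * (ln (a ^+ 2 + (B + s) ^+ 2) - ln (a ^+ 2 + (b + s) ^+ 2)).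
have iphi B : b < B -> I_ (fun t => phi B t * N t)
    = (pi / s1 * LL s1 B - pi / s2 * LL s2 B)%:E.
  move=> bB.
  apply: (subE _ (fun t => phi B t * C s2 t) (fun t => phi B t * C s1 t)).
  - exact: measurable_funM.
  - exact: measurable_funM.
  - by move=> t Et; rewrite mulr_ge0 ?phi0.
  - by move=> t Et; rewrite mulr_ge0 ?phi0 ?C0.
  - by move=> t _; rewrite -mulrDr; congr (_ * _); rewrite /N /cauchyB /C subrK.
  - by apply: fullE; [exact: measurable_funM|exact: integral_log_cauchy].
  - by apply: fullE; [exact: measurable_funM|exact: integral_log_cauchy].
(* This is [rtheta (X B t / B^2)] written out; it is nonnegative, and its integral is the error term
   that vanishes as [B] grows. *)
pose P B t := (t - a) ^+ 2 / (2 * B ^+ 2) - 2^-1 * ln (X B t) + ln B.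
pose f t := rtheta (A * X b t) * N t.
have mf : measurable_fun setT f.
  apply: measurable_funM => //; apply: measurable_funB.
    by apply: measurable_funM => //; apply: measurable_funB => //; exact: measurable_funM.
  apply: measurable_funM => //; apply: measurableT_comp => //; exact: measurable_funM.
have f0 t : E t -> 0 <= f t.
  by move=> Et; rewrite mulr_ge0// rtheta_ge0// mulr_gt0// X0.
have -> : (\int[mu]_t (theta (A * ((t - a) ^+ 2 + b ^+ 2)) * (cauchyB s1 s2 t)%:E)
    = I_ f)%E.
  rewrite -(@integral_setD1 _ _ a setT)//.
    apply: eq_integral => t; rewrite inE => Et.
    by rewrite theta_pos ?EFinM// mulr_gt0// X0.
  apply: measurable_funTS; apply: emeasurable_funM.
    apply: (@measurable_fun_theta _ _ _ (fun t => A * X b t)); exact: measurable_funM.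
  exact/measurable_EFinP.
(* Pointwise, [rtheta (A * X b t) + (t - a)^2 / (2 B^2) + c B = P B t + phi B t + A / 2 * (t -
   a)^2]. The threshold [B0] makes [c B] nonnegative, so that all six terms may be integrated
   separately. *)
pose c B := ln A / 2 + ln B + 1 / 2 - A * b ^+ 2 / 2.
pose B0 := b + 1 + expR (- (ln A / 2 + 1 / 2 - A * b ^+ 2 / 2)).
have B01 : 1 <= B0 by have := expR_ge0 (- (ln A / 2 + 1 / 2 - A * b ^+ 2 / 2)); rewrite /B0; lra.
have B0b : b < B0 by have := expR_gt0 (- (ln A / 2 + 1 / 2 - A * b ^+ 2 / 2)); rewrite /B0; lra.
have B0c B : B0 <= B -> 0 <= c B.
  move=> BB; have : expR (- (ln A / 2 + 1 / 2 - A * b ^+ 2 / 2)) <= B by rewrite /B0 in BB; lra.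
  rewrite -ler_ln ?posrE ?expR_gt0//; last by lra.
  by rewrite expRK /c; lra.
have key B : B0 <= B -> exists2 q : R, 0 <= q <= M2 / (2 * B ^+ 2) &
    (I_ f + (M2 / (2 * B ^+ 2) + c B * (pi / s1 - pi / s2))%:E =
     (q + (pi / s1 * LL s1 B - pi / s2 * LL s2 B) + A / 2 * M2)%:E)%E.
  move=> BB; have bB := lt_le_trans B0b BB; have B1 := le_trans B01 BB.
  have Bp : 0 < B by lra.
  have B2 : 0 < B ^+ 2 by rewrite exprn_gt0.
  have k0 : 0 <= (2 * B ^+ 2)^-1 by rewrite invr_ge0 mulr_ge0// ltW.
  have mP : measurable_fun setT (P B).
    by apply: measurable_funD => //; apply: measurable_funB; apply: measurable_funM.
  have P0 t : E t -> 0 <= P B t.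
    move=> Et; have := rtheta_ge0 (divr_gt0 (X0 B t Et) B2).
    rewrite /rtheta ln_div ?posrE ?X0// lnXn// (mulr2n (ln B)).
    have -> : (X B t / B ^+ 2 - 1) / 2 = (t - a) ^+ 2 / (2 * B ^+ 2).
      by rewrite /X; field; rewrite gt_eqF.
    by rewrite /P; lra.
  have P1 t : E t -> P B t <= (2 * B ^+ 2)^-1 * (t - a) ^+ 2.
    move=> Et; rewrite /P [_ / _]mulrC -addrA gerDl.
    have : ln (B ^+ 2) <= ln (X B t) by rewrite ler_ln ?posrE ?X0// /X lerDr sqr_ge0.
    by rewrite lnXn// (mulr2n (ln B)); lra.
  have iP0 : (0 <= I_ (fun t => (P B t * N t)%R))%E.
    by apply: integral_ge0 => t Et; rewrite lee_fin mulr_ge0// P0.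
  have iP1 : (I_ (fun t => (P B t * N t)%R) <= (M2 / (2 * B ^+ 2))%:E)%E.
    have -> : (M2 / (2 * B ^+ 2))%:E =
        I_ (fun t => (2 * B ^+ 2)^-1 * ((t - a) ^+ 2 * N t)).
      rewrite mulE ?i2 -?EFinM 1?[in LHS]mulrC//; first exact: measurable_funM.
      by move=> t _; rewrite mulr_ge0 ?sqr_ge0.
    apply: ge0_le_integral => //.
    - by move=> t Et; rewrite lee_fin mulr_ge0// P0.
    - by apply/measurable_EFinP; apply: measurable_funTS; apply: measurable_funM.
    - by apply/measurable_EFinP; apply: measurable_funTS; do 2 apply: measurable_funM => //.
    - by move=> t Et; rewrite lee_fin mulrA ler_wpM2r// P1.
  have iPf : I_ (fun t => P B t * N t) \is a fin_num.
    by rewrite ge0_fin_numE// (le_lt_trans iP1)// ltry.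
  exists (fine (I_ (fun t => P B t * N t))).
    by rewrite fine_ge0//= -lee_fin fineK.
  rewrite !EFinD fineK//.
  have -> : (M2 / (2 * B ^+ 2))%:E = I_ (fun t => (2 * B ^+ 2)^-1 * ((t - a) ^+ 2 * N t)).
    rewrite mulE ?i2 -?EFinM 1?[in LHS]mulrC//; first exact: measurable_funM.
    by move=> t _; rewrite mulr_ge0 ?sqr_ge0.
  have -> : (c B * (pi / s1 - pi / s2))%:E = I_ (fun t => c B * N t).
    by rewrite mulE ?iN -?EFinM// B0c.
  have -> : (A / 2 * M2)%:E = I_ (fun t => A / 2 * ((t - a) ^+ 2 * N t)).
    rewrite mulE ?i2 -?EFinM//; first by rewrite divr_ge0// ltW.
      exact: measurable_funM.
    by move=> t _; rewrite mulr_ge0 ?sqr_ge0.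
  have m2N : measurable_fun setT (fun t => (t - a) ^+ 2 * N t) by exact: measurable_funM.
  have p2N t : 0 <= (t - a) ^+ 2 * N t by rewrite mulr_ge0 ?sqr_ge0.
  rewrite -EFinD -iphi// -!addE//.
  - apply: eqE => t Et; rewrite /f /P /phi /rtheta lnM ?posrE ?X0// /c.
    by rewrite /X; field; rewrite gt_eqF.
  - by apply: measurable_funD; apply: measurable_funM.
  - exact: measurable_funM.
  - by move=> t Et; rewrite addr_ge0// mulr_ge0// ?P0 ?phi0.
  - by move=> t _; rewrite mulr_ge0// divr_ge0// ltW.
  - exact: measurable_funM.
  - exact: measurable_funM.
  - by move=> t Et; rewrite mulr_ge0// P0.
  - by move=> t Et; rewrite mulr_ge0// phi0.
  - by apply: measurable_funD; apply: measurable_funM.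
  - by move=> t _; rewrite addr_ge0// mulr_ge0// B0c.
  - exact: measurable_funM.
  - exact: measurable_funM.
  - by move=> t _; rewrite mulr_ge0.
  - by move=> t _; rewrite mulr_ge0// B0c.
have fif : I_ f \is a fin_num.
  have [q _ hq] := key B0 (lexx _).
  have i0 : (0 <= I_ f)%E by apply: integral_ge0 => t Et; rewrite lee_fin f0.
  rewrite ge0_fin_numE// ltey; apply/eqP => fy.
  by move: hq; rewrite fy addye.
rewrite -(fineK fif); congr EFin; apply/eqP; rewrite -subr_eq0; apply/eqP.
pose K := M2 / 2 + pi / s1 * ((2 * s1 + s1 ^+ 2 + a ^+ 2) / 2)
  + pi / s2 * ((2 * s2 + s2 ^+ 2 + a ^+ 2) / 2).
apply: (@eq0_le_inv _ K B0); first by lra.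
move=> B BB; have B1 := le_trans B01 BB; have Bp : 0 < B by lra.
have [q /andP[q0 q1] hq] := key B BB.
have {hq} hq : fine (I_ f) + (M2 / (2 * B ^+ 2) + c B * (pi / s1 - pi / s2)) =
     q + (pi / s1 * LL s1 B - pi / s2 * LL s2 B) + A / 2 * M2.
  by apply: EFin_inj; rewrite -hq EFinD fineK.
have /andP[e10 e11] := ln_quad_bounds a s10 B1.
have /andP[e20 e21] := ln_quad_bounds a s20 B1.
set e1 := _ - ln B in e10 e11; set e2 := _ - ln B in e20 e21.
rewrite (_ : _ - _ = q - M2 / (2 * B ^+ 2) + pi / s1 * e1 - pi / s2 * e2); last first.
  rewrite -(addrK (M2 / (2 * B ^+ 2) + c B * (pi / s1 - pi / s2)) (fine _)) hq.
  by rewrite /e1 /e2 /c /LL; field; rewrite !gt_eqF.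
have ps s : 0 < s -> 0 <= pi / s by move=> s0; rewrite divr_ge0 ?pi_ge0 ?ltW.
have h1 := ler_wpM2l (ps _ s10) e11; have h2 := ler_wpM2l (ps _ s20) e21.
have h10 := mulr_ge0 (ps _ s10) e10; have h20 := mulr_ge0 (ps _ s20) e20.
have hM : M2 / (2 * B ^+ 2) <= M2 / 2 / B.
  rewrite invfM mulrA ler_wpM2l ?divr_ge0// lef_pV2 ?posrE ?exprn_gt0//.
  by rewrite expr2 ler_peMl// ltW.
have -> : K / B = M2 / 2 / B + pi / s1 * ((2 * s1 + s1 ^+ 2 + a ^+ 2) / 2 / B)
    + pi / s2 * ((2 * s2 + s2 ^+ 2 + a ^+ 2) / 2 / B).
  by rewrite /K; field; rewrite !gt_eqF.
by rewrite ler_norml; apply/andP; split; lra.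
Qed.

(** The difference of Poisson's formulas at the heights [s1] and [s2]: because [m >= 0], the
    logarithm of the factor is harmonic in the upper half plane. The quadratic part of [rtheta] is
    not, and the term with [s2 - s1] corrects for it. *)
Lemma integral_theta_dist2 p m x0 s1 s2 : 0 <= m -> 0 < s1 -> s1 < s2 ->
  (\int[mu]_t (theta (dist2 p m (x0 + t) 0) * (cauchyB s1 s2 t)%:E)
     + (pi / s2 * rtheta (dist2 p m x0 s2))%:E
   = (pi / s1 * rtheta (dist2 p m x0 s1) + pi * (p ^+ 2 + m ^+ 2) * (s2 - s1))%:E)%E.
Proof.
move=> m0 s10 s12; have s20 := lt_trans s10 s12.
have [A0|A0] := eqVneq (p ^+ 2 + m ^+ 2) 0.
  have [p0 mm0] : p = 0 /\ m = 0.
    have := A0 => /eqP; rewrite paddr_eq0 ?sqr_ge0// !sqrf_eq0.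
    by move=> /andP[/eqP -> /eqP ->].
  subst p m; rewrite A0 mulr0 mul0r addr0.
  have D1 x y : dist2 0 0 x y = 1 by rewrite /dist2; ring.
  rewrite integral0_eq; last by move=> t _; rewrite D1 theta1 mul0e.
  by rewrite !D1 /rtheta ln1 subrr mul0r subrr !mulr0 add0e.
have Ap : 0 < p ^+ 2 + m ^+ 2 by rewrite lt0r A0 addr_ge0 ?sqr_ge0.
set A := p ^+ 2 + m ^+ 2 in A0 Ap *.
(* The zero is [(p - i m) / A]: [a] is its abscissa seen from [x0] and [b] its distance from the
   real axis. *)
pose a := p / A - x0; pose b := m / A.
have b0 : 0 <= b by rewrite divr_ge0// ltW.
have Ds s : dist2 p m x0 s = A * (a ^+ 2 + (b + s) ^+ 2).
  by rewrite /dist2 /a /b; move: A0; rewrite /A => A0; field.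
have -> : (\int[mu]_t (theta (dist2 p m (x0 + t) 0) * (cauchyB s1 s2 t)%:E) =
    \int[mu]_t (theta (A * ((t - a) ^+ 2 + b ^+ 2)) * (cauchyB s1 s2 t)%:E))%E.
  apply: eq_integral => t _; congr (theta _ * _)%E.
  by rewrite /dist2 /a /b; move: A0; rewrite /A => A0; field.
rewrite (integral_theta_quad a Ap b0 s10 s12) -EFinD; congr EFin.
have Q0 s : 0 < s -> 0 < a ^+ 2 + (b + s) ^+ 2.
  by move=> s0; rewrite ltr_wpDl ?sqr_ge0// exprn_gt0// ltr_wpDl.
rewrite /rtheta !Ds !lnM ?posrE ?Q0//.
field.
by rewrite !lt0r_neq0.
Qed.

End FactorIdentity.

Section FactorIdentity0.
Context {R : realType}.
Implicit Types p m s t x : R.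
Local Notation mu := (@lebesgue_measure R).

(** Monotone convergence for kernels that become singular at 0. Since [f 0 = 0], the conventional
    value of the kernel at that point does not matter. *)
Lemma cvg_integral_kernel (f : R -> \bar R) (k_ : nat -> R -> R) (k : R -> R) :
  measurable_fun setT f -> (forall t, (0 <= f t)%E) -> f 0 = 0%E ->
  (forall n, measurable_fun setT (k_ n)) -> (forall n t, 0 <= k_ n t) ->
  (forall n t, t != 0 -> 0 < k_ n t) ->
  (forall t, t != 0 -> nondecreasing_seq (k_ ^~ t)) ->
  (forall t, t != 0 -> k_ n t @[n --> \oo] --> k t) ->
  (\int[mu]_t (f t * (k_ n t)%:E) @[n --> \oo] --> \int[mu]_t (f t * (k t)%:E))%E.
Proof.
move=> mf f0 f00 mk k0 kp ndk ck.
have := @cvg_monotone_convergence _ _ _ mu setT measurableT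
  (fun n t => f t * (k_ n t)%:E)%E.
have -> : (\int[mu]_t (f t * (k t)%:E) =
    \int[mu]_t limn (fun n => f t * (k_ n t)%:E))%E.
  apply: eq_integral => t _; apply/esym; apply: cvg_lim => //.
  have [->|t0] := eqVneq t 0.
    by under eq_fun do rewrite f00 mul0e; rewrite f00 mul0e; exact: cvg_cst.
  have kt0 : 0 < k t.
    apply: (lt_le_trans (kp 0%N t t0)).
    rewrite -(cvg_lim _ (ck t t0))//.
    apply: nondecreasing_cvgn_le; first exact: ndk.
    by apply/cvg_ex; exists (k t); exact: ck.
  case E : (f t) => [r| |].
  - under eq_fun do rewrite -EFinM; rewrite -EFinM.
    by apply: cvg_EFin; [exact: nearW|apply: cvgMr; exact: ck].
  - rewrite gt0_mulye ?lte_fin//.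
    under eq_fun do rewrite gt0_mulye ?lte_fin ?kp//.
    exact: cvg_cst.
  - by have := f0 t; rewrite E.
apply.
- by move=> n; apply: emeasurable_funM => //; apply/measurable_EFinP; exact: mk.
- by move=> n t _; rewrite mule_ge0// lee_fin.
- move=> t _ n n' nn'; have [->|t0] := eqVneq t 0; first by rewrite f00 !mul0e.
  by rewrite lee_wpmul2l// lee_fin ndk.
Qed.

(* Equal to [t^-2 - (t^2 + s^2)^-1] away from [t = 0], where it vanishes. *)
Definition ker s t : R := s ^+ 2 / (t ^+ 2 * (t ^+ 2 + s ^+ 2)).

Lemma kerE s t : 0 < s -> t != 0 -> ker s t = (t ^+ 2)^-1 - (t ^+ 2 + s ^+ 2)^-1.
Proof.
move=> s0 t0; rewrite /ker; field.
by rewrite t0 gt_eqF// ltr_wpDl ?sqr_ge0 ?exprn_gt0.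
Qed.

Lemma ker_ge0 s t : 0 <= ker s t.
Proof.
by apply: mulr_ge0; rewrite ?invr_ge0 ?sqr_ge0// mulr_ge0 ?addr_ge0 ?sqr_ge0.
Qed.

Lemma ker_gt0 s t : 0 < s -> t != 0 -> 0 < ker s t.
Proof.
move=> s0 t0; have t2 : 0 < t ^+ 2 by rewrite exprn_even_gt0.
by rewrite divr_gt0 ?exprn_gt0// mulr_gt0// ltr_pwDl// sqr_ge0.
Qed.

Lemma measurable_ker s : measurable_fun setT (ker s).
Proof.
apply: measurable_funM => //; apply: measurable_fun_invr_ge0 => [|t].
  apply: measurable_funM; first exact: measurable_funX.
  by apply: measurable_funD => //; exact: measurable_funX.
by rewrite mulr_ge0 ?addr_ge0 ?sqr_ge0.
Qed.

(** The factor [s^2] outweighs the [pi / s] in front of this term when [s] tends to 0. *)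
Lemma rtheta_dist2_0_le p m s : 0 <= m -> 0 < s ->
  rtheta (dist2 p m 0 s) <= s ^+ 2 * (2 * m + (p ^+ 2 + m ^+ 2) * s) ^+ 2 / 2.
Proof.
move=> m0 s0; apply: (le_trans (rtheta_le (dist2_gt0 p 0 m0 s0))).
have -> : dist2 p m 0 s = 1 + s * (2 * m + (p ^+ 2 + m ^+ 2) * s) by rewrite dist2E; ring.
set d := s * _; have d0 : 0 <= d.
  by rewrite mulr_ge0 ?addr_ge0 ?mulr_ge0 ?addr_ge0 ?sqr_ge0// ltW.
rewrite -exprMn -/d addrC addrA addNr add0r.
rewrite ler_wpM2l ?sqr_ge0// lef_pV2 ?posrE; lra.
Qed.

(** The limit of [integral_theta_dist2] for [x0 = 0] as the lower height tends to 0. *)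
Lemma integral_theta_dist2_0 p m s : 0 <= m -> 0 < s ->
  (\int[mu]_t (theta (dist2 p m t 0) * (ker s t)%:E)
     + (pi / s * rtheta (dist2 p m 0 s))%:E = (pi * (p ^+ 2 + m ^+ 2) * s)%:E)%E.
Proof.
move=> m0 s0; set A := p ^+ 2 + m ^+ 2.
have A0 : 0 <= A by rewrite addr_ge0 ?sqr_ge0.
(* The shift by two keeps [s_ n] strictly below [s] already for [n = 0]. *)
pose s_ n : R := s * n.+2%:R^-1.
have sn0 n : 0 < s_ n by rewrite mulr_gt0// invr_gt0.
have sns n : s_ n < s by rewrite gtr_pMr// invf_lt1// ltr1n.
have s_0 : s_ n @[n --> \oo] --> (0 : R).
  rewrite -[X in _ --> X](mulr0 s); apply: cvgMr.
  have := @cvg_harmonic R; rewrite -(cvg_shiftS (@harmonic R)) => h.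
  exact: h.
have h1 := @cvg_integral_kernel (fun t => theta (dist2 p m t 0))
  (fun n t => cauchyB (s_ n) s t) (ker s).
have {}h1 : (\int[mu]_t (theta (dist2 p m t 0) * (cauchyB (s_ n) s t)%:E) @[n --> \oo]
    --> \int[mu]_t (theta (dist2 p m t 0) * (ker s t)%:E))%E.
  apply: h1.
  - apply: measurable_fun_theta; apply: measurable_funD; apply: measurable_funX.
      by apply: measurable_funD => //; apply: measurable_funB => //; exact: measurable_funM.
    by apply: measurable_funD => //; exact: measurable_funM.
  - by move=> t; exact: theta_ge0.
  - by rewrite dist2E (_ : _ + _ = 1) ?theta1//; ring.
  - by move=> n; exact: measurable_cauchyB.
  - by move=> n t; exact: cauchyB_ge0.
  - move=> n t t0; have P x : 0 < x -> 0 < t ^+ 2 + x ^+ 2.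
      by move=> x0; rewrite ltr_wpDl ?sqr_ge0 ?exprn_gt0.
    rewrite subr_gt0 ltf_pV2 ?posrE ?P//.
    by rewrite ltrD2l ltr_pXn2r ?nnegrE ?ltW.
  - move=> t t0 n n' nn'; rewrite lerD2r lef_pV2 ?posrE ?ltr_wpDl ?sqr_ge0 ?exprn_gt0//.
    rewrite lerD2l ler_pXn2r ?nnegrE ?(ltW (sn0 _))//.
    by rewrite ler_pM2l// lef_pV2 ?posrE// ler_nat !ltnS.
  - move=> t t0; rewrite kerE//; apply: cvgB; last exact: cvg_cst.
    have h2 : t ^+ 2 + s_ n ^+ 2 @[n --> \oo] --> t ^+ 2 + 0 * 0.
      apply: cvgD; first exact: cvg_cst.
      by under eq_fun do rewrite expr2; exact: cvgM.
    have tn : t ^+ 2 + 0 * 0 != 0 by rewrite mul0r addr0 expf_neq0.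
    pose proof (cvgV tn h2) as h3; rewrite mul0r addr0 in h3; exact: h3.
have e n : (\int[mu]_t (theta (dist2 p m t 0) * (cauchyB (s_ n) s t)%:E) =
    (pi / s_ n * rtheta (dist2 p m 0 (s_ n)) + pi * A * (s - s_ n)
      - pi / s * rtheta (dist2 p m 0 s))%:E)%E.
  have := integral_theta_dist2 p 0 m0 (sn0 n) (sns n).
  under eq_integral do rewrite add0r.
  by move=> h; rewrite EFinB -h addeK.
have h2 : (\int[mu]_t (theta (dist2 p m t 0) * (cauchyB (s_ n) s t)%:E) @[n --> \oo]
    --> (pi * A * s - pi / s * rtheta (dist2 p m 0 s))%:E)%E.
  under eq_fun do rewrite e.
  apply: cvg_EFin; first exact: nearW.
  apply: cvgB; last exact: cvg_cst.
  rewrite -[X in _ --> X](add0r (pi * A * s)); apply: cvgD.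
    apply: (@squeeze_cvgr _ _ _ _ (fun=> 0) (fun n => pi * ((2 * m + A * s) ^+ 2 / 2) * s_ n)).
    - apply: nearW => n.
      have ps : 0 <= pi / s_ n by apply: mulr_ge0; [exact: pi_ge0|rewrite invr_ge0 ltW].
      rewrite mulr_ge0 ?rtheta_ge0 ?dist2_gt0//=.
      have -> : pi * ((2 * m + A * s) ^+ 2 / 2) * s_ n =
         pi / s_ n * ((s_ n) ^+ 2 * (2 * m + A * s) ^+ 2 / 2) by field; rewrite gt_eqF.
      rewrite ler_wpM2l//.
      apply: (le_trans (rtheta_dist2_0_le p m0 (sn0 n))).
      have q0 x : 0 <= x -> 0 <= 2 * m + A * x.
        by move=> x0; rewrite addr_ge0// mulr_ge0.
      rewrite ler_pM2r ?invr_gt0// ler_wpM2l ?sqr_ge0// -/A.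
      rewrite ler_pXn2r ?nnegrE ?q0 ?(ltW s0) ?(ltW (sn0 _))//.
      by rewrite lerD2l ler_wpM2l// ltW.
    - exact: cvg_cst.
    - rewrite -[X in _ --> X](mulr0 (pi * ((2 * m + A * s) ^+ 2 / 2))); exact: cvgMr.
  have -> : pi * A * s = pi * A * (s - 0) by rewrite subr0.
  by apply: cvgMr; apply: cvgB => //; exact: cvg_cst.
have -> := cvg_unique (@ereal_hausdorff R) h1 h2.
by rewrite -EFinD subrK.
Qed.

End FactorIdentity0.

(** * The logarithm of the modulus of the product *)

Section Potential.
Context {R : realType}.
Local Notation mu := (@lebesgue_measure R).

Definition gsum (p m : nat -> R) (x y : R) : \bar R :=
  (\sum_(k <oo) theta (dist2 (p k) (m k) x y))%E.

(* With [q k = p k + i m k] the reciprocals of the zeros and [Q] the sum of [|q k|^2],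
   this is the logarithm of the modulus of the canonical product at [x + i y]. *)
Definition lpot (p m : nat -> R) (Q x y : R) : \bar R :=
  ((Q * (x ^+ 2 + y ^+ 2) / 2)%:E - gsum p m x y)%E.

Lemma gsum_ge0 p m x y : (0 <= gsum p m x y)%E.
Proof. by apply: nneseries_ge0 => k _ _; exact: theta_ge0. Qed.

Lemma dist2_norm (p m x : R) : dist2 p `|m| x 0 = dist2 p m x 0.
Proof. by rewrite !dist2E !mulr0 real_normK ?num_real. Qed.

Lemma measurable_dist2 (p m y : R) : measurable_fun setT (fun x => dist2 p m x y).
Proof.
apply: measurable_funD; apply: measurable_funX.
  by apply: measurable_funD => //; apply: measurable_funB => //; exact: measurable_funM.
by apply: measurable_funD => //; exact: measurable_funM.
Qed.

Lemma measurable_gsum p m y : measurable_fun setT (fun x => gsum p m x y).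
Proof.
apply: ge0_emeasurable_sum => [k x _ _|k _]; first exact: theta_ge0.
by apply: measurable_fun_theta; exact: measurable_dist2.
Qed.

Lemma integral_gsumZ p m x0 (k : R -> R) : measurable_fun setT k -> (forall t, 0 <= k t) ->
  (\int[mu]_t (gsum p m (x0 + t) 0 * (k t)%:E) =
   \sum_(i <oo) \int[mu]_t (theta (dist2 (p i) (m i) (x0 + t) 0) * (k t)%:E))%E.
Proof.
move=> mk k0; rewrite -integral_nneseries//.
- apply: eq_integral => t _; rewrite muleC /gsum -nneseriesZl.
    by apply: eq_eseriesr => i _; rewrite muleC.
  by move=> i _; exact: theta_ge0.
- move=> i; apply: emeasurable_funM; last exact/measurable_EFinP.
  apply: measurable_fun_theta.
  exact: (measurableT_comp (measurable_dist2 (p i) (m i) 0) (measurable_funD _ _)).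
- by move=> i t _; rewrite mule_ge0 ?theta_ge0// lee_fin.
Qed.

Section Sums.
Implicit Types s t x : R.
Variables (p m : nat -> R) (Q : R).
Hypothesis hQ : (\sum_(k <oo) (p k ^+ 2 + m k ^+ 2)%:E = Q%:E)%E.
(** Imaginary parts of the reciprocals of the reflected zeros: [gsum p am] belongs to the product
    [Pi*] of the overview. *)
Let am k := `|m k|.

Lemma sum_sqr_ge0 : 0 <= Q.
Proof.
rewrite -lee_fin -hQ; apply: nneseries_ge0 => k _ _.
by rewrite lee_fin addr_ge0 ?sqr_ge0.
Qed.

Lemma gsum_rtheta x s : 0 < s ->
  gsum p am x s = (\sum_(k <oo) (rtheta (dist2 (p k) (am k) x s))%:E)%E.
Proof.
by move=> s0; apply: eq_eseriesr => k _; rewrite theta_pos// dist2_gt0 ?normr_ge0.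
Qed.

Lemma integral_gsum x0 s1 s2 : 0 < s1 -> s1 < s2 ->
  (\int[mu]_t (gsum p m (x0 + t) 0 * (cauchyB s1 s2 t)%:E) + (pi / s2)%:E * gsum p am x0 s2
   = (pi / s1)%:E * gsum p am x0 s1 + (pi * Q * (s2 - s1))%:E)%E.
Proof.
move=> s10 s12; have s20 := lt_trans s10 s12.
have ps s : 0 < s -> 0 <= pi / s by move=> s0; rewrite divr_ge0 ?pi_ge0 ?ltW.
have r0 s k : 0 < s -> 0 <= rtheta (dist2 (p k) (am k) x0 s).
  by move=> s0; rewrite rtheta_ge0// dist2_gt0 ?normr_ge0.
have -> : (pi * Q * (s2 - s1))%:E =
    (\sum_(k <oo) (pi * (p k ^+ 2 + m k ^+ 2) * (s2 - s1))%:E)%E.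
  rewrite mulrAC EFinM -hQ -nneseriesZl; last by move=> k _; rewrite lee_fin addr_ge0 ?sqr_ge0.
  by apply: eq_eseriesr => k _; rewrite -EFinM; congr EFin; ring.
rewrite integral_gsumZ; [|exact: measurable_cauchyB|by move=> t; exact: cauchyB_ge0].
rewrite !gsum_rtheta// -!nneseriesZl; do 2?by move=> k _; rewrite lee_fin r0.
rewrite -!nneseriesD.
- apply: eq_eseriesr => k _; rewrite -!EFinM -EFinD.
  have := integral_theta_dist2 (p k) x0 (normr_ge0 (m k)) s10 s12.
  rewrite real_normK ?num_real// => <-; congr (_ + _)%E.
  by apply: eq_integral => t _; rewrite dist2_norm.
- by move=> k _ _; rewrite -EFinM lee_fin mulr_ge0 ?ps ?r0.
- move=> k _ _; rewrite lee_fin; apply: mulr_ge0; last by rewrite subr_ge0 ltW.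
  by rewrite mulr_ge0 ?pi_ge0 ?addr_ge0 ?sqr_ge0.
- move=> k _ _; apply: integral_ge0 => t _.
  by rewrite mule_ge0 ?theta_ge0// lee_fin cauchyB_ge0.
- by move=> k _ _; rewrite -EFinM lee_fin mulr_ge0 ?ps ?r0.
Qed.

Lemma integral_gsum0 s : 0 < s ->
  (\int[mu]_t (gsum p m t 0 * (ker s t)%:E) + (pi / s)%:E * gsum p am 0 s
   = (pi * Q * s)%:E)%E.
Proof.
move=> s0.
have ps : 0 <= pi / s by rewrite divr_ge0 ?pi_ge0 ?ltW.
have r0 k : 0 <= rtheta (dist2 (p k) (am k) 0 s).
  by rewrite rtheta_ge0// dist2_gt0 ?normr_ge0.
have -> : (pi * Q * s)%:E = (\sum_(k <oo) (pi * (p k ^+ 2 + m k ^+ 2) * s)%:E)%E.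
  rewrite mulrAC EFinM -hQ -nneseriesZl; last by move=> k _; rewrite lee_fin addr_ge0 ?sqr_ge0.
  by apply: eq_eseriesr => k _; rewrite -EFinM; congr EFin; ring.
have := @integral_gsumZ p m 0 (ker s) (measurable_ker s) (ker_ge0 s).
under eq_integral do rewrite add0r; move=> ->.
rewrite gsum_rtheta// -!nneseriesZl; last by move=> k _; rewrite lee_fin r0.
rewrite -!nneseriesD.
- apply: eq_eseriesr => k _; rewrite -!EFinM.
  have := integral_theta_dist2_0 (p k) (normr_ge0 (m k)) s0.
  rewrite real_normK ?num_real// => <-; congr (_ + _)%E.
  by apply: eq_integral => t _; rewrite add0r dist2_norm.
- move=> k _ _; apply: integral_ge0 => t _.
  by rewrite mule_ge0 ?theta_ge0// lee_fin ker_ge0.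
- by move=> k _ _; rewrite -EFinM lee_fin mulr_ge0 ?r0.
Qed.

Definition lpos t : \bar R := maxe (lpot p m Q t 0) 0%E.
Definition lneg t : \bar R := maxe (- lpot p m Q t 0)%E 0%E.

Lemma lpos_ge0 t : (0 <= lpos t)%E. Proof. by rewrite le_max lexx orbT. Qed.
Lemma lneg_ge0 t : (0 <= lneg t)%E. Proof. by rewrite le_max lexx orbT. Qed.

Lemma measurable_lpot y : measurable_fun setT (fun x => lpot p m Q x y).
Proof.
apply: emeasurable_funB; last exact: measurable_gsum.
apply/measurable_EFinP; apply: measurable_funM => //; apply: measurable_funM => //.
by apply: measurable_funD => //; exact: measurable_funX.
Qed.

Lemma measurable_lpos : measurable_fun setT lpos.
Proof. by apply: measurable_maxe => //; exact: measurable_lpot. Qed.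

Lemma measurable_lneg : measurable_fun setT lneg.
Proof.
by apply: measurable_maxe => //; apply: measurableT_comp => //; exact: measurable_lpot.
Qed.

(** The decomposition of log |Pi| into its positive and negative parts, arranged without subtraction
    so that it remains valid where [gsum] is +oo. *)
Lemma gsum_lpos t : (gsum p m t 0 + lpos t = (Q * t ^+ 2 / 2)%:E + lneg t)%E.
Proof.
rewrite /lpos /lneg /lpot expr0n addr0.
case: (gsum p m t 0) (gsum_ge0 p m t 0) => [g| |]// g0; last first.
  by rewrite /= (max_r (leNye 0)) (max_l (leey 0)) adde0.
rewrite -!EFinD -EFinN -!EFin_max -!EFinD; congr EFin.
set q := Q * _ / 2.
case: (boolP (0 <= q - g)) => [h|]; last rewrite -ltNge => h.
  by rewrite (max_l h) max_r; lra.
by rewrite (max_r (ltW h)) max_l; lra.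
Qed.

Lemma lpos_le t : (lpos t <= (Q * t ^+ 2 / 2)%:E)%E.
Proof.
rewrite /lpos ge_max; apply/andP; split.
  by rewrite /lpot expr0n addr0 geeDl// oppe_le0 gsum_ge0.
by rewrite lee_fin divr_ge0// mulr_ge0 ?sum_sqr_ge0 ?sqr_ge0.
Qed.

Lemma integral_sqr_ker s : 0 < s ->
  (\int[mu]_t ((Q * t ^+ 2 / 2)%:E * (ker s t)%:E) = (pi * Q * s / 2)%:E)%E.
Proof.
move=> s0.
have e : (\int[mu]_t ((Q * t ^+ 2 / 2)%:E * (ker s t)%:E) =
    \int[mu]_t ((Q * s ^+ 2 / 2)%:E * ((t ^+ 2 + s ^+ 2)^-1)%:E))%E.
  apply: ae_eq_integral => //.
  - apply: emeasurable_funM; apply/measurable_EFinP; last exact: measurable_ker.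
    by apply: measurable_funM => //; apply: measurable_funM => //; exact: measurable_funX.
  - apply: emeasurable_funM; apply/measurable_EFinP; last exact: measurable_cauchy.
    exact: measurable_cst.
  - exists [set 0]; split; [exact: measurable_set1|exact: lebesgue_measure_set1|].
    move=> t /= ht; apply: contrapT => /eqP t0; apply: ht => _.
    rewrite -!EFinM; congr EFin; rewrite /ker; field.
    have h : t ^+ 2 + s ^+ 2 != 0 by rewrite lt0r_neq0// ltr_wpDl ?sqr_ge0 ?exprn_gt0.
    by rewrite t0 h.
rewrite e ge0_integralZl_EFin//.
- rewrite integral_cauchy// -EFinM; congr EFin; field; exact: lt0r_neq0.
- by move=> t _; rewrite lee_fin ltW// cauchy_gt0.
- by apply/measurable_EFinP; exact: measurable_cauchy.
- by rewrite divr_ge0// mulr_ge0 ?sqr_ge0// sum_sqr_ge0.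
Qed.

(** [ipos s] and [ineg s] are pi times the truncated integrals of the overview, for Pi and for its
    inverse. *)
Definition ipos s := (\int[mu]_t (lpos t * (ker s t)%:E))%E.
Definition ineg s := (\int[mu]_t (lneg t * (ker s t)%:E))%E.

Lemma ipos_ge0 s : (0 <= ipos s)%E.
Proof. by apply: integral_ge0 => t _; rewrite mule_ge0 ?lpos_ge0// lee_fin ker_ge0. Qed.

Lemma ineg_ge0 s : (0 <= ineg s)%E.
Proof. by apply: integral_ge0 => t _; rewrite mule_ge0 ?lneg_ge0// lee_fin ker_ge0. Qed.

Lemma ipos_fin s : 0 < s -> ipos s \is a fin_num.
Proof.
move=> s0; rewrite ge0_fin_numE ?ipos_ge0//.
apply: (@le_lt_trans _ _ (pi * Q * s / 2)%:E); last exact: ltry.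
rewrite -integral_sqr_ker//; apply: ge0_le_integral => //.
- by move=> t _; rewrite mule_ge0 ?lpos_ge0// lee_fin ker_ge0.
- apply: emeasurable_funM; first exact: measurable_lpos.
  by apply/measurable_EFinP; exact: measurable_ker.
- apply: emeasurable_funM; apply/measurable_EFinP; last exact: measurable_ker.
  by apply: measurable_funM => //; apply: measurable_funM => //; exact: measurable_funX.
- by move=> t _; rewrite lee_wpmul2r ?lpos_le// lee_fin ker_ge0.
Qed.

Lemma gsum0_fin s : 0 < s -> gsum p am 0 s \is a fin_num.
Proof.
move=> s0; rewrite ge0_fin_numE ?gsum_ge0// ltey; apply/eqP => h.
have := integral_gsum0 s0; rewrite h gt0_muley ?lte_fin ?divr_gt0 ?pi_gt0// addey//.
rewrite -ltNye (@lt_le_trans _ _ 0%E)//; apply: integral_ge0 => t _.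
by rewrite mule_ge0 ?gsum_ge0// lee_fin ker_ge0.
Qed.

(** This is the identity for log |Pi*(is)| / s of the overview, multiplied by pi and with negative
    terms moved across. Half of the [pi Q s] of [integral_gsum0] is used up by the quadratic in
    [gsum_lpos]. *)
Lemma ineg_balance s : 0 < s ->
  (ineg s + (pi / s)%:E * gsum p am 0 s = ipos s + (pi * Q * s / 2)%:E)%E.
Proof.
move=> s0.
have mk : measurable_fun setT (fun t => (ker s t)%:E).
  by apply/measurable_EFinP; exact: measurable_ker.
have mq : measurable_fun setT (fun t : R => (Q * t ^+ 2 / 2)%:E).
  apply/measurable_EFinP.
  by apply: measurable_funM => //; apply: measurable_funM => //; exact: measurable_funX.
have k0 t : (0 <= (ker s t)%:E)%E by rewrite lee_fin ker_ge0.
have q0 t : (0 <= (Q * t ^+ 2 / 2)%:E)%E.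
  by rewrite lee_fin divr_ge0// mulr_ge0 ?sum_sqr_ge0 ?sqr_ge0.
have h : (\int[mu]_t (gsum p m t 0 * (ker s t)%:E) + ipos s =
    (pi * Q * s / 2)%:E + ineg s)%E.
  rewrite -integral_sqr_ker// -!ge0_integralD//.
  - apply: eq_integral => t _.
    by rewrite -!ge0_muleDl ?gsum_ge0 ?lpos_ge0 ?lneg_ge0 ?q0// gsum_lpos.
  - by move=> t _; rewrite mule_ge0.
  - exact: emeasurable_funM.
  - by move=> t _; rewrite mule_ge0// lneg_ge0.
  - by apply: emeasurable_funM => //; exact: measurable_lneg.
  - by move=> t _; rewrite mule_ge0// gsum_ge0.
  - by apply: emeasurable_funM => //; exact: measurable_gsum.
  - by move=> t _; rewrite mule_ge0// lpos_ge0.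
  - by apply: emeasurable_funM => //; exact: measurable_lpos.
have := integral_gsum0 s0; have := h.
have := ipos_fin s0; have := gsum0_fin s0.
move: (\int[mu]_t _)%E => I; move: (ipos s) (ineg s) (gsum p am 0 s).
move=> [ip| |] [in_| |] [g| |]//; case: I => [i| |]//= _ _ [h1] [h2].
rewrite -!EFinM -!EFinD; congr EFin.
move: h1 h2; lra.
Qed.

End Sums.
End Potential.

(** * Limits of the truncated integrals *)

Section Limits.
Context {R : realType}.
Local Notation mu := (@lebesgue_measure R).
Implicit Types s t x : R.
Variables (p m : nat -> R) (Q : R).
Hypothesis hQ : (\sum_(k <oo) (p k ^+ 2 + m k ^+ 2)%:E = Q%:E)%E.
Let am k := `|m k|.

Definition apos := (\int[mu]_t (lpos p m Q t * ((t ^+ 2)^-1)%:E))%E.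
Definition aneg := (\int[mu]_t (lneg p m Q t * ((t ^+ 2)^-1)%:E))%E.

Lemma apos_ge0 : (0 <= apos)%E.
Proof.
by apply: integral_ge0 => t _; rewrite mule_ge0 ?lpos_ge0// lee_fin invr_ge0 sqr_ge0.
Qed.

Lemma aneg_ge0 : (0 <= aneg)%E.
Proof.
by apply: integral_ge0 => t _; rewrite mule_ge0 ?lneg_ge0// lee_fin invr_ge0 sqr_ge0.
Qed.

Lemma gsum00 : gsum p m 0 0 = 0%E.
Proof.
by apply: eseries0 => k _ _; rewrite dist2E (_ : _ + _ = 1) ?theta1//; ring.
Qed.

Lemma lpot00 : lpot p m Q 0 0 = 0%E.
Proof. by rewrite /lpot gsum00 expr0n addr0 mulr0 mul0r sube0. Qed.

Lemma lpos0 : lpos p m Q 0 = 0%E.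
Proof. by rewrite /lpos lpot00 maxxx. Qed.

Lemma lneg0 : lneg p m Q 0 = 0%E.
Proof. by rewrite /lneg lpot00 oppe0 maxxx. Qed.

Lemma measurable_invsqr : measurable_fun setT (fun t => (t ^+ 2)^-1).
Proof.
by apply: measurable_fun_invr_ge0 => [|t]; [exact: measurable_funX|exact: sqr_ge0].
Qed.

Lemma ker_le s t : 0 < s -> ker s t <= (t ^+ 2)^-1.
Proof.
move=> s0; have [->|t0] := eqVneq t 0.
  by rewrite /ker expr0n mul0r invr0 mulr0.
by rewrite kerE// gerBl ltW// cauchy_gt0.
Qed.

Lemma ipos_le s : 0 < s -> (ipos p m Q s <= apos)%E.
Proof.
move=> s0; apply: ge0_le_integral => //.
- by move=> t _; rewrite mule_ge0 ?lpos_ge0// lee_fin ker_ge0.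
- apply: emeasurable_funM; first exact: measurable_lpos.
  by apply/measurable_EFinP; exact: measurable_ker.
- apply: emeasurable_funM; first exact: measurable_lpos.
  by apply/measurable_EFinP; exact: measurable_invsqr.
- by move=> t _; rewrite lee_wpmul2l ?lpos_ge0// lee_fin ker_le.
Qed.

Lemma ineg_le s : 0 < s -> (ineg p m Q s <= aneg)%E.
Proof.
move=> s0; apply: ge0_le_integral => //.
- by move=> t _; rewrite mule_ge0 ?lneg_ge0// lee_fin ker_ge0.
- apply: emeasurable_funM; first exact: measurable_lneg.
  by apply/measurable_EFinP; exact: measurable_ker.
- apply: emeasurable_funM; first exact: measurable_lneg.
  by apply/measurable_EFinP; exact: measurable_invsqr.
- by move=> t _; rewrite lee_wpmul2l ?lneg_ge0// lee_fin ker_le.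
Qed.

Lemma cvg_ker t : t != 0 -> ker n.+1%:R t @[n --> \oo] --> (t ^+ 2)^-1.
Proof.
move=> t0; have t2 : 0 < t ^+ 2 by rewrite exprn_even_gt0.
have h : harmonic n @[n --> \oo] --> (0 : R) by exact: cvg_harmonic.
apply: (@squeeze_cvgr _ _ _ _ (fun n => (t ^+ 2)^-1 - harmonic n) (fun=> (t ^+ 2)^-1)).
- apply: nearW => n; rewrite ker_le// andbT kerE// lerD2l lerN2 /harmonic.
  rewrite lef_pV2 ?posrE//; last by rewrite ltr_wpDl ?sqr_ge0 ?exprn_gt0.
  by rewrite -[leLHS]add0r lerD ?sqr_ge0// expr2 ler_peMr// ler1n.
- pose proof (cvgB (cvg_cst ((t ^+ 2)^-1)) h) as h'; rewrite subr0 in h'; exact: h'.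
- exact: cvg_cst.
Qed.

Lemma ker_homo t (s1 s2 : R) : 0 < s1 -> s1 <= s2 -> ker s1 t <= ker s2 t.
Proof.
move=> s10 s12; have s20 := lt_le_trans s10 s12.
have [->|t0] := eqVneq t 0; first by rewrite /ker expr0n !mul0r invr0 !mulr0.
have P x : 0 < x -> 0 < t ^+ 2 + x ^+ 2 by move=> x0; rewrite ltr_wpDl ?sqr_ge0 ?exprn_gt0.
rewrite !kerE// lerD2l lerN2 lef_pV2 ?posrE ?P// lerD2l.
by rewrite ler_pXn2r ?nnegrE ?(ltW s10) ?(ltW s20).
Qed.

Lemma cvg_ipos : (ipos p m Q n.+1%:R @[n --> \oo] --> apos)%E.
Proof.
apply: cvg_integral_kernel.
- exact: measurable_lpos.
- exact: lpos_ge0.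
- exact: lpos0.
- by move=> n; exact: measurable_ker.
- by move=> n t; exact: ker_ge0.
- by move=> n t t0; exact: ker_gt0.
- by move=> t t0 n n' nn'; rewrite ker_homo// ler_nat.
- exact: cvg_ker.
Qed.

Lemma cvg_ineg : (ineg p m Q n.+1%:R @[n --> \oo] --> aneg)%E.
Proof.
apply: cvg_integral_kernel.
- exact: measurable_lneg.
- exact: lneg_ge0.
- exact: lneg0.
- by move=> n; exact: measurable_ker.
- by move=> n t; exact: ker_ge0.
- by move=> n t t0; exact: ker_gt0.
- by move=> t t0 n n' nn'; rewrite ker_homo// ler_nat.
- exact: cvg_ker.
Qed.

Lemma ipos_homo (s1 s2 : R) : 0 < s1 -> s1 <= s2 -> (ipos p m Q s1 <= ipos p m Q s2)%E.
Proof.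
move=> s10 s12; apply: ge0_le_integral => //.
- by move=> t _; rewrite mule_ge0 ?lpos_ge0// lee_fin ker_ge0.
- apply: emeasurable_funM; first exact: measurable_lpos.
  by apply/measurable_EFinP; exact: measurable_ker.
- apply: emeasurable_funM; first exact: measurable_lpos.
  by apply/measurable_EFinP; exact: measurable_ker.
- by move=> t _; rewrite lee_wpmul2l ?lpos_ge0// lee_fin ker_homo.
Qed.

Lemma ineg_homo (s1 s2 : R) : 0 < s1 -> s1 <= s2 -> (ineg p m Q s1 <= ineg p m Q s2)%E.
Proof.
move=> s10 s12; apply: ge0_le_integral => //.
- by move=> t _; rewrite mule_ge0 ?lneg_ge0// lee_fin ker_ge0.
- apply: emeasurable_funM; first exact: measurable_lneg.
  by apply/measurable_EFinP; exact: measurable_ker.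
- apply: emeasurable_funM; first exact: measurable_lneg.
  by apply/measurable_EFinP; exact: measurable_ker.
- by move=> t _; rewrite lee_wpmul2l ?lneg_ge0// lee_fin ker_homo.
Qed.

Lemma aneg_le_of (M : \bar R) (s0 : R) :
  (forall s, (s0 <= s)%R -> (0 < s)%R -> ineg p m Q s <= M)%E -> (aneg <= M)%E.
Proof.
move=> h; rewrite -(cvg_lim _ cvg_ineg)//; apply: lime_le.
  by apply/cvg_ex; exists aneg; exact: cvg_ineg.
near=> n; apply: h => //.
near: n; have := nbhs_infty_ger s0; apply: filterS => n /le_trans; apply.
by rewrite ler_nat.
Unshelve. all: by end_near. Qed.

Lemma apos_le_of (M : \bar R) :
  (forall s, (0 < s)%R -> ipos p m Q s <= M)%E -> (apos <= M)%E.
Proof.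
move=> h; rewrite -(cvg_lim _ cvg_ipos)//; apply: lime_le.
  by apply/cvg_ex; exists apos; exact: cvg_ipos.
by apply: nearW => n; apply: h.
Qed.

Definition gam : \bar R := (\sum_(k <oo) (am k)%:E)%E.

(** For a reflected zero the squared modulus on the upper imaginary axis is at least 1, so the
    logarithm may be dropped. *)
Lemma rtheta_dist2_le (p' m' s : R) : 0 <= m' -> 0 < s ->
  rtheta (dist2 p' m' 0 s) <= m' * s + (p' ^+ 2 + m' ^+ 2) * s ^+ 2 / 2.
Proof.
move=> m0 s0; rewrite /rtheta; set D := dist2 _ _ _ _.
have DE : D = 1 + (2 * m' * s + (p' ^+ 2 + m' ^+ 2) * s ^+ 2).
  by rewrite /D dist2E; ring.
have D1 : 1 <= D.
  rewrite DE lerDl addr_ge0//; first by rewrite !mulr_ge0// ltW.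
  by rewrite mulr_ge0 ?addr_ge0 ?sqr_ge0.
by have := ln_ge0 D1; rewrite {2}DE; lra.
Qed.

Lemma gsum0_le s : 0 < s -> ((pi / s)%:E * gsum p am 0 s <= pi%:E * gam + (pi * Q * s / 2)%:E)%E.
Proof.
move=> s0; have ps : 0 <= pi / s by rewrite divr_ge0 ?pi_ge0 ?ltW.
have -> : (pi * Q * s / 2)%:E = (\sum_(k <oo) (pi * s / 2 * (p k ^+ 2 + m k ^+ 2))%:E)%E.
  have -> : pi * Q * s / 2 = pi * s / 2 * Q by ring.
  rewrite EFinM -hQ -nneseriesZl; last by move=> k _; rewrite lee_fin addr_ge0 ?sqr_ge0.
  by apply: eq_eseriesr => k _; rewrite EFinM.
rewrite gsum_rtheta// /gam -!nneseriesZl; last 2 first.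
- by move=> k _; rewrite lee_fin normr_ge0.
- by move=> k _; rewrite lee_fin rtheta_ge0// dist2_gt0 ?normr_ge0.
rewrite -nneseriesD.
- apply: lee_nneseries => k _.
    by rewrite -EFinM lee_fin mulr_ge0// rtheta_ge0// dist2_gt0 ?normr_ge0.
  rewrite -!EFinM -EFinD lee_fin.
  have h := ler_wpM2l ps (@rtheta_dist2_le (p k) (am k) s (normr_ge0 _) s0).
  apply: (le_trans h); rewrite /am real_normK ?num_real//.
  by rewrite le_eqVlt; apply/orP; left; apply/eqP; field; exact: lt0r_neq0.
- by move=> k _ _; rewrite -EFinM lee_fin mulr_ge0 ?pi_ge0 ?normr_ge0.
- move=> k _ _; rewrite lee_fin mulr_ge0 ?addr_ge0 ?sqr_ge0//.
  by rewrite divr_ge0// mulr_ge0 ?pi_ge0// ltW.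
Qed.

Lemma apos_le : (apos <= aneg + pi%:E * gam)%E.
Proof.
apply: apos_le_of => s s0.
have := ineg_balance hQ s0; have := gsum0_le s0; have := ineg_le s0.
move=> h1 h2 h3.
rewrite -(@leeD2rE _ (pi * Q * s / 2)%:E)// -h3 -(addeA aneg).
exact: leeD.
Qed.

End Limits.

(** * Jensen's inequality *)

Section RootsOfUnity.
Context {R : realType}.
Implicit Types a b w x y : R[i].

Definition sqn x : R := complex.Re x ^+ 2 + complex.Im x ^+ 2.

Lemma sqn_ge0 x : 0 <= sqn x. Proof. by rewrite addr_ge0 ?sqr_ge0. Qed.

Lemma sqnM x y : sqn (x * y) = sqn x * sqn y.
Proof. by case: x y => [a b] [c d]; rewrite /sqn /=; ring. Qed.

Lemma sqn1 : sqn 1 = 1. Proof. by rewrite /sqn /= expr1n expr0n addr0. Qed.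

Lemma sqnX x n : sqn (x ^+ n) = sqn x ^+ n.
Proof. by elim: n => [|n IH]; rewrite ?sqn1// !exprS sqnM IH. Qed.

Lemma sqn_eq0 x : (sqn x == 0) = (x == 0).
Proof.
case: x => a b; rewrite /sqn /= paddr_eq0 ?sqr_ge0// !sqrf_eq0.
by rewrite eq_complex.
Qed.

Lemma sqn_prod (I : Type) (s : seq I) (f : I -> R[i]) :
  sqn (\prod_(w <- s) f w) = \prod_(w <- s) sqn (f w).
Proof. by elim/big_rec2: _ => [|w u v _ <-]; rewrite ?sqn1 ?sqnM. Qed.

Lemma cmodE x : cmod x = Num.sqrt (sqn x).
Proof. by case: x. Qed.

Lemma sqr_cmod x : cmod x ^+ 2 = sqn x.
Proof. by rewrite cmodE sqr_sqrtr ?sqn_ge0. Qed.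

Lemma cmod_ge0 x : 0 <= cmod x. Proof. by rewrite cmodE sqrtr_ge0. Qed.

Lemma cmodX x n : cmod (x ^+ n) = cmod x ^+ n.
Proof. by elim: n => [|n IH]; rewrite ?[cmod 1]normc1// !exprS -IH /cmod normcM. Qed.

Lemma cmod_sub_ge x y : cmod x - cmod y <= cmod (x - y).
Proof. by rewrite lerBlDr -[x in leLHS](subrK y) le_normcD. Qed.

Lemma sqn_sub x y : sqn (x - y) = sqn x + sqn y
  - 2 * (complex.Re x * complex.Re y + complex.Im x * complex.Im y).
Proof. by case: x y => [a b] [c d]; rewrite /sqn /=; ring. Qed.

Lemma sqnBC x y : sqn (x - y) = sqn (y - x).
Proof. by rewrite !sqn_sub; ring. Qed.

(** [|a^n - b^n| >= |a|^n - |b|^n], and [(|b| / |a|)^n <= (|b| / |a|)^2] since [n >= 2]. The factor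
    lost does not depend on [n], which is essential later. *)
Lemma sqn_expB_ge a b n : (2 <= n)%N -> sqn b < sqn a ->
  (sqn a ^+ n) * (1 - sqn b / sqn a) ^+ 2 <= sqn (a ^+ n - b ^+ n).
Proof.
move=> n2 ba; have a0 : 0 < sqn a := le_lt_trans (sqn_ge0 b) ba.
have ca0 : 0 < cmod a by rewrite cmodE sqrtr_gt0.
have t0 : 0 <= cmod b / cmod a by rewrite divr_ge0 ?cmod_ge0.
have t1 : cmod b / cmod a <= 1.
  by rewrite ler_pdivrMr// mul1r !cmodE ler_sqrt// ltW.
rewrite -!sqr_cmod -!exprM mulnC exprM -exprMn.
have h : cmod a ^+ n * (1 - cmod b ^+ 2 / cmod a ^+ 2) <= cmod (a ^+ n - b ^+ n).
  apply: le_trans (cmod_sub_ge _ _); rewrite !cmodX mulrBr mulr1 lerD2l lerN2.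
  rewrite -[leLHS](mulfVK (expf_neq0 n (lt0r_neq0 ca0))) mulrC.
  rewrite ler_wpM2l ?exprn_ge0 ?cmod_ge0// -!expr_div_n.
  exact: ler_wiXn2l.
rewrite ler_pXn2r ?nnegrE ?cmod_ge0// mulr_ge0 ?exprn_ge0 ?cmod_ge0// subr_ge0.
by rewrite -expr_div_n exprn_ile1.
Qed.

Lemma roots_of_unity_seq n : (2 <= n)%N -> exists rs : seq R[i],
  [/\ size rs = n, (forall w, w \in rs -> sqn w = 1), \sum_(w <- rs) w = 0
    & forall a b, \prod_(w <- rs) (a - b * w) = a ^+ n - b ^+ n].
Proof.
move=> n2; have n0 : (0 < n)%N by exact: ltn_trans n2.
have [rs hrs] := closed_field_poly_normal ('X^n - 1 : {poly R[i]}).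
have lc : lead_coef ('X^n - 1 : {poly R[i]}) = 1 by exact/monicP/monic_Xn_sub_1.
rewrite lc scale1r in hrs.
have srs : size rs = n.
  by apply/succn_inj; rewrite -(size_prod_XsubC rs id) -hrs size_Xn_sub_1.
exists rs; split => //.
- move=> w wrs; have : root ('X^n - 1 : {poly R[i]}) w by rewrite hrs root_prod_XsubC.
  rewrite rootE !hornerE subr_eq0 => /eqP wn.
  have : sqn w ^+ n = 1 by rewrite -sqnX wn sqn1.
  move=> /eqP; by rewrite pexpr_eq1 ?sqn_ge0// => /eqP.
(* Up to sign, the sum of the roots is the coefficient of degree [n - 1] of [X^n - 1], which
   vanishes because [n >= 2]. *)
- have := @coefPn_prod_XsubC _ rs; rewrite srs -lt0n n0 => /(_ isT).
  rewrite -hrs coefB coefXn coef1 ltn_eqF ?prednK//.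
  have -> : (n.-1 == 0)%N = false by case: n n2 {n0 hrs lc srs} => [|[|n]].
  by rewrite subrr => /esym /eqP; rewrite oppr_eq0 => /eqP.
- move=> a b; have [->|b0] := eqVneq b 0.
    under eq_bigr do rewrite mul0r subr0.
    by rewrite big_const_seq count_predT srs iter_mulr_1 expr0n gtn_eqF// subr0.
  have := congr1 (fun P => P.[a / b]) hrs.
  rewrite horner_prod !hornerE.
  under eq_bigr do rewrite hornerXsubC.
  move=> h.
  have -> : \prod_(w <- rs) (a - b * w) = \prod_(w <- rs) (b * (a / b - w)).
    by apply: eq_bigr => w _; rewrite mulrBr mulrCA divff// mulr1.
  rewrite big_split /= -h big_const_seq count_predT srs iter_mulr_1.
  by rewrite mulrBr mulr1 exprMn mulrCA -exprMn divff// expr1n mulr1.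
Qed.

(* The mean of [rtheta (|a - b w|^2)] over the unit circle [|w| = 1], where [u = |a|^2] and
   [v = |b|^2]. *)
Definition jens (u v : R) := (u + v - 1) / 2 - ln (Num.max u v) / 2.

Lemma Re_sum (s : seq R[i]) (f : R[i] -> R[i]) :
  complex.Re (\sum_(w <- s) f w) = \sum_(w <- s) complex.Re (f w).
Proof. by elim/big_rec2: _ => // w u v _ <-; case: (f w) v => [? ?] [? ?]. Qed.

Lemma Im_sum (s : seq R[i]) (f : R[i] -> R[i]) :
  complex.Im (\sum_(w <- s) f w) = \sum_(w <- s) complex.Im (f w).
Proof. by elim/big_rec2: _ => // w u v _ <-; case: (f w) v => [? ?] [? ?]. Qed.

Lemma ln_prod_seq (I : eqType) (s : seq I) (f : I -> R) :
  (forall i, i \in s -> 0 < f i) ->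
  ln (\prod_(i <- s) f i) = \sum_(i <- s) ln (f i).
Proof.
elim: s => [|i s IH] h; first by rewrite !big_nil ln1.
have hs v : v \in s -> 0 < f v by move=> vs; rewrite h// inE vs orbT.
rewrite !big_cons lnM ?posrE ?IH// ?h ?mem_head//.
by rewrite big_seq; apply: prodr_gt0 => v /hs.
Qed.

Lemma sum_sqn_roots (rs : seq R[i]) a b : (forall w, w \in rs -> sqn w = 1) ->
  \sum_(w <- rs) w = 0 ->
  \sum_(w <- rs) sqn (a - b * w) = (size rs)%:R * (sqn a + sqn b).
Proof.
move=> h1 h0.
have hb : \sum_(w <- rs) b * w = 0 by rewrite -mulr_sumr h0 mulr0.
have hR : \sum_(w <- rs) complex.Re (b * w) = 0 by rewrite -Re_sum hb.
have hI : \sum_(w <- rs) complex.Im (b * w) = 0 by rewrite -Im_sum hb.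
transitivity (\sum_(w <- rs) (sqn a + sqn b)
  - 2 * (complex.Re a * \sum_(w <- rs) complex.Re (b * w)
       + complex.Im a * \sum_(w <- rs) complex.Im (b * w))).
  rewrite !mulr_sumr -big_split /= mulr_sumr -sumrB; apply: eq_big_seq => w wr.
  by rewrite sqn_sub sqnM (h1 w wr) mulr1.
rewrite hR hI !mulr0 addr0 mulr0 subr0 big_const_seq count_predT iter_addr_0.
by rewrite mulr_natl.
Qed.

(** The mean over the vertices exceeds the circle mean [jens] by at most a constant over [n]: the
    squared moduli sum exactly, and the logarithms add up to that of [|a^n - b^n|^2]. *)
Lemma sum_rtheta_roots n (rs : seq R[i]) a b : (2 <= n)%N -> size rs = n ->
  (forall w, w \in rs -> sqn w = 1) -> \sum_(w <- rs) w = 0 ->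
  (forall a b, \prod_(w <- rs) (a - b * w) = a ^+ n - b ^+ n) ->
  sqn a != sqn b ->
  (forall w, w \in rs -> 0 < sqn (a - b * w)) /\
  \sum_(w <- rs) rtheta (sqn (a - b * w)) <= n%:R * jens (sqn a) (sqn b)
    - ln (1 - Num.min (sqn a) (sqn b) / Num.max (sqn a) (sqn b)).
Proof.
move=> n2 srs h1 h0 hp ab.
have M0 : 0 < Num.max (sqn a) (sqn b).
  rewrite lt_max; have [a0|a0] := eqVneq (sqn a) 0.
    by rewrite [0 < sqn b]lt0r sqn_ge0 eq_sym -a0 ab orbT.
  by rewrite lt0r a0 sqn_ge0.
set t := Num.min _ _ / _.
have t1 : 0 < 1 - t.
  rewrite subr_gt0 ltr_pdivrMr// mul1r gt_min !lt_max !ltxx orbF /=.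
  by rewrite -neq_lt.
have key : Num.max (sqn a) (sqn b) ^+ n * (1 - t) ^+ 2 <= sqn (a ^+ n - b ^+ n).
  rewrite /t; case: (ltgtP (sqn a) (sqn b)) => [lt|lt|E].
  - by rewrite sqnBC sqn_expB_ge.
  - by rewrite sqn_expB_ge.
  - by rewrite E eqxx in ab.
have P0 : 0 < \prod_(w <- rs) sqn (a - b * w).
  rewrite -sqn_prod hp; apply: lt_le_trans key.
  by rewrite mulr_gt0 ?exprn_gt0.
have p0 w : w \in rs -> 0 < sqn (a - b * w).
  move=> wr; rewrite lt0r sqn_ge0 andbT; apply/negP => /eqP w0.
  move: P0; rewrite (perm_big _ (perm_to_rem wr)) big_cons /= w0 mul0r ltxx.
  by [].
split=> //.
have -> : \sum_(w <- rs) rtheta (sqn (a - b * w)) =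
    (\sum_(w <- rs) sqn (a - b * w) - n%:R) / 2 - (\sum_(w <- rs) ln (sqn (a - b * w))) / 2.
  rewrite /rtheta sumrB -!mulr_suml sumrB; congr ((_ - _) / 2 - _).
  by rewrite big_const_seq count_predT iter_addr_0 srs.
rewrite sum_sqn_roots// srs -ln_prod_seq// -sqn_prod hp.
have : ln (Num.max (sqn a) (sqn b) ^+ n * (1 - t) ^+ 2) <= ln (sqn (a ^+ n - b ^+ n)).
  rewrite ler_ln ?posrE ?mulr_gt0 ?exprn_gt0//.
  by apply: lt_le_trans key; rewrite mulr_gt0 ?exprn_gt0.
rewrite lnM ?posrE ?exprn_gt0// !lnXn// /jens.
rewrite -(mulr_natl (ln (Num.max _ _)) n) -(mulr_natl (ln (1 - t)) 2).
lra.
Qed.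

End RootsOfUnity.

Section SeriesTools.
Context {R : realType}.
Implicit Types u v : nat -> R.

Lemma nneseries_tail_small u (e : R) : (forall k, 0 <= u k) ->
  (\sum_(k <oo) (u k)%:E < +oo)%E -> 0 < e ->
  exists K, (\sum_(K <= k <oo) (u k)%:E < e%:E)%E.
Proof.
move=> u0 su e0.
have u0' k : xpredT k -> (0 <= (u k)%:E)%E by rewrite lee_fin.
have := @nneseries_tail_cvg R (fun k => (u k)%:E) xpredT su u0'.
move=> /fine_cvgP[hf hc].
have [N _ HN] : \forall N \near \oo, (\sum_(N <= k <oo) (u k)%:E < e%:E)%E.
  near=> N.
  have h1 : (\sum_(N <= k <oo) (u k)%:E)%E \is a fin_num by near: N; exact: hf.
  rewrite -(fineK h1) lte_fin.
  near: N; exact: (cvgr_lt 0 hc).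
by exists N; apply: HN => /=.
Unshelve. all: by end_near. Qed.

Lemma nneseries_term_small u (e : R) : (forall k, 0 <= u k) ->
  (\sum_(k <oo) (u k)%:E < +oo)%E -> 0 < e ->
  exists K, forall k, (K <= k)%N -> u k < e.
Proof.
move=> u0 su e0; have [K hK] := nneseries_tail_small u0 su e0.
exists K => k Kk; rewrite -lte_fin; apply: le_lt_trans hK.
have u0' i : (K <= i)%N -> (0 <= (u i)%:E)%E by rewrite lee_fin.
apply: le_trans (nneseries_lim_ge k.+1 _); last by move=> i _ _; rewrite lee_fin.
rewrite big_nat_recr//= leeDr//.
by apply: sume_ge0 => i _; rewrite lee_fin.
Qed.

Lemma nneseries_fin_of_le u v (C : R) K : (forall k, 0 <= u k) -> (forall k, 0 <= v k) ->
  0 <= C -> (forall k, (K <= k)%N -> u k <= C * v k) ->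
  (\sum_(k <oo) (v k)%:E < +oo)%E -> (\sum_(k <oo) (u k)%:E < +oo)%E.
Proof.
move=> u0 v0 C0 uv sv.
rewrite (nneseries_split 0 K); last by move=> k _; rewrite lee_fin.
rewrite add0n; apply: lte_add_pinfty.
  by rewrite sumEFin ltry.
apply: (@le_lt_trans _ _ (\sum_(K <= k <oo) (C%:E * (v k)%:E))%E).
  rewrite -[leLHS]nneseries_addn; last by move=> k; rewrite lee_fin.
  rewrite -[leRHS]nneseries_addn; last by move=> k; rewrite -EFinM lee_fin mulr_ge0.
  apply: lee_nneseries => [k _ _|k _]; first by rewrite lee_fin.
  by rewrite -EFinM lee_fin uv// leq_addl.
rewrite nneseriesZl; last by move=> k _; rewrite lee_fin.
apply: lte_mul_pinfty => //.
apply: le_lt_trans sv.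
rewrite [leRHS](nneseries_split 0 K); last by move=> k _; rewrite lee_fin.
rewrite add0n leeDr//.
by apply: sume_ge0 => i _; rewrite lee_fin.
Qed.

End SeriesTools.

Section Jensen.
Context {R : realType}.
Variables (p m : nat -> R) (Q : R).
Hypothesis hQ : (\sum_(k <oo) (p k ^+ 2 + m k ^+ 2)%:E = Q%:E)%E.

Lemma jens_ge0 (u v : R) : 0 <= u -> 0 <= v -> 0 < Num.max u v -> 0 <= jens u v.
Proof.
move=> u0 v0 M0; have := ln_leB1 M0.
have : Num.max u v <= u + v by rewrite ge_max lerDl lerDr u0 v0.
by rewrite /jens; lra.
Qed.

Lemma jens_le (u v w : R) : 0 <= u -> 0 <= v -> v <= w -> 0 < Num.max u v ->
  jens u w <= jens u v + (w - v) / 2.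
Proof.
move=> u0 v0 vw M0.
have : ln (Num.max u v) <= ln (Num.max u w).
  have h : Num.max u v <= Num.max u w by rewrite ge_max !le_max lexx vw orbT.
  by rewrite ler_ln ?posrE// (lt_le_trans M0).
by rewrite /jens; lra.
Qed.

Let A k := p k ^+ 2 + m k ^+ 2.

Lemma dist2_max_gt0 x y r k : 0 < r -> 0 < Num.max (dist2 (p k) (m k) x y) (r ^+ 2 * A k).
Proof.
move=> r0; rewrite lt_max; have [A0|A0] := eqVneq (A k) 0.
  have /andP[/eqP p0 /eqP m0] : (p k == 0) && (m k == 0).
    by move/eqP: A0; rewrite /A paddr_eq0 ?sqr_ge0// !sqrf_eq0.
  by rewrite p0 m0 /dist2 !mul0r subr0 !addr0 expr1n expr0n addr0 ltr01.
by rewrite orbC mulr_gt0 ?exprn_gt0// lt0r A0 addr_ge0 ?sqr_ge0.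
Qed.

(** The circles about the given point that pass through a zero have countably many radii, and a
    countable set cannot contain an interval of positive length. *)
Lemma generic_radius x y r1 r2 : 0 < r1 -> r1 < r2 -> exists2 r, r1 < r < r2 &
  forall k, dist2 (p k) (m k) x y != r ^+ 2 * A k.
Proof.
move=> r10 r12; apply: contrapT => H.
pose f k := Num.sqrt (dist2 (p k) (m k) x y / A k).
have sub : `]r1, r2[%classic `<=` range f.
  move=> r /=; rewrite in_itv/= => /andP[h1 h2].
  have r0 : 0 < r := lt_trans r10 h1.
  apply: contrapT => nr; apply: H; exists r; first by rewrite h1 h2.
  move=> k; apply/negP => /eqP E; apply: nr; exists k => //.
  have A0 : A k != 0.
    apply/negP => /eqP A0; have := dist2_max_gt0 x y k r0.
    by rewrite E A0 mulr0 maxxx ltxx.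
  by rewrite /f E mulfK// sqrtr_sqr gtr0_norm.
have c : countable (`]r1, r2[%classic : set R).
  by apply: sub_countable (subset_card_le sub) _; apply: card_le_trans (card_image_le f setT) _.
have := countable_lebesgue_measure0 c.
rewrite lebesgue_measure_itv/= lte_fin r12 => /eqP.
by rewrite -EFinB eqe subr_eq0 gt_eqF.
Qed.

(** [S] is the total error of [sum_rtheta_roots] over all factors. Each term is finite by the choice
    of [r], and from some index on the terms are at most [8 r^2 A k]. *)
Lemma sum_ln_fin x y r : 0 < r ->
  (forall k, dist2 (p k) (m k) x y != r ^+ 2 * A k) ->
  exists2 S : R, 0 <= S &
  (\sum_(k <oo) (- ln (1 - Num.min (dist2 (p k) (m k) x y) (r ^+ 2 * A k)
    / Num.max (dist2 (p k) (m k) x y) (r ^+ 2 * A k)))%:E = S%:E)%E.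
Proof.
move=> r0 hr.
pose d k := dist2 (p k) (m k) x y.
pose t k := Num.min (d k) (r ^+ 2 * A k) / Num.max (d k) (r ^+ 2 * A k).
have A0 k : 0 <= A k by rewrite addr_ge0 ?sqr_ge0.
have rA0 k : 0 <= r ^+ 2 * A k by rewrite mulr_ge0 ?sqr_ge0.
have d0 k : 0 <= d k by exact: dist2_ge0.
have M0 k : 0 < Num.max (d k) (r ^+ 2 * A k) by exact: dist2_max_gt0.
have t0 k : 0 <= t k by rewrite mulr_ge0 ?invr_ge0 ?(ltW (M0 k))// le_min d0 rA0.
have t1 k : t k < 1.
  rewrite ltr_pdivrMr// mul1r gt_min !lt_max !ltxx orbF /= -neq_lt; exact: hr.
have L0 k : 0 <= - ln (1 - t k).
  by rewrite oppr_ge0 ln_le0// gerBl.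
suff : (\sum_(k <oo) (- ln (1 - t k))%:E < +oo)%E.
  move=> h; exists (fine (\sum_(k <oo) (- ln (1 - t k))%:E)%E).
    by rewrite fine_ge0// nneseries_ge0// => k _ _; rewrite lee_fin.
  by rewrite fineK// ge0_fin_numE// nneseries_ge0// => k _ _; rewrite lee_fin.
have sA : (\sum_(k <oo) (A k)%:E < +oo)%E by rewrite hQ ltry.
(* [A k < 1 / Z] gives [A k |z|^2 <= 1/4], hence [d k >= 1/4] and [t k <= 4 r^2 A k]. It also gives
   [A k r^2 <= 1/8], hence [t k <= 1/2], and then [- ln (1 - t k) <= 2 t k]. *)
pose Z := 4 * (x ^+ 2 + y ^+ 2) + 8 * r ^+ 2 + 1.
have Z0 : 0 < Z by rewrite /Z; have := sqr_ge0 x; have := sqr_ge0 y; have := sqr_ge0 r; lra.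
have [K hK] := nneseries_term_small A0 sA (divr_gt0 ltr01 Z0).
apply: (nneseries_fin_of_le (C := 8 * r ^+ 2) (K := K) L0 A0 _ _ sA).
  by rewrite mulr_ge0 ?sqr_ge0.
move=> k /hK; rewrite ltr_pdivlMr// => AZ.
have AZ1 : A k * (4 * (x ^+ 2 + y ^+ 2)) <= 1.
  apply: le_trans (ltW AZ); rewrite ler_wpM2l// /Z.
  by have := sqr_ge0 r; lra.
have AZ2 : A k * (8 * r ^+ 2) <= 1.
  apply: le_trans (ltW AZ); rewrite ler_wpM2l// /Z.
  by have := sqr_ge0 x; have := sqr_ge0 y; lra.
have dk : 1 / 4 <= d k.
  (* [|1 - zq| >= 1 - |zq| >= 1/2], squared via [(u - v)^2 >= 0] *)
  rewrite /d dist2E -/(A k).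
  have : (p k * x - m k * y) ^+ 2 <= A k * (x ^+ 2 + y ^+ 2).
    have := sqr_ge0 (p k * y + m k * x); rewrite /A; lra.
  set c := p k * x - m k * y; set B := A k * (x ^+ 2 + y ^+ 2) => cB.
  have hB : B <= 1 / 4 by rewrite /B; lra.
  have hB0 : 0 <= B by apply: le_trans cB; exact: sqr_ge0.
  have c2 : c <= 1 / 2.
    by have := sqr_ge0 (c - 1 / 2); rewrite sqrrB => h; lra.
  have -> : 1 - 2 * p k * x + 2 * m k * y + B = 1 - 2 * c + B by rewrite /c; ring.
  have : (1 - c) ^+ 2 <= 1 - 2 * c + B by rewrite sqrrB; lra.
  have := sqr_ge0 (1 / 2 - c); rewrite !sqrrB; lra.
have tk : t k <= 4 * r ^+ 2 * A k.
  rewrite /t ler_pdivrMr//.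
  apply: (@le_trans _ _ (r ^+ 2 * A k)); first by rewrite ge_min lexx orbT.
  have : 1 / 4 <= Num.max (d k) (r ^+ 2 * A k) by rewrite le_max dk.
  by move=> /(ler_wpM2l (rA0 k)); lra.
have tk2 : t k <= 1 / 2 by lra.
have p1 : 0 < 1 - t k by lra.
have := ln_ge1BV p1 => h.
have : (1 - t k)^-1 <= 1 + 2 * t k.
  rewrite -[leLHS]mul1r ler_pdivrMr//.
  have := t0 k; nra.
lra.
Qed.

(** [Q (x0^2 + y0^2 + r1^2) / 2 - J] is the mean of log |Pi| over the circle of radius [r1]. If log
    |Pi| stayed below this mean by more than [e] at all [n] vertices on a generic circle, summation
    would give [n e <= S]. Passing from [r1] to the generic radius costs nothing: by [jens_le], the
    growth of the circle means of [theta] is at most that of the quadratic. *)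
Lemma jensen x0 y0 r1 r2 (J e : R) : 0 < r1 -> r1 < r2 -> 0 < e ->
  (\sum_(k <oo) (jens (dist2 (p k) (m k) x0 y0) (r1 ^+ 2 * A k))%:E = J%:E)%E ->
  exists x y, r1 ^+ 2 <= (x - x0) ^+ 2 + (y - y0) ^+ 2 <= r2 ^+ 2 /\
    ((Q * (x0 ^+ 2 + y0 ^+ 2 + r1 ^+ 2) / 2 - J - e)%:E <= lpot p m Q x y)%E.
Proof.
move=> r10 r12 e0 hJ.
have [r /andP[rr1 rr2] hr] := generic_radius x0 y0 r10 r12.
have r0 : 0 < r := lt_trans r10 rr1.
have [S S0 hS] := sum_ln_fin r0 hr.
(* Enough vertices for [n e > S], and at least two as the roots of unity require. *)
pose n := maxn 2 (Num.truncn (S / e)).+1.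
have n2 : (2 <= n)%N by rewrite leq_maxl.
have nS : S < n%:R * e.
  rewrite -ltr_pdivrMr//; apply: (lt_le_trans (truncnS_gt _)).
  by rewrite ler_nat leq_maxr.
have [rs [srs h1 h0 hp]] := @roots_of_unity_seq R n n2.
pose a k : R[i] := Complex (1 - p k * x0 + m k * y0) (- (m k * x0 + p k * y0)).
pose b k : R[i] := Complex (r * p k) (r * m k).
have sa k : sqn (a k) = dist2 (p k) (m k) x0 y0 by rewrite /sqn /a /dist2 /= sqrrN.
have sb k : sqn (b k) = r ^+ 2 * A k by rewrite /sqn /b /A /=; ring.
pose X (w : R[i]) := x0 + r * complex.Re w; pose Y (w : R[i]) := y0 + r * complex.Im w.
have dab k w : dist2 (p k) (m k) (X w) (Y w) = sqn (a k - b k * w).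
  by case: w => u v; rewrite /dist2 /sqn /a /b /X /Y /=; ring.
have key k := sum_rtheta_roots n2 srs h1 h0 hp
  (a := a k) (b := b k) ltac:(by rewrite sa sb; exact: hr).
have XY w : w \in rs -> (X w - x0) ^+ 2 + (Y w - y0) ^+ 2 = r ^+ 2.
  move=> /h1; case: w => u v; rewrite /sqn /X /Y /= => h.
  have -> : (x0 + r * u - x0) ^+ 2 + (y0 + r * v - y0) ^+ 2 = r ^+ 2 * (u ^+ 2 + v ^+ 2) by ring.
  by rewrite h mulr1.
have sXY : \sum_(w <- rs) (X w ^+ 2 + Y w ^+ 2) = n%:R * (x0 ^+ 2 + y0 ^+ 2 + r ^+ 2).
  have := @sum_sqn_roots R rs (Complex x0 y0) (- (Complex r 0)) h1 h0.
  rewrite srs; have -> : sqn (- (Complex r 0 : R[i])) = r ^+ 2 by rewrite /sqn /=; ring.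
  rewrite {2}/sqn /= => <-; apply: eq_big_seq => w _.
  by case: w => u v; rewrite /sqn /X /Y /=; ring.
apply: contrapT => H.
have lb w : w \in rs ->
    ((Q * (X w ^+ 2 + Y w ^+ 2) / 2 - (Q * (x0 ^+ 2 + y0 ^+ 2 + r1 ^+ 2) / 2 - J - e))%:E
      <= gsum p m (X w) (Y w))%E.
  move=> wr; rewrite leNgt; apply/negP => lt; apply: H; exists (X w), (Y w); split.
    by rewrite XY// !ler_pXn2r ?nnegrE ?(ltW r10) ?(ltW r0) ?(ltW rr1) ?(ltW rr2)// ltW// (lt_trans r0).
  rewrite /lpot; move: lt; case: (gsum p m (X w) (Y w)) => [g| |]//=; last by rewrite leey.
  by rewrite lte_fin -EFinB lee_fin; lra.
have sum_lb : ((n%:R * (Q * (r ^+ 2 - r1 ^+ 2) / 2 + J + e))%:E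
    <= \sum_(w <- rs) gsum p m (X w) (Y w))%E.
  apply: (@le_trans _ _ (\sum_(w <- rs)
      (Q * (X w ^+ 2 + Y w ^+ 2) / 2 - (Q * (x0 ^+ 2 + y0 ^+ 2 + r1 ^+ 2) / 2 - J - e))%:E)%E).
    rewrite sumEFin sumrB -mulr_suml -mulr_sumr sXY big_const_seq count_predT iter_addr_0 srs.
    by rewrite lee_fin -[_ *+ n]mulr_natl le_eqVlt; apply/orP; left; apply/eqP; field.
  by rewrite big_seq [leRHS]big_seq; apply: lee_sum => w; exact: lb.
have sum_ub : (\sum_(w <- rs) gsum p m (X w) (Y w)
    <= (n%:R * (J + Q * (r ^+ 2 - r1 ^+ 2) / 2) + S)%:E)%E.
  rewrite /gsum -nneseries_sum; last by move=> w k _; exact: theta_ge0.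
  apply: (@le_trans _ _ (\sum_(k <oo)
     (n%:R%:E * (jens (dist2 (p k) (m k) x0 y0) (r1 ^+ 2 * A k))%:E
      + (n%:R * ((r ^+ 2 - r1 ^+ 2) / 2))%:E * (A k)%:E
      + (- ln (1 - Num.min (dist2 (p k) (m k) x0 y0) (r ^+ 2 * A k)
          / Num.max (dist2 (p k) (m k) x0 y0) (r ^+ 2 * A k)))%:E))%E).
    apply: lee_nneseries => [k _ _|k _].
      by apply: sume_ge0 => w _; exact: theta_ge0.
    have [kp ks] := key k.
    rewrite -!EFinM -!EFinD.
    rewrite big_seq (eq_bigr (fun w => (rtheta (sqn (a k - b k * w)))%:E)); last first.
      by move=> w /kp w0; rewrite dab theta_pos.
    rewrite -big_seq sumEFin lee_fin; apply: (le_trans ks); rewrite sa sb lerD2r.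
    have A0 : 0 <= A k by rewrite addr_ge0 ?sqr_ge0.
    apply: (@le_trans _ _ (n%:R * (jens (dist2 (p k) (m k) x0 y0) (r1 ^+ 2 * A k)
        + (r ^+ 2 * A k - r1 ^+ 2 * A k) / 2))).
      rewrite ler_wpM2l//.
      apply: jens_le; [exact: dist2_ge0|by rewrite mulr_ge0 ?sqr_ge0| |exact: dist2_max_gt0].
      by rewrite ler_wpM2r// ler_pXn2r ?nnegrE ?(ltW r10) ?(ltW r0)// ltW.
    by rewrite le_eqVlt; apply/orP; left; apply/eqP; rewrite /A; ring.
  have A0 k : 0 <= A k by rewrite addr_ge0 ?sqr_ge0.
  have rr : 0 <= (r ^+ 2 - r1 ^+ 2) / 2.
    by rewrite divr_ge0// subr_ge0 ler_pXn2r ?nnegrE ?(ltW r10) ?(ltW r0)// ltW.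
  have j0 k : 0 <= jens (dist2 (p k) (m k) x0 y0) (r1 ^+ 2 * A k).
    by apply: jens_ge0; [exact: dist2_ge0|rewrite mulr_ge0 ?sqr_ge0|exact: dist2_max_gt0].
  have l0 k : 0 <= - ln (1 - Num.min (dist2 (p k) (m k) x0 y0) (r ^+ 2 * A k)
          / Num.max (dist2 (p k) (m k) x0 y0) (r ^+ 2 * A k)).
    rewrite oppr_ge0 ln_le0// gerBl mulr_ge0//.
      by rewrite le_min dist2_ge0 mulr_ge0 ?sqr_ge0.
    by rewrite invr_ge0 ltW// dist2_max_gt0.
  rewrite nneseriesD; last 2 first.
  - by move=> k _ _; rewrite adde_ge0// -EFinM lee_fin mulr_ge0// mulr_ge0.
  - by move=> k _ _; rewrite lee_fin.
  rewrite nneseriesD; last 2 first.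
  - by move=> k _ _; rewrite -EFinM lee_fin mulr_ge0.
  - by move=> k _ _; rewrite -EFinM lee_fin mulr_ge0// mulr_ge0.
  rewrite !nneseriesZl; do 2?by move=> k _; rewrite lee_fin.
  rewrite hJ hS hQ -!EFinM -!EFinD lee_fin le_eqVlt; apply/orP; left; apply/eqP.
  by ring.
have := le_trans sum_lb sum_ub; rewrite lee_fin; move: nS; clear; lra.
Qed.

End Jensen.

(** * Products of exponential type *)

Section FiniteGrowth.
Context {R : realType}.
Implicit Types r s : R.
Variables (p m : nat -> R) (Q : R).
Hypothesis hQ : (\sum_(k <oo) (p k ^+ 2 + m k ^+ 2)%:E = Q%:E)%E.
Let A k := p k ^+ 2 + m k ^+ 2.
Let A0 k : 0 <= A k.
Proof. by rewrite addr_ge0 ?sqr_ge0. Qed.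

(** This is [log^+ (r |q k|)]. By Jensen's formula its sum over [k] is the mean of log |Pi| over the
    circle of radius [r] about 0, so it measures the number of zeros. *)
Definition lp r k : R := Num.max (ln (r ^+ 2 * A k) / 2) 0.

Lemma lp_ge0 r k : 0 <= lp r k. Proof. by rewrite le_max lexx orbT. Qed.

Lemma jens1 r k : jens 1 (r ^+ 2 * A k) + lp r k = r ^+ 2 * A k / 2.
Proof.
have x0 : 0 <= r ^+ 2 * A k by rewrite mulr_ge0 ?sqr_ge0.
rewrite /jens /lp; set x := r ^+ 2 * A k in x0 *.
case: (boolP (1 <= x)) => h.
  rewrite (max_r h) max_l; first by lra.
  by have := ln_ge0 h; lra.
rewrite -ltNge in h; rewrite (max_l (ltW h)) ln1 max_r; first by lra.
by have := ln_le0 (ltW h); lra.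
Qed.

Hypotheses (C r0 : R).
Hypothesis C0 : 0 <= C.
Hypothesis hC : forall x y, r0 ^+ 2 <= x ^+ 2 + y ^+ 2 ->
  (lpot p m Q x y <= (C * Num.sqrt (x ^+ 2 + y ^+ 2))%:E)%E.

Lemma sum_lp_le r : 0 < r -> r0 <= r -> 0 <= r0 ->
  (\sum_(k <oo) (lp r k)%:E <= ((2 * C + 1) * r)%:E)%E.
Proof.
move=> rp r0r r00.
have j0 k : 0 <= jens 1 (r ^+ 2 * A k).
  by apply: jens_ge0; [|rewrite mulr_ge0 ?sqr_ge0 ?A0|rewrite lt_max ltr01].
have hs : (\sum_(k <oo) (jens 1 (r ^+ 2 * A k))%:E + \sum_(k <oo) (lp r k)%:E
    = (Q * r ^+ 2 / 2)%:E)%E.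
  rewrite -nneseriesD; [|by move=> k _ _; rewrite lee_fin..|by move=> k _ _; rewrite lee_fin lp_ge0].
  under eq_eseriesr do rewrite -EFinD jens1 mulrAC EFinM.
  rewrite nneseriesZl; last by move=> k _; rewrite lee_fin.
  by rewrite hQ -EFinM; congr EFin; ring.
have s0 : (0 <= \sum_(k <oo) (lp r k)%:E)%E.
  by apply: nneseries_ge0 => k _ _; rewrite lee_fin lp_ge0.
have s1 : (0 <= \sum_(k <oo) (jens 1 (r ^+ 2 * A k))%:E)%E.
  by apply: nneseries_ge0 => k _ _; rewrite lee_fin.
have [J hJ] : exists J : R, (\sum_(k <oo) (jens 1 (r ^+ 2 * A k))%:E = J%:E)%E.
  move: hs s0 s1; case: (\sum_(k <oo) (jens _ _)%:E)%E => [J| |]//.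
    by exists J.
  by case: (\sum_(k <oo) _)%E => [?| |].
have hJ' : (\sum_(k <oo) (jens (dist2 (p k) (m k) 0 0) (r ^+ 2 * A k))%:E = J%:E)%E.
  rewrite -hJ; apply: eq_eseriesr => k _; congr (jens _ _)%:E.
  by rewrite dist2E; ring.
have r2 : r < 2 * r by lra.
(* The point found has modulus at most [2 r], and the error allowed is [r]; hence the constant
   [2 C + 1]. *)
have [x [y [/andP[h1 h2] h3]]] := jensen hQ rp r2 rp hJ'.
rewrite !subr0 in h1 h2.
have h4 : r0 ^+ 2 <= x ^+ 2 + y ^+ 2.
  by apply: le_trans h1; rewrite ler_pXn2r ?nnegrE// ltW.
have := le_trans h3 (hC h4); rewrite lee_fin => h5.
have h6 : Num.sqrt (x ^+ 2 + y ^+ 2) <= 2 * r.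
  have r20 : 0 <= 2 * r by lra.
  by rewrite -(ger0_norm r20) -sqrtr_sqr ler_sqrt// sqr_ge0.
have h7 := ler_wpM2l C0 h6.
move: hs; rewrite hJ; move: s0; case: (\sum_(k <oo) (lp r k)%:E)%E => [l| |]// _.
rewrite -EFinD => -[] h8; rewrite lee_fin.
move: h5; rewrite expr0n /= !add0r; lra.
Qed.

Let C' := 2 * C + 1.
Let C'0 : 0 <= C'. Proof. by apply: addr_ge0 => //; rewrite mulr_ge0 ?C0. Qed.

(* [farA] keeps the zeros of modulus larger than [s], [nearm] the others. *)
Definition farA s k : R := if A k * s ^+ 2 < 1 then A k * s ^+ 2 else 0.

Lemma farA_ge0 s k : 0 <= farA s k.
Proof. by rewrite /farA; case: ifP => // _; rewrite mulr_ge0 ?sqr_ge0. Qed.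

(* Among the dyadic multiples of [s] one puts [2^j s |q|] in the range [2, 4). *)
Lemma farA_le s k : 0 < s -> exists j : nat,
  farA s k <= 32 / 4 ^+ j * lp (2 ^+ j * s) k.
Proof.
move=> s0; rewrite /farA; case: ifPn => h; last first.
  by exists 0%N; rewrite expr0 divr1 mulr_ge0 ?lp_ge0.
have [Az|Az] := eqVneq (A k) 0.
  by exists 0%N; rewrite Az mul0r mulr_ge0 ?lp_ge0// divr_ge0.
have Ap : 0 < A k by rewrite lt0r Az A0.
set t := A k * s ^+ 2 in h *; have t0 : 0 < t by rewrite mulr_gt0 ?exprn_gt0.
have ex : exists j, 4 <= t * 4 ^+ j.
  exists (Num.truncn (4 / t)).+1.
  have := truncnS_gt (4 / t); set n := (Num.truncn _).+1 => hn.
  rewrite mulrC -ler_pdivrMr//; apply: (le_trans (ltW hn)).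
  by rewrite -natrX ler_nat ltnW// ltn_expl.
have [j hj jmin] := ex_minnP ex.
case: j hj jmin => [|j] hj jmin; first by rewrite expr0 mulr1 in hj; lra.
have hj2 : t * 4 ^+ j < 4.
  by rewrite ltNge; apply/negP => /jmin; rewrite ltnn.
have p4 : 0 < 4 ^+ j.+1 :> R by rewrite exprn_gt0.
exists j.+1.
have e : (2 ^+ j.+1 * s) ^+ 2 * A k = t * 4 ^+ j.+1.
  by rewrite exprMn -exprM mulnC exprM (_ : 2 ^+ 2 = 4 :> R) /t; [ring|ring].
have l1 : 1 / 2 <= lp (2 ^+ j.+1 * s) k.
  rewrite /lp e le_max; apply/orP; left.
  have : ln 4 <= ln (t * 4 ^+ j.+1) by rewrite ler_ln ?posrE// mulr_gt0.
  have : ln (4 : R) = 2 * ln 2.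
    by rewrite (_ : 4 = 2 ^+ 2 :> R) ?lnXn// ?mulr_natl//; ring.
  have := @ln_ge1BV R 2 ltac:(by []).
  lra.
(* Minimality gives [t 4^(j+1) < 16], and [lp] is at least 1/2; this is the origin of 32. *)
apply: (@le_trans _ _ (32 / 4 ^+ j.+1 * (1 / 2))).
  rewrite mulrAC ler_pdivlMr// exprS mulrCA; lra.
by rewrite ler_wpM2l// divr_ge0// ltW.
Qed.

(** After the sums over [k] and over the dyadic scales are exchanged, the bound [C' 2^j s] at scale
    [j] leaves the geometric series of terms [32 C' s / 2^j]. *)
Lemma sum_farA_le s : 0 < s -> r0 <= s -> 0 <= r0 ->
  (\sum_(k <oo) (farA s k)%:E <= (64 * C' * s)%:E)%E.
Proof.
move=> s0 r0s r00.
pose f k j := (32 / 4 ^+ j * lp (2 ^+ j * s) k)%:E.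
have f0 k j : (0 <= f k j)%E by rewrite lee_fin mulr_ge0 ?lp_ge0// divr_ge0 ?exprn_ge0.
apply: (@le_trans _ _ (\sum_(k <oo) \sum_(j <oo) f k j)%E).
  apply: lee_nneseries => [k _ _|k _]; first by rewrite lee_fin farA_ge0.
  have [j hj] := farA_le k s0.
  apply: (@le_trans _ _ (f k j)); first by rewrite lee_fin.
  apply: le_trans (nneseries_lim_ge j.+1 _); last by move=> i _ _.
  by rewrite big_nat_recr//= leeDr// sume_ge0.
rewrite nneseries_interchange//.
apply: (@le_trans _ _ (\sum_(j <oo) ((64 * C' * s) / (2 ^ j.+1)%:R)%:E)%E); last first.
  by apply: epsilon_trick0; rewrite !mulr_ge0// ltW.
apply: lee_nneseries => [j _ _|j _]; first exact: nneseries_ge0.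
rewrite /f; under eq_eseriesr do rewrite EFinM.
rewrite nneseriesZl; last by move=> k _; rewrite lee_fin lp_ge0.
have p2 : 0 < 2 ^+ j :> R by rewrite exprn_gt0.
have p21 : 1 <= 2 ^+ j :> R by rewrite exprn_ege1// ler1n.
have h := @sum_lp_le (2 ^+ j * s) (mulr_gt0 p2 s0).
apply: (@le_trans _ _ ((32 / 4 ^+ j)%:E * (C' * (2 ^+ j * s))%:E)%E).
  apply: lee_wpmul2l; first by rewrite lee_fin divr_ge0 ?exprn_ge0.
  by apply: h => //; apply: (le_trans r0s); rewrite ler_peMl// ltW.
rewrite -EFinM lee_fin le_eqVlt; apply/orP; left; apply/eqP.
rewrite natrX exprS (_ : 4 = 2 * 2 :> R) ?exprMn; last by ring.
by field; rewrite gt_eqF.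
Qed.

Let am k := `|m k|.
Definition nearm s k : R := if A k * s ^+ 2 < 1 then 0 else am k.

Lemma nearm_ge0 s k : 0 <= nearm s k.
Proof. by rewrite /nearm; case: ifP => // _; exact: normr_ge0. Qed.

(** For a far zero the left side is [farA s k / (2 s)]. For a near one, [m s + A s^2 / 2] is
    [rtheta] plus half the logarithm of [1 + 2 m s + A s^2], with [m] replaced by its absolute
    value; that quadratic is at most [4 A s^2], so half its logarithm is at most [lp (2 s) k]. *)
Lemma nearm_le s k : 0 < s -> nearm s k + A k * s / 2 <=
  rtheta (dist2 (p k) (am k) 0 s) / s + (lp (2 * s) k / s + farA s k / (2 * s)).
Proof.
move=> s0; have D0 := dist2_gt0 (p k) 0 (normr_ge0 (m k)) s0.
have r0' := rtheta_ge0 D0; have l0 := lp_ge0 (2 * s) k.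
rewrite /nearm /farA; case: ifPn => h.
  rewrite add0r (_ : A k * s / 2 = A k * s ^+ 2 / (2 * s)); last by field; exact: lt0r_neq0.
  by rewrite addrA lerDr addr_ge0 ?divr_ge0// ltW.
rewrite -leNgt in h; rewrite mul0r addr0.
have : ln (dist2 (p k) (am k) 0 s) / 2 <= lp (2 * s) k.
  rewrite /lp le_max; apply/orP; left; rewrite ler_pM2r ?invr_gt0//.
  have Q4 : (2 * s) ^+ 2 * A k = 4 * (A k * s ^+ 2) by ring.
  rewrite Q4 ler_ln ?posrE//; last by lra.
  rewrite dist2E real_normK ?num_real// -/(A k).
  have hm : am k ^+ 2 <= A k by rewrite real_normK ?num_real// lerDr sqr_ge0.
  have hms : (am k * s) ^+ 2 <= A k * s ^+ 2 by rewrite exprMn ler_wpM2r ?sqr_ge0.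
  have am0 := normr_ge0 (m k).
  have := sqr_ge0 (am k * s - 1); rewrite sqrrB => h2.
  by rewrite /am in hms h2 *; lra.
move=> h1.
rewrite -mulrDl ler_pdivlMr// mulrDl /rtheta.
rewrite {1}dist2E real_normK ?num_real// -/(A k).
have -> : A k * s / 2 * s = A k * s ^+ 2 / 2 by ring.
rewrite expr0n add0r mulr0 subr0 /am.
lra.
Qed.

(** Sum [nearm_le], multiply by pi and cancel [gsum] by means of [ineg_balance]. The point is that
    the bound does not depend on [s]. The constant is 2 from [lp] at radius [2 s] plus 32, half of
    the 64 in [sum_farA_le]. *)
Lemma ineg_nearm_le s : 0 < s -> r0 <= s -> 0 <= r0 ->
  (ineg p m Q s + pi%:E * \sum_(k <oo) (nearm s k)%:E
    <= apos p m Q + (34 * pi * C')%:E)%E.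
Proof.
move=> s0 r0s r00.
have s20 : 0 < 2 * s by lra.
have ps : 0 <= pi / s by rewrite divr_ge0 ?pi_ge0 ?ltW.
have rt0 k : 0 <= rtheta (dist2 (p k) (am k) 0 s).
  by rewrite rtheta_ge0// dist2_gt0 ?normr_ge0.
have h1 : (pi%:E * \sum_(k <oo) (nearm s k)%:E + (pi * Q * s / 2)%:E <=
    (pi / s)%:E * gsum p am 0 s + (34 * pi * C')%:E)%E.
  apply: (@le_trans _ _ ((pi / s)%:E * gsum p am 0 s
     + ((pi / s)%:E * \sum_(k <oo) (lp (2 * s) k)%:E
      + (pi / (2 * s))%:E * \sum_(k <oo) (farA s k)%:E))%E); last first.
    apply: leeD => //.
    have -> : 34 * pi * C' = pi / s * (C' * (2 * s)) + pi / (2 * s) * (64 * C' * s).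
      by field; exact: lt0r_neq0.
    rewrite EFinD !EFinM; apply: leeD; rewrite -EFinM; apply: lee_wpmul2l.
    - by rewrite lee_fin.
    - by apply: sum_lp_le => //; lra.
    - by rewrite lee_fin divr_ge0 ?pi_ge0 ?ltW.
    - exact: sum_farA_le.
  rewrite gsum_rtheta//.
  have -> : (pi * Q * s / 2)%:E = ((pi * s / 2)%:E * \sum_(k <oo) (A k)%:E)%E.
    by rewrite hQ -EFinM; congr EFin; ring.
  rewrite -!nneseriesZl; do ?by move=> k _; rewrite lee_fin ?lp_ge0 ?farA_ge0 ?nearm_ge0.
  have p1 k : (0 <= (pi / s)%:E * (rtheta (dist2 (p k) (am k) 0 s))%:E)%E.
    by rewrite -EFinM lee_fin mulr_ge0.
  have p2 k : (0 <= (pi / s)%:E * (lp (2 * s) k)%:E)%E.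
    by rewrite -EFinM lee_fin mulr_ge0 ?lp_ge0.
  have p3 k : (0 <= (pi / (2 * s))%:E * (farA s k)%:E)%E.
    by rewrite -EFinM lee_fin mulr_ge0 ?farA_ge0// divr_ge0 ?pi_ge0 ?ltW.
  have p4 k : (0 <= pi%:E * (nearm s k)%:E)%E.
    by rewrite -EFinM lee_fin mulr_ge0 ?nearm_ge0 ?pi_ge0.
  have p5 k : (0 <= (pi * s / 2)%:E * (A k)%:E)%E.
    by rewrite -EFinM lee_fin mulr_ge0// divr_ge0// mulr_ge0 ?pi_ge0// ltW.
  rewrite -!nneseriesD//; last by move=> k _ _; rewrite adde_ge0.
  apply: lee_nneseries => [k _ _|k _]; first by rewrite adde_ge0.
  rewrite -!EFinM -!EFinD lee_fin.
  have := ler_wpM2l (@pi_ge0 R) (nearm_le k s0) => h.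
  have -> : pi * nearm s k + pi * s / 2 * A k = pi * (nearm s k + A k * s / 2) by ring.
  apply: (le_trans h); rewrite le_eqVlt; apply/orP; left; apply/eqP.
  by field; exact: lt0r_neq0.
have h2 := ineg_balance hQ s0; have h3 := ipos_le p m Q s0.
rewrite -(@leeD2rE _ (pi * Q * s / 2)%:E)// -(addeA (ineg p m Q s)).
apply: (@le_trans _ _ (ineg p m Q s + ((pi / s)%:E * gsum p am 0 s + (34 * pi * C')%:E))%E).
  exact: leeD.
rewrite (addeA (ineg p m Q s)) h2 -(addeA (ipos p m Q s)) -(addeA (apos p m Q)).
by apply: leeD => //; rewrite addeC.
Qed.

(** As [s] grows, the bound of [ineg_nearm_le] stays fixed while [ineg] tends to [aneg] and any
    finite set of zeros is eventually near. *)
Lemma gam_aneg_fin : 0 <= r0 -> (apos p m Q < +oo)%E ->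
  (gam m < +oo)%E /\ (aneg p m Q < +oo)%E.
Proof.
move=> r00 ap; set M := (apos p m Q + (34 * pi * C')%:E)%E.
have M1 : (M < +oo)%E by rewrite /M lte_add_pinfty// ltry.
have nn0 s : (0 <= pi%:E * \sum_(k <oo) (nearm s k)%:E)%E.
  by rewrite mule_ge0 ?lee_fin ?pi_ge0// nneseries_ge0// => k _ _; rewrite lee_fin nearm_ge0.
split; last first.
  apply: le_lt_trans M1; apply: (aneg_le_of (s0 := r0)) => s hs s0.
  by apply: le_trans (ineg_nearm_le s0 hs r00); rewrite leeDl.
apply: (@le_lt_trans _ _ (pi^-1%:E * M)%E); last first.
  by rewrite lte_mul_pinfty// lee_fin invr_ge0 pi_ge0.
rewrite /gam; apply: lime_le.
  by apply: is_cvg_nneseries => k _ _; rewrite lee_fin normr_ge0.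
apply: nearW => K.
(* With [s >= 1] and [s >= 1 / A k] one has [A k s^2 >= 1], so the first [K] zeros are near. Indices
   with [A k = 0] add 0 to the sum, and for them [m k = 0]. *)
pose s : R := r0 + 1 + \sum_(0 <= k < K) (A k)^-1.
have sA : 0 <= \sum_(0 <= k < K) (A k)^-1 by apply: sumr_ge0 => k _; rewrite invr_ge0.
have s1 : 1 <= s by rewrite /s; lra.
have hs : r0 <= s by rewrite /s; lra.
have s0 : 0 < s by lra.
apply: (@le_trans _ _ (\sum_(k <oo) (nearm s k)%:E)%E); last first.
  rewrite -(@lee_pmul2l _ pi%:E) ?lte_fin ?pi_gt0//.
  rewrite muleA -EFinM mulfV ?gt_eqF ?pi_gt0// mul1e.
  by apply: le_trans (ineg_nearm_le s0 hs r00); rewrite leeDr// ineg_ge0.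
apply: le_trans (nneseries_lim_ge K _); last by move=> k _ _; rewrite lee_fin nearm_ge0.
rewrite big_nat [leRHS]big_nat; apply: lee_sum => k /andP[_ kK].
rewrite lee_fin /nearm; case: ifPn => // h.
have [Az|Az] := eqVneq (A k) 0.
  by move/eqP: Az; rewrite /A paddr_eq0 ?sqr_ge0// !sqrf_eq0 => /andP[_ /eqP ->]; rewrite normr0.
have Ap : 0 < A k by rewrite lt0r Az A0.
suff : 1 <= A k * s ^+ 2 by rewrite leNgt h.
have hAs : (A k)^-1 <= s.
  apply: (@le_trans _ _ (\sum_(0 <= k < K) (A k)^-1)); last by rewrite /s; lra.
  rewrite (bigD1_seq k)//= ?mem_index_iota ?iota_uniq//.
  by rewrite lerDl; apply: sumr_ge0 => i _; rewrite invr_ge0.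
rewrite mulrC -ler_pdivrMr// mul1r; apply: (le_trans hAs).
by rewrite expr2 ler_peMl// ltW.
Qed.

End FiniteGrowth.

(** * Upper bound for the growth *)

Section Translation.
Context {R : realType}.
Local Notation mu := (@lebesgue_measure R).

Lemma lebesgue_measure_shift (x : R) (A : set R) : measurable A ->
  pushforward mu (fun t : measurableTypeR R => (x + t : measurableTypeR R)) A = mu A.
Proof.
move=> mA; apply/esym.
have mf : measurable_fun setT (fun t : measurableTypeR R => (x + t : measurableTypeR R)).
  exact: measurable_funD.
pose f : {mfun measurableTypeR R >-> measurableTypeR R} :=
  HB.pack (fun t : measurableTypeR R => (x + t : measurableTypeR R))
    (isMeasurableFun.Build _ _ _ _ _ mf).
apply: (@lebesgue_measure_unique R (pushforward mu f)) => //= _ [[a b]] _ <-.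
rewrite /pushforward /f /=.
have -> : (fun t : R => x + t) @^-1` `]a, b] = `]a - x, b - x]%classic.
  by apply/seteqP; split=> t /=; rewrite !in_itv/= ltrBlDl lerBrDl.
by rewrite !lebesgue_measure_itv/= !lte_fin ltrD2r; case: ifP => // _; rewrite -!EFinD; congr EFin; ring.
Qed.

Lemma ge0_integral_shift (x : R) (f : R -> \bar R) : measurable_fun setT f ->
  (forall t, (0 <= f t)%E) -> (\int[mu]_t f (x + t)%R = \int[mu]_t f t)%E.
Proof.
move=> mf f0.
have mp : measurable_fun setT (fun t : measurableTypeR R => (x + t : measurableTypeR R)).
  exact: measurable_funD.
have := @ge0_integral_pushforward _ _ _ _ R _ mp mu setT f measurableT mf.
rewrite preimage_setT => <-; last by move=> t _; exact: f0.
by apply: eq_measure_integral => //= A mA _; exact: lebesgue_measure_shift.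
Qed.

End Translation.

Section Tannery.
Context {R : realType}.

(** Dominated convergence for series: [M] controls the tail uniformly in [s], and [c k / s] makes
    the remaining finitely many terms small. *)
Lemma tannery (f : R -> nat -> R) (M c : nat -> R) :
  (forall s k, 1 <= s -> 0 <= f s k) -> (forall k, 0 <= M k) ->
  (\sum_(k <oo) (M k)%:E < +oo)%E ->
  (forall s k, 1 <= s -> f s k <= M k) ->
  (forall s k, 1 <= s -> f s k <= c k / s) ->
  forall e, 0 < e -> exists2 s0, 1 <= s0 & forall s, s0 <= s ->
    (\sum_(k <oo) (f s k)%:E <= e%:E)%E.
Proof.
move=> f0 M0 sM fM fc e e0.
have e2 : 0 < e / 2 by rewrite divr_gt0.
have [K hK] := nneseries_tail_small M0 sM e2.
pose T := \sum_(0 <= k < K) `|c k|.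
have T0 : 0 <= T by apply: sumr_ge0.
exists (1 + T / (e / 2)); first by rewrite lerDl divr_ge0// ltW.
move=> s hs; have s1 : 1 <= s by apply: le_trans hs; rewrite lerDl divr_ge0// ltW.
have s0 : 0 < s by lra.
rewrite (nneseries_split 0 K); last by move=> k _; rewrite lee_fin f0.
rewrite add0n (splitr e) EFinD; apply: leeD.
  rewrite sumEFin lee_fin; apply: (@le_trans _ _ (T / s)).
    rewrite /T mulr_suml; apply: ler_sum => k _; apply: (le_trans (fc s k s1)).
    by rewrite ler_wpM2r ?invr_ge0 ?ler_norm// ltW.
  rewrite ler_pdivrMr// mulrC -ler_pdivrMr//.
  by apply: le_trans hs; rewrite lerDr.
apply: (le_trans _ (ltW hK)).
rewrite -[leLHS]nneseries_addn; last by move=> k; rewrite lee_fin f0.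
rewrite -[leRHS]nneseries_addn; last by move=> k; rewrite lee_fin.
by apply: lee_nneseries => [k _ _|k _]; rewrite lee_fin ?f0 ?fM.
Qed.

End Tannery.

Section AxisHeight.
Context {R : realType}.
Implicit Types r s t x y : R.
Local Notation mu := (@lebesgue_measure R).

Section Upper.
Variables (p m : nat -> R) (Q : R).
Hypothesis hQ : (\sum_(k <oo) (p k ^+ 2 + m k ^+ 2)%:E = Q%:E)%E.
Variables (ap an : R).
Hypothesis hap : apos p m Q = ap%:E.
Hypothesis han : aneg p m Q = an%:E.
Let A k := p k ^+ 2 + m k ^+ 2.
Let A0 k : 0 <= A k.
Proof. by rewrite addr_ge0 ?sqr_ge0. Qed.
Let am k := `|m k|.
Let kst := (an - ap) / pi.

(* [log |Pi* (x + i s)| / s], where [Pi*] has the zeros reflected into the lower half plane. *)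
Definition hgt x s : R := (Q * (x ^+ 2 + s ^+ 2) / 2 - fine (gsum p am x s)) / s.

Lemma hgt_balance s : 0 < s ->
  pi * hgt 0 s = fine (ineg p m Q s) - fine (ipos p m Q s).
Proof.
move=> s0; have := ineg_balance hQ s0.
have := gsum0_fin hQ s0; have := ipos_fin hQ s0; rewrite /hgt.
have : ineg p m Q s \is a fin_num.
  rewrite ge0_fin_numE ?ineg_ge0//; apply: le_lt_trans (ineg_le p m Q s0) _.
  by rewrite han ltry.
rewrite -/am; move: (ineg p m Q s) (ipos p m Q s) (gsum p am 0 s) => [a| |] [b| |] [g| |]//= _ _ _.
rewrite -EFinM -!EFinD => -[] h.
rewrite expr0n add0r; apply: (mulIf (lt0r_neq0 s0)).
have e : (a + pi / s * g) * s = (b + pi * Q * s / 2) * s by rewrite h.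
rewrite mulrA divfK ?gt_eqF//.
have : a * s + pi * g = b * s + pi * Q * s / 2 * s.
  by rewrite -mulrDl -e; field; exact: lt0r_neq0.
lra.
Qed.

Lemma hgt_cvg e : 0 < e -> exists2 s0, 1 <= s0 & forall s, s0 <= s -> `|hgt 0 s - kst| <= e.
Proof.
move=> e0.
have pe : 0 < pi * e by rewrite mulr_gt0 ?pi_gt0.
have near_of (I : R -> \bar R) (l : R) : (I n.+1%:R @[n --> \oo] --> l%:E)%E ->
    exists n : nat, (I n.+1%:R > (l - pi * e)%:E)%E.
  move=> /fine_cvgP[hf hl].
  have [N _ HN] : \forall n \near \oo, (I n.+1%:R > (l - pi * e)%:E)%E.
    near=> n.
    have h1 : I n.+1%:R \is a fin_num by near: n; exact: hf.
    rewrite -(fineK h1) lte_fin; near: n.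
    by apply: (cvgr_gt l hl); rewrite gtrDl oppr_lt0.
  by exists N; apply: HN => /=.
have [n1 h1] : exists n : nat, ((ap - pi * e)%:E < ipos p m Q n.+1%:R)%E.
  by apply: near_of; rewrite -hap; exact: cvg_ipos.
have [n2 h2] : exists n : nat, ((an - pi * e)%:E < ineg p m Q n.+1%:R)%E.
  by apply: near_of; rewrite -han; exact: cvg_ineg.
exists (maxn n1 n2).+1%:R; first by rewrite ler1n.
move=> s hs.
have hs1 : n1.+1%:R <= s by apply: le_trans hs; rewrite ler_nat ltnS leq_maxl.
have hs2 : n2.+1%:R <= s by apply: le_trans hs; rewrite ler_nat ltnS leq_maxr.
have s0 : 0 < s by apply: lt_le_trans hs1; rewrite ltr0n.
have {}h1 := lt_le_trans h1 (ipos_homo p m Q (ltr0Sn _ _) hs1).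
have {}h2 := lt_le_trans h2 (ineg_homo p m Q (ltr0Sn _ _) hs2).
have h3 := ipos_le p m Q s0; have h4 := ineg_le p m Q s0.
rewrite hap in h3; rewrite han in h4.
have hb := hgt_balance s0.
move: hb h1 h2 h3 h4; move: (ipos p m Q s) (ineg p m Q s) => [a| |] [b| |]//=.
rewrite !lte_fin !lee_fin => hb h1 h2 h3 h4.
rewrite -(ler_pM2l (@pi_gt0 R)) -{1}(gtr0_norm (@pi_gt0 R)) -normrM mulrBr hb.
rewrite /kst mulrC divfK ?gt_eqF ?pi_gt0// ler_norml; apply/andP; split; lra.
Unshelve. all: by end_near. Qed.

End Upper.
End AxisHeight.

(** * Poisson's bound for the reflected product *)

Section PoissonBound.
Context {R : realType}.
Implicit Types r s t x y : R.
Local Notation mu := (@lebesgue_measure R).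

(** With [D = dist2 p' m' 0 s], the bound [ln v <= v - 1] for the ratio of the two squared moduli
    leaves [p' x (1 - 1 / D)], and [1 - 1 / D] equals [s (2 m' + (p'^2 + m'^2) s) / D]. In this
    form, after division by [s], the terms suit [tannery]. *)
Lemma rtheta_shift_le (p' m' x s : R) : 0 <= m' -> 0 < s ->
  rtheta (dist2 p' m' 0 s) + (p' ^+ 2 + m' ^+ 2) * x ^+ 2 / 2 <=
  rtheta (dist2 p' m' x s)
   + s * (`|p'| * `|x| * ((2 * m' + (p' ^+ 2 + m' ^+ 2) * s) / dist2 p' m' 0 s))
   + (p' ^+ 2 + m' ^+ 2) * x ^+ 2 / 2.
Proof.
move=> m0 s0; have D0 := dist2_gt0 p' 0 m0 s0; have D1 := dist2_gt0 p' x m0 s0.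
set a := p' ^+ 2 + m' ^+ 2; have a0 : 0 <= a by rewrite addr_ge0 ?sqr_ge0.
set D := dist2 p' m' 0 s in D0 *; set D' := dist2 p' m' x s in D1 *.
have E0 : D = 1 + s * (2 * m' + a * s) by rewrite /D dist2E /a; ring.
have E1 : D' = D - 2 * p' * x + a * x ^+ 2 by rewrite /D' /D !dist2E /a; ring.
have q0 : 0 <= 2 * m' + a * s by rewrite addr_ge0 ?mulr_ge0// ltW.
have Dge1 : 1 <= D by rewrite E0 lerDl mulr_ge0// ltW.
have h : ln (D' / D) <= D' / D - 1 by rewrite ln_leB1// divr_gt0.
rewrite ln_div ?posrE// in h.
have e1 : D' / D - 1 = (- 2 * p' * x + a * x ^+ 2) / D by rewrite E1; field; exact: lt0r_neq0.
rewrite e1 in h.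
rewrite lerD2r /rtheta.
have hp : p' * x <= `|p'| * `|x| by rewrite -normrM ler_norm.
have w0 : 0 <= s * ((2 * m' + a * s) / D) by rewrite mulr_ge0 ?divr_ge0 ?(ltW s0) ?(ltW D0).
have hw := ler_wpM2r w0 hp.
have we : s * ((2 * m' + a * s) / D) = 1 - 1 / D.
  have sq : s * (2 * m' + a * s) = D - 1 by rewrite E0; ring.
  by rewrite mulrA sq mulrBl divff ?lt0r_neq0.
rewrite we in hw w0.
have -> : s * (`|p'| * `|x| * ((2 * m' + a * s) / D)) = `|p'| * `|x| * (1 - 1 / D).
  by rewrite -we; ring.
have ax : a * x ^+ 2 / D <= a * x ^+ 2.
  by rewrite ler_pdivrMr// ler_peMr// mulr_ge0 ?sqr_ge0.
have -> : (D' - 1) / 2 = (D - 1) / 2 - p' * x + a * x ^+ 2 / 2 by rewrite E1; field.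
have e2 : (-2 * p' * x + a * x ^+ 2) / D = - 2 * (p' * x * (1 / D)) + a * x ^+ 2 / D by field; exact: lt0r_neq0.
rewrite e2 in h.
have e3 : p' * x * (1 - 1 / D) = p' * x - p' * x * (1 / D) by ring.
rewrite e3 in hw; lra.
Qed.

Section Upper.
Variables (p m : nat -> R) (Q : R).
Hypothesis hQ : (\sum_(k <oo) (p k ^+ 2 + m k ^+ 2)%:E = Q%:E)%E.
Let A k := p k ^+ 2 + m k ^+ 2.
Let A0 k : 0 <= A k.
Proof. by rewrite addr_ge0 ?sqr_ge0. Qed.
Let am k := `|m k|.

(** In terms of potentials: high above a fixed [x], log |Pi*| exceeds its value at [i s] by at most
    [e s]. Hence the limit on the imaginary axis bounds the growth along every vertical line. *)
Lemma gsum_shift_le x e : 0 < e -> exists2 s0, 1 <= s0 & forall s, s0 <= s ->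
  (gsum p am 0 s + (Q * x ^+ 2 / 2)%:E <= gsum p am x s + (e * s)%:E)%E.
Proof.
move=> e0.
have sA : (\sum_(k <oo) (A k)%:E < +oo)%E by rewrite hQ ltry.
have Q0 := sum_sqr_ge0 hQ.
have sM : (\sum_(k <oo) (2 * `|x| * A k)%:E < +oo)%E.
  by apply: (nneseries_fin_of_le (C := 2 * `|x|) (K := 0%N) _ A0 _ _ sA) => // k;
    rewrite ?mulr_ge0.
pose f s k := `|p k| * `|x| * ((2 * am k + A k * s) / dist2 (p k) (am k) 0 s).
have am0 k : 0 <= am k by exact: normr_ge0.
have Aam k : p k ^+ 2 + am k ^+ 2 = A k by rewrite real_normK ?num_real.
have DE s k : dist2 (p k) (am k) 0 s = 1 + s * (2 * am k + A k * s).
  by rewrite dist2E Aam; ring.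
have q0 s k : 0 < s -> 0 <= 2 * am k + A k * s.
  by move=> s0; rewrite addr_ge0 ?mulr_ge0// ltW.
have D1 s k : 0 < s -> 1 <= dist2 (p k) (am k) 0 s.
  by move=> s0; rewrite DE lerDl mulr_ge0 ?q0// ltW.
have D0 s k : 0 < s -> 0 < dist2 (p k) (am k) 0 s by move=> /(D1 s k); lra.
have f0 s k : 1 <= s -> 0 <= f s k.
  move=> s1; have s0 : 0 < s by lra.
  by rewrite /f mulr_ge0 ?mulr_ge0 ?invr_ge0 ?q0 ?(ltW (D0 s k s0)).
have [s1 s11 hs1] : exists2 s0, 1 <= s0 & forall s, s0 <= s ->
    (\sum_(k <oo) (f s k)%:E <= (e / 2)%:E)%E.
  apply: (@tannery R f (fun k => 2 * `|x| * A k) (fun k => 2 * (`|p k| * `|x|))) => //.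
  - by move=> k; rewrite !mulr_ge0.
  - move=> s k sge1; have s0 : 0 < s by lra.
    have -> : f s k = `|x| * (`|p k| * (2 * am k + A k * s) / dist2 (p k) (am k) 0 s).
      by rewrite /f; ring.
    rewrite (_ : 2 * `|x| * A k = `|x| * (2 * A k)); last by ring.
    rewrite ler_wpM2l// ler_pdivrMr ?D0//.
    have h1 : `|p k| * (2 * am k) <= A k.
      have := sqr_ge0 (`|p k| - am k); rewrite sqrrB !real_normK ?num_real// /A; lra.
    have h2 : `|p k| * s <= dist2 (p k) (am k) 0 s.
      rewrite DE.
      have h3 : (`|p k| * s) ^+ 2 <= s * (A k * s).
        rewrite exprMn real_normK ?num_real// /A.
        have := mulr_ge0 (sqr_ge0 (m k)) (sqr_ge0 s); lra.
      have := sqr_ge0 (`|p k| * s - 1); have := mulr_ge0 (ltW s0) (am0 k).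
      have := sqr_ge0 (`|p k| * s); rewrite sqrrB; lra.
    have h4 := ler_wpM2l (A0 k) h2.
    have h5 := ler_wpM2l (A0 k) (D1 s k s0).
    lra.
  - move=> s k sge1; have s0 : 0 < s by lra.
    rewrite (_ : 2 * (`|p k| * `|x|) / s = `|p k| * `|x| * (2 / s)); last by ring.
    rewrite /f ler_wpM2l ?mulr_ge0//.
    rewrite ler_pdivrMr ?D0// mulrAC ler_pdivlMr//.
    by have := D1 s k s0; rewrite !DE; lra.
  - by rewrite divr_gt0.
exists (s1 + Q * x ^+ 2 / e).
  have : 0 <= Q * x ^+ 2 / e by rewrite divr_ge0 ?(ltW e0)// mulr_ge0 ?sqr_ge0.
  lra.
move=> s hs; have z0 : 0 <= Q * x ^+ 2 / e by rewrite divr_ge0 ?(ltW e0)// mulr_ge0 ?sqr_ge0.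
have ss1 : s1 <= s by lra.
have s0 : 0 < s by lra.
have hse : Q * x ^+ 2 <= e * s.
  by rewrite [e * s]mulrC -ler_pdivrMr//; lra.
have Ax : (\sum_(k <oo) ((x ^+ 2 / 2) * A k)%:E)%E = (Q * x ^+ 2 / 2)%:E.
  under eq_eseriesr do rewrite EFinM.
  rewrite nneseriesZl; last by move=> k _; rewrite lee_fin.
  by rewrite hQ -EFinM; congr EFin; ring.
have r0 z k : 0 <= rtheta (dist2 (p k) (am k) z s).
  by rewrite rtheta_ge0// dist2_gt0.
apply: (@le_trans _ _ (gsum p am x s + (s%:E * \sum_(k <oo) (f s k)%:E
    + \sum_(k <oo) ((x ^+ 2 / 2) * A k)%:E))%E); last first.
  apply: leeD => //.
  apply: (@le_trans _ _ ((s * (e / 2))%:E + (Q * x ^+ 2 / 2)%:E)%E).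
    apply: leeD; last by rewrite Ax.
    by rewrite EFinM; apply: lee_wpmul2l; [rewrite lee_fin ltW|exact: hs1].
  by rewrite -EFinD lee_fin; lra.
rewrite -{1}Ax !gsum_rtheta//.
have g0 k : 0 <= x ^+ 2 / 2 * A k by rewrite mulr_ge0 ?divr_ge0 ?sqr_ge0.
have s1' : 1 <= s by lra.
have ff0 k : 0 <= f s k by exact: f0.
rewrite -nneseriesZl; last by move=> k _; rewrite lee_fin.
have sf k : (0 <= s%:E * (f s k)%:E)%E by rewrite -EFinM lee_fin mulr_ge0// ltW.
rewrite -!nneseriesD; do ?by move=> k _ _; rewrite ?adde_ge0 ?sf ?lee_fin ?r0 ?g0.
apply: lee_nneseries => [k _ _|k _]; first by rewrite adde_ge0// lee_fin.
rewrite -!EFinM -!EFinD lee_fin.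
have := @rtheta_shift_le (p k) (am k) x s (am0 k) s0; rewrite Aam.
rewrite /f; lra.
Qed.

Variables (ap an : R).
Hypothesis hap : apos p m Q = ap%:E.
Hypothesis han : aneg p m Q = an%:E.
Let kst := (an - ap) / pi.

(** It says that log |Pi*| at [x + i s1] is at most [s1 (kst + B)], where [s1 B] bounds the Poisson
    integral of log^+ |Pi|. In [integral_gsum] the far height [s2] contributes only the slope [kst],
    up to an arbitrarily small error. *)
Lemma gsum_ge x s1 B : 0 < s1 ->
  (\int[mu]_t (lpos p m Q (x + t) * ((t ^+ 2 + s1 ^+ 2)^-1)%:E) <= (pi * B)%:E)%E ->
  ((Q * (x ^+ 2 + s1 ^+ 2) / 2)%:E <= gsum p am x s1 + (s1 * (kst + B))%:E)%E.
Proof.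
move=> s10 hB.
case g1E : (gsum p am x s1) => [g1| |]; last 2 first.
- by rewrite leey.
- by have := gsum_ge0 p am x s1; rewrite g1E.
rewrite -EFinD lee_fin; apply/ler_addgt0Pr => e e0.
pose e' := e / s1; have e'0 : 0 < e' / 2 by rewrite !divr_gt0.
have [sa sa1 ha] := gsum_shift_le x e'0.
have [sb sb1 hb] := hgt_cvg hQ hap han e'0.
(* Beyond both thresholds: the sideways shift and the distance of [hgt] from its limit each use half
   of [e']. *)
pose s2 := s1 + sa + sb.
have s12 : s1 < s2 by rewrite /s2; lra.
have s20 : 0 < s2 := lt_trans s10 s12.
have sa2 : sa <= s2 by rewrite /s2; lra.
have sb2 : sb <= s2 by rewrite /s2; lra.
have {}ha := ha s2 sa2; have {}hb := hb s2 sb2.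
have I2 := integral_gsum hQ x s10 s12.
have mN := @measurable_cauchyB R s1 s2.
have N0 t : 0 <= cauchyB s1 s2 t by exact: cauchyB_ge0.
have mg : measurable_fun setT (fun t => gsum p m (x + t) 0).
  exact: (measurableT_comp (measurable_gsum p m 0) (measurable_funD _ _)).
have ml : measurable_fun setT (fun t => lpos p m Q (x + t)).
  exact: (measurableT_comp (measurable_lpos p m Q) (measurable_funD _ _)).
have mNe : measurable_fun setT (fun t => (cauchyB s1 s2 t)%:E) by exact/measurable_EFinP.
have lb : ((Q / 2 * (pi * (s2 - s1 + x ^+ 2 * (s1^-1 - s2^-1))))%:E <=
    \int[mu]_t (gsum p m (x + t) 0 * (cauchyB s1 s2 t)%:E) + (pi * B)%:E)%E.
  apply: (@le_trans _ _ (\int[mu]_t (gsum p m (x + t) 0 * (cauchyB s1 s2 t)%:E)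
     + \int[mu]_t (lpos p m Q (x + t) * (cauchyB s1 s2 t)%:E))%E); last first.
    apply: leeD => //; apply: le_trans hB; apply: ge0_le_integral => //.
    - by move=> t _; rewrite mule_ge0 ?lpos_ge0// lee_fin.
    - exact: emeasurable_funM.
    - by apply: emeasurable_funM => //; apply/measurable_EFinP; exact: measurable_cauchy.
    - move=> t _; apply: lee_wpmul2l; first exact: lpos_ge0.
      by rewrite lee_fin gerBl ltW// cauchy_gt0.
  rewrite -ge0_integralD//; last 4 first.
  - by move=> t _; rewrite mule_ge0 ?gsum_ge0// lee_fin.
  - exact: emeasurable_funM.
  - by move=> t _; rewrite mule_ge0 ?lpos_ge0// lee_fin.
  - exact: emeasurable_funM.
  have -> : (Q / 2 * (pi * (s2 - s1 + x ^+ 2 * (s1^-1 - s2^-1))))%:E =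
     (\int[mu]_t ((Q / 2)%:E * ((t - (- x)) ^+ 2 * cauchyB s1 s2 t)%:E))%E.
    rewrite ge0_integralZl_EFin//.
    + by rewrite integral_sqr_cauchyB// sqrrN EFinM.
    + by move=> t _; rewrite lee_fin mulr_ge0 ?sqr_ge0.
    + apply/measurable_EFinP; apply: measurable_funM => //; apply: measurable_funX.
      exact: measurable_funB.
    + by rewrite divr_ge0// (sum_sqr_ge0 hQ).
  apply: ge0_le_integral => //.
  - move=> t _; rewrite -EFinM lee_fin mulr_ge0//.
      by rewrite divr_ge0// (sum_sqr_ge0 hQ).
    by rewrite mulr_ge0 ?sqr_ge0.
  - apply: (emeasurable_funM (f := fun=> (Q / 2)%:E)) => //; apply/measurable_EFinP.
    by apply: measurable_funM => //; apply: measurable_funX; exact: measurable_funB.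
  - by apply: emeasurable_funD; exact: emeasurable_funM.
  - move=> t _; rewrite -ge0_muleDl ?gsum_ge0 ?lpos_ge0// (EFinM ((t - - x) ^+ 2)) muleA.
    apply: lee_wpmul2r; first by rewrite lee_fin.
    rewrite (gsum_lpos p m Q (x + t)) -EFinM (_ : Q / 2 * (t - - x) ^+ 2 = Q * (x + t) ^+ 2 / 2); last by ring.
    by rewrite leeDl// lneg_ge0.
have i0 : (0 <= \int[mu]_t (gsum p m (x + t) 0 * (cauchyB s1 s2 t)%:E))%E.
  by apply: integral_ge0 => t _; rewrite mule_ge0 ?gsum_ge0// lee_fin.
rewrite -/am g1E in I2.
have G0 := gsum0_fin hQ s20; rewrite -/am in G0.
move: hb; rewrite /hgt -/am -/kst => hb.
have ps2 : 0 < pi / s2 by rewrite divr_gt0 ?pi_gt0.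
have g20 := gsum_ge0 p am x s2.
move: I2 lb i0 ha G0 hb g20.
move: (\int[mu]_t _)%E (gsum p am x s2) (gsum p am 0 s2) => [i| |] [g2| |] [g0| |]//=; last 2 first.
- by rewrite gt0_muley ?lte_fin.
- by rewrite gt0_muley ?lte_fin.
rewrite -!EFinM -!EFinD !lee_fin => -[] I2 lb i0 ha _ hb g20.
have ph := @pi_gt0 R.
move: hb; rewrite ler_norml => /andP[_ hb].
rewrite expr0n add0r lerBlDr ler_pdivrMr// in hb.
have [P hP] : exists P : R, P = pi by exists pi.
rewrite -hP in ph I2 lb.
have I2' : i / P + g2 / s2 = g1 / s1 + Q * (s2 - s1).
  have -> : i / P + g2 / s2 = (i + P / s2 * g2) / P by field; rewrite ?(lt0r_neq0 ph) ?(lt0r_neq0 s10) ?(lt0r_neq0 s20).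
  by rewrite I2; field; rewrite ?(lt0r_neq0 ph) ?(lt0r_neq0 s10) ?(lt0r_neq0 s20).
have lb' : Q / 2 * (s2 - s1 + x ^+ 2 * (s1^-1 - s2^-1)) <= i / P + B.
  rewrite -(ler_pM2l ph); have -> : P * (i / P + B) = i + P * B by field; rewrite ?(lt0r_neq0 ph) ?(lt0r_neq0 s10) ?(lt0r_neq0 s20).
  by lra.
have e2 : (g0 + Q * x ^+ 2 / 2) / s2 <= g2 / s2 + e' / 2.
  by rewrite ler_pdivrMr// mulrDl divfK ?gt_eqF//; lra.
have e3 : Q * s2 / 2 - g0 / s2 <= e' / 2 + kst.
  rewrite -(ler_pM2r s20); have -> : (Q * s2 / 2 - g0 / s2) * s2 = Q * s2 ^+ 2 / 2 - g0.
    by field; rewrite ?(lt0r_neq0 ph) ?(lt0r_neq0 s10) ?(lt0r_neq0 s20).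
  lra.
have e4 : (g0 + Q * x ^+ 2 / 2) / s2 = g0 / s2 + Q / 2 * (x ^+ 2 * s2^-1) by ring.
have : Q / 2 * (s1 + x ^+ 2 * s1^-1) <= g1 / s1 + (kst + B) + e'.
  rewrite e4 in e2; rewrite mulrBr in lb'; lra.
have -> : Q / 2 * (s1 + x ^+ 2 * s1^-1) = Q * (x ^+ 2 + s1 ^+ 2) / 2 / s1.
  by field; rewrite ?(lt0r_neq0 ph) ?(lt0r_neq0 s10) ?(lt0r_neq0 s20).
rewrite ler_pdivrMr//.
have -> : (g1 / s1 + (kst + B) + e') * s1 = g1 + s1 * (kst + B) + e.
  by rewrite /e'; field; rewrite ?(lt0r_neq0 ph) ?(lt0r_neq0 s10) ?(lt0r_neq0 s20).
by [].
Qed.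

End Upper.
End PoissonBound.

(** * From the reflected product back to the product *)

Section UpperBound.
Context {R : realType}.
Implicit Types r s t x y : R.
Local Notation mu := (@lebesgue_measure R).

(** The reflected factor at the greater height has the larger modulus, so the logarithms compare in
    the right direction. What remains is quadratic, or the linear term [|m'| y' - m' y] split by the
    sign of [m']. Raising [y] to [y' > 0] lets Poisson's formula reach the real axis too. *)
Lemma theta_reflect_le (p' m' x y y' : R) : 0 <= y -> y <= y' -> 0 < y' ->
  ((rtheta (dist2 p' `|m'| x y'))%:E + ((p' ^+ 2 + m' ^+ 2) * ((x ^+ 2 + y ^+ 2) / 2))%:E <=
   theta (dist2 p' m' x y) + ((p' ^+ 2 + m' ^+ 2) * ((x ^+ 2 + y' ^+ 2) / 2)
     + Num.max (- m') 0 * (y' + y) + Num.max m' 0 * (y' - y))%:E)%E.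
Proof.
move=> y0 yy' y'0; set a := p' ^+ 2 + m' ^+ 2.
have a0 : 0 <= a by rewrite addr_ge0 ?sqr_ge0.
have Em : m' = Num.max m' 0 - Num.max (- m') 0 /\ `|m'| = Num.max m' 0 + Num.max (- m') 0.
  have [m0|m0] := leP 0 m'.
    by rewrite max_r ?oppr_le0// ger0_norm//; split; ring.
  by rewrite max_l ?oppr_ge0 ?(ltW m0)// ltr0_norm//; split; ring.
have [n0 q0] : 0 <= Num.max (- m') 0 /\ 0 <= Num.max m' 0 by rewrite !le_max lexx !orbT.
have [d0|d0] := leP (dist2 p' m' x y) 0.
  by rewrite /theta d0 addye// leey.
rewrite (theta_pos d0) -!EFinD lee_fin.
have dD : dist2 p' m' x y <= dist2 p' `|m'| x y'.
  rewrite !dist2E real_normK ?num_real// -/a.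
  have h1 : y ^+ 2 <= y' ^+ 2 by rewrite ler_pXn2r// nnegrE ltW.
  have h2 := ler_wpM2l a0 h1.
  have h3 : m' * y <= `|m'| * y' by apply: (le_trans (ler_norm _)); rewrite normrM ler_wpM2l// ger0_norm.
  lra.
have D0 := lt_le_trans d0 dD.
have hl : ln (dist2 p' m' x y) <= ln (dist2 p' `|m'| x y') by rewrite ler_ln ?posrE.
rewrite /rtheta; move: hl; set L1 := ln _; set L2 := ln _.
rewrite !dist2E real_normK ?num_real// -/a.
case: Em; move: (Num.max (- m') 0) (Num.max m' 0) n0 q0 => u v u0 v0 e1 -> hl.
have e2 : m' * y = (v - u) * y by rewrite -e1.
lra.
Qed.

Lemma gamE (m : nat -> R) : (gam m =
  \sum_(k <oo) (Num.max (- m k) 0)%:E + \sum_(k <oo) (Num.max (m k) 0)%:E)%E.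
Proof.
rewrite -nneseriesD; do ?by move=> k _ _; rewrite lee_fin le_max lexx orbT.
apply: eq_eseriesr => k _; rewrite -EFinD; congr EFin.
have [m0|m0] := leP 0 (m k).
  by rewrite max_r ?oppr_le0// ger0_norm//; ring.
by rewrite max_l ?oppr_ge0 ?(ltW m0)// ltr0_norm//; ring.
Qed.

Section Upper.
Variables (p m : nat -> R) (Q : R).
Hypothesis hQ : (\sum_(k <oo) (p k ^+ 2 + m k ^+ 2)%:E = Q%:E)%E.
Let am k := `|m k|.
Variables (ap an gn gp : R).
Hypothesis hap : apos p m Q = ap%:E.
Hypothesis han : aneg p m Q = an%:E.
Hypothesis hgn : (\sum_(k <oo) (Num.max (- m k) 0)%:E = gn%:E)%E.
Hypothesis hgp : (\sum_(k <oo) (Num.max (m k) 0)%:E = gp%:E)%E.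
Let kst := (an - ap) / pi.

Lemma gam_sum : gam m = (gn + gp)%:E.
Proof. by rewrite gamE hgn hgp. Qed.

Lemma kst_ge : - (gn + gp) <= kst.
Proof.
have := apos_le hQ; rewrite hap han gam_sum -EFinM -EFinD lee_fin => h.
by rewrite /kst ler_pdivlMr ?pi_gt0//; lra.
Qed.

Lemma gsum_reflect_le x y y' : 0 <= y -> y <= y' -> 0 < y' ->
  (gsum p am x y' + (Q * (x ^+ 2 + y ^+ 2) / 2)%:E <=
   gsum p m x y + (Q * (x ^+ 2 + y' ^+ 2) / 2 + gn * (y' + y) + gp * (y' - y))%:E)%E.
Proof.
move=> y0 yy' y'0.
have Z (f : nat -> R) (l s : R) : (forall k, 0 <= f k) -> 
    (\sum_(k <oo) (f k)%:E = l%:E)%E -> (\sum_(k <oo) (f k * s)%:E = (l * s)%:E)%E.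
  move=> f0 h; rewrite mulrC EFinM -h -nneseriesZl; last by move=> k _; rewrite lee_fin.
  by apply: eq_eseriesr => k _; rewrite mulrC EFinM.
have A0 k : 0 <= p k ^+ 2 + m k ^+ 2 by rewrite addr_ge0 ?sqr_ge0.
have n0 k : 0 <= Num.max (- m k) 0 by rewrite le_max lexx orbT.
have q0 k : 0 <= Num.max (m k) 0 by rewrite le_max lexx orbT.
have r0 k : 0 <= rtheta (dist2 (p k) (am k) x y') by rewrite rtheta_ge0// dist2_gt0 ?normr_ge0.
have z1 : 0 <= y' + y by lra.
have z2 : 0 <= y' - y by lra.
have t0 k s : 0 <= (p k ^+ 2 + m k ^+ 2) * ((x ^+ 2 + s ^+ 2) / 2).
  by rewrite mulr_ge0// divr_ge0// addr_ge0 ?sqr_ge0.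
have t1 k : 0 <= Num.max (- m k) 0 * (y' + y) by rewrite mulr_ge0.
have t2 k : 0 <= Num.max (m k) 0 * (y' - y) by rewrite mulr_ge0.
rewrite !EFinD -!(mulrA Q) -(Z _ _ _ A0 hQ) -(Z _ _ _ A0 hQ) -(Z _ _ _ n0 hgn) -(Z _ _ _ q0 hgp).
rewrite gsum_rtheta// /gsum -!nneseriesD;
  do ?by move=> k _ _; rewrite ?adde_ge0 ?theta_ge0 ?lee_fin ?t0 ?t1 ?t2 ?r0.
apply: lee_nneseries => [k _ _|k _].
  by rewrite adde_ge0 ?lee_fin ?t0 ?r0.
by rewrite -!EFinD; exact: theta_reflect_le.
Qed.

Lemma lpot_le x y y' B : 0 <= y -> y <= y' -> 0 < y' ->
  (\int[mu]_t (lpos p m Q (x + t) * ((t ^+ 2 + y' ^+ 2)^-1)%:E) <= (pi * B)%:E)%E ->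
  (lpot p m Q x y <= (y' * (kst + B) + gn * (y' + y) + gp * (y' - y))%:E)%E.
Proof.
move=> y0 yy' y'0 hB.
have := gsum_ge hQ hap han y'0 hB; have := gsum_reflect_le x y0 yy' y'0.
rewrite /lpot -/am -/kst; have := gsum_ge0 p am x y'; have := gsum_ge0 p m x y.
case: (gsum p m x y) (gsum p am x y') => [g| |] [g'| |]//=; last 2 first.
- by rewrite addeNy leNye.
- by rewrite addeNy leNye.
by rewrite -!EFinD !lee_fin => _ _ h1 h2; lra.
Qed.

Lemma integral_lpos_cauchy r : 0 < r ->
  (\int[mu]_t (lpos p m Q t * ((t ^+ 2 + r ^+ 2)^-1)%:E) = (ap - fine (ipos p m Q r))%:E)%E.
Proof.
move=> r0.
have mc : measurable_fun setT (fun t => (t ^+ 2 + r ^+ 2)^-1) by exact: measurable_cauchy.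
have c0 t : 0 <= (t ^+ 2 + r ^+ 2)^-1 by rewrite ltW// cauchy_gt0.
have : (ipos p m Q r + \int[mu]_t (lpos p m Q t * ((t ^+ 2 + r ^+ 2)^-1)%:E) = ap%:E)%E.
  rewrite /ipos -ge0_integralD//; last 4 first.
  - by move=> t _; rewrite mule_ge0 ?lpos_ge0// lee_fin ker_ge0.
  - apply: emeasurable_funM; first exact: measurable_lpos.
    by apply/measurable_EFinP; exact: measurable_ker.
  - by move=> t _; rewrite mule_ge0 ?lpos_ge0// lee_fin.
  - by apply: emeasurable_funM; [exact: measurable_lpos|exact/measurable_EFinP].
  rewrite -hap; apply: eq_integral => t _.
  have [->|t0] := eqVneq t 0; first by rewrite lpos0 !mul0e adde0.
  rewrite -ge0_muleDr ?lee_fin ?ker_ge0//; congr (_ * _)%E.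
  by rewrite kerE// -EFinD subrK.
have := ipos_fin hQ r0.
case: (ipos p m Q r) => [i| |]//= _.
case: (\int[mu]_t _)%E => [j| |]//=.
by rewrite -EFinD => -[] <-; congr EFin; ring.
Qed.

Lemma integral_lpos_cauchy_small e : 0 < e -> exists2 r0, 1 <= r0 & forall r, r0 <= r ->
  (\int[mu]_t (lpos p m Q t * ((t ^+ 2 + r ^+ 2)^-1)%:E) <= e%:E)%E.
Proof.
move=> e0; have := @cvg_ipos _ p m Q; rewrite hap => /fine_cvgP[_].
move/cvgr_dist_le => /(_ e e0)[n _ hn].
exists n.+1%:R; first by rewrite ler1n.
move=> r hr; have r0 : 0 < r by apply: lt_le_trans hr; rewrite ltr0n.
rewrite integral_lpos_cauchy// lee_fin.
have := hn n (leqnn n); rewrite ler_norml => /andP[_ h].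
have n0 : 0 < n.+1%:R :> R by rewrite ltr0n.
have := ipos_homo p m Q n0 hr.
have := ipos_fin hQ r0; have := ipos_fin hQ n0; move: h => /=.
case: (ipos p m Q n.+1%:R) (ipos p m Q r) => [i| |] [j| |]//= h _ _; rewrite lee_fin; lra.
Qed.

Lemma lpot_upper_half e : 0 < e -> exists2 r0, 1 <= r0 & forall x y, 0 <= y ->
  r0 ^+ 2 <= x ^+ 2 + y ^+ 2 ->
  (lpot p m Q x y <= ((kst + 2 * Num.max gn gp + e) * Num.sqrt (x ^+ 2 + y ^+ 2))%:E)%E.
Proof.
move=> e0.
have gn0 : 0 <= gn by rewrite -lee_fin -hgn; apply: nneseries_ge0 => k _ _; rewrite lee_fin le_max lexx orbT.
have gp0 : 0 <= gp by rewrite -lee_fin -hgp; apply: nneseries_ge0 => k _ _; rewrite lee_fin le_max lexx orbT.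
have k0 := kst_ge.
(* [z] is the relative lift in [y' = y + z r]; it is small enough that all the terms it creates sum
   to at most [e r]. *)
pose z := e / (2 + `|kst| + gn + gp + e).
have W0 : 0 < 2 + `|kst| + gn + gp + e by have := normr_ge0 kst; lra.
have z0 : 0 < z by rewrite divr_gt0.
have z1 : z <= 1 by rewrite ler_pdivrMr// mul1r; have := normr_ge0 kst; lra.
have zW : z * (2 + `|kst| + gn + gp + e) = e by rewrite /z divfK ?gt_eqF.
clearbody z; have ph := @pi_gt0 R.
(* The kernel centred at [x] with height [y'] is at most [3 / z^2] times the kernel centred at 0
   with height [r], whatever the direction of [x + i y]; the factor [z^2 / 3] compensates for
   this. *)
have eta0 : 0 < pi * z * (z ^+ 2 / 3) by apply: mulr_gt0; [exact: mulr_gt0|apply: divr_gt0 => //; exact: exprn_gt0].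
have [r0 r01 hr] := integral_lpos_cauchy_small eta0.
exists r0 => // x y y0.
pose r := Num.sqrt (x ^+ 2 + y ^+ 2); rewrite -/r.
have rE : r ^+ 2 = x ^+ 2 + y ^+ 2 by rewrite sqr_sqrtr// addr_ge0 ?sqr_ge0.
have rr0 : 0 <= r by exact: sqrtr_ge0.
rewrite -rE ler_pXn2r ?nnegrE//; last lra.
move=> r0r; have rp : 0 < r by lra.
have yr : y <= r by rewrite -(@ler_pXn2r _ 2)// ?nnegrE// rE lerDr sqr_ge0.
pose y' := y + z * r.
have zr : 0 < z * r by rewrite mulr_gt0.
have yy' : y <= y' by rewrite /y'; lra.
have y'0 : 0 < y' by rewrite /y'; lra.
have hB : (\int[mu]_t (lpos p m Q (x + t)%R * ((t ^+ 2 + y' ^+ 2)^-1)%:E) <= (pi * z)%:E)%E.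
  pose f t := (lpos p m Q t * (((t - x) ^+ 2 + y' ^+ 2)^-1)%:E)%E.
  have f0 t : (0 <= f t)%E by rewrite mule_ge0 ?lpos_ge0// lee_fin ltW// cauchy_gt0.
  have mf : measurable_fun setT f.
    apply: emeasurable_funM; first exact: measurable_lpos.
    apply/measurable_EFinP; apply: (measurableT_comp (measurable_cauchy y')).
    exact: measurable_funB.
  rewrite (_ : (\int[mu]_t _)%E = (\int[mu]_t f (x + t)%R)%E); last first.
    by apply: eq_integral => t _; rewrite /f addrAC subrr add0r.
  rewrite ge0_integral_shift//.
  pose g t := ((3 / z ^+ 2)%:E * (lpos p m Q t * ((t ^+ 2 + r ^+ 2)^-1)%:E))%E.
  have mg : measurable_fun setT (fun t => lpos p m Q t * ((t ^+ 2 + r ^+ 2)^-1)%:E)%E.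
    by apply: emeasurable_funM; [exact: measurable_lpos|apply/measurable_EFinP; exact: measurable_cauchy].
  have g0 t : (0 <= lpos p m Q t * ((t ^+ 2 + r ^+ 2)^-1)%:E)%E.
    by rewrite mule_ge0 ?lpos_ge0// lee_fin ltW// cauchy_gt0.
  have q0 : 0 <= 3 / z ^+ 2 by rewrite divr_ge0// sqr_ge0.
  apply: (@le_trans _ _ (\int[mu]_t g t)%E).
    apply: ge0_le_integral => //.
    - by apply: emeasurable_funM.
    - move=> t _; rewrite /f /g muleCA; apply: lee_wpmul2l; first exact: lpos_ge0.
      rewrite -EFinM lee_fin -[leLHS]mul1r -ler_pdivlMr ?cauchy_gt0// invrK.
      have h1 : 0 < t ^+ 2 + r ^+ 2 by rewrite ltr_wpDl ?sqr_ge0 ?exprn_gt0.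
      rewrite mulrAC ler_pdivlMr// mul1r mulrAC ler_pdivlMr ?exprn_gt0//.
      have h2 : (z * r) ^+ 2 <= y' ^+ 2 by rewrite ler_pXn2r// ?nnegrE ?(ltW zr) ?(ltW y'0)// /y'; lra.
      have h3 : (z * x) ^+ 2 <= (z * r) ^+ 2 by rewrite !exprMn rE; apply: ler_wpM2l; rewrite ?sqr_ge0// lerDl sqr_ge0.
      have h4 : (z * (t - x)) ^+ 2 <= (t - x) ^+ 2.
        rewrite exprMn ler_piMl ?sqr_ge0//; rewrite expr_le1// ltW//.
      have h5 : (z * t) ^+ 2 <= 2 * (z * (t - x)) ^+ 2 + 2 * (z * x) ^+ 2.
        rewrite -subr_ge0 (_ : _ - _ = (z * (t - x) - z * x) ^+ 2) ?sqr_ge0//; ring.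
      have -> : (t ^+ 2 + r ^+ 2) * z ^+ 2 = (z * t) ^+ 2 + (z * r) ^+ 2 by ring.
      have := sqr_ge0 (t - x); lra.
  rewrite ge0_integralZl_EFin//.
  apply: (@le_trans _ _ ((3 / z ^+ 2)%:E * (pi * z * (z ^+ 2 / 3))%:E)%E).
    by apply: lee_wpmul2l; [rewrite lee_fin|exact: hr].
  rewrite -EFinM lee_fin le_eqVlt; apply/orP; left; apply/eqP.
  move: (pi : R) => P; field; exact: lt0r_neq0.
apply: le_trans (lpot_le y0 yy' y'0 hB) _; rewrite lee_fin.
(* Replacing [y] by [r] requires a nonnegative slope, which [kst_ge] provides because [gn + gp] is
   at most twice the maximum. *)
have hM : y * (kst + 2 * gn) <= r * (kst + 2 * Num.max gn gp).
  apply: (@le_trans _ _ (y * (kst + 2 * Num.max gn gp))).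
    by rewrite ler_wpM2l// lerD2l ler_pM2l// le_max lexx.
  rewrite ler_wpM2r//; have : gn + gp <= 2 * Num.max gn gp.
    have : gn <= Num.max gn gp by rewrite le_max lexx.
    have : gp <= Num.max gn gp by rewrite le_max lexx orbT.
    lra.
  lra.
have hz : z * (1 + kst + z + gn + gp) <= e.
  rewrite -[leRHS]zW ler_wpM2l ?(ltW z0)//; have := ler_norm kst; lra.
have hzr := ler_wpM2l rr0 hz.
have hzy := ler_wpM2r (ltW z0) yr.
rewrite /y'; lra.
Qed.

End Upper.
End UpperBound.

Section Conjugate.
Context {R : realType}.
Implicit Types (p m : nat -> R) (x y : R).

(** Conjugating the zeros reduces each statement on the lower half plane to one on the upper, with
    [gn] and [gp] exchanged. *)
Lemma lpot_conj p m Q x y : lpot p (fun k => - m k) Q x (- y) = lpot p m Q x y.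
Proof.
rewrite /lpot sqrrN; congr (_ - _)%E; apply: eq_eseriesr => k _.
by rewrite !dist2E !sqrrN; congr theta; ring.
Qed.

Lemma lpot_conj0 p m Q x : lpot p (fun k => - m k) Q x 0 = lpot p m Q x 0.
Proof. by rewrite -[in LHS]oppr0 lpot_conj. Qed.

Lemma apos_conj p m Q : apos p (fun k => - m k) Q = apos p m Q.
Proof. by apply: eq_integral => t _; rewrite /lpos lpot_conj0. Qed.

Lemma aneg_conj p m Q : aneg p (fun k => - m k) Q = aneg p m Q.
Proof. by apply: eq_integral => t _; rewrite /lneg lpot_conj0. Qed.

End Conjugate.

(** * Lower bound for the growth *)

Section LowerBound.
Context {R : realType}.
Implicit Types r s t x y : R.

(** For the circle of radius [r] about [iY], the gain [2 Y max(- m', 0)] over the reflected factor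
    is attained up to a defect. The two squared moduli at [iY] differ by [4 Y max(- m', 0)], and
    [ln v <= v - 1] turns this into the last term. *)
Lemma jens_reflect_le (p' m' Y r : R) : 0 < Y ->
  0 < Num.max (dist2 p' m' 0 Y) (r ^+ 2 * (p' ^+ 2 + m' ^+ 2)) ->
  jens (dist2 p' m' 0 Y) (r ^+ 2 * (p' ^+ 2 + m' ^+ 2)) + 2 * Y * Num.max (- m') 0 <=
  rtheta (dist2 p' `|m'| 0 Y) + r ^+ 2 / 2 * (p' ^+ 2 + m' ^+ 2)
  + Y * (2 * Num.max (- m') 0 / Num.max (dist2 p' m' 0 Y) (r ^+ 2 * (p' ^+ 2 + m' ^+ 2))).
Proof.
move=> Y0 X0; set X := Num.max (dist2 _ _ _ _) _ in X0 *.
have D0 : 0 < dist2 p' `|m'| 0 Y by rewrite dist2_gt0.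
have hl : ln (dist2 p' `|m'| 0 Y) - ln X <= dist2 p' `|m'| 0 Y / X - 1.
  by rewrite -ln_div ?posrE// ln_leB1// divr_gt0.
have dX : dist2 p' m' 0 Y <= X by rewrite le_max lexx.
have Dd : dist2 p' `|m'| 0 Y = dist2 p' m' 0 Y + 4 * Y * Num.max (- m') 0.
  rewrite !dist2E real_normK ?num_real//; have [m0|m0] := leP 0 m'.
    by rewrite max_r ?oppr_le0// ger0_norm//; ring.
  by rewrite max_l ?oppr_ge0 ?(ltW m0)// ltr0_norm//; ring.
have h2 : dist2 p' `|m'| 0 Y / X - 1 <= 4 * Y * Num.max (- m') 0 / X.
  by rewrite lerBlDr ler_pdivrMr// mulrDl mul1r divfK ?gt_eqF// Dd; lra.
rewrite /jens /rtheta -/X.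
have -> : Y * (2 * Num.max (- m') 0 / X) = 4 * Y * Num.max (- m') 0 / X / 2 by field; exact: lt0r_neq0.
move: hl h2; set q := _ / X - 1; set q' := _ / X => hl h2.
lra.
Qed.

Section Lower.
Variables (p m : nat -> R) (Q : R).
Hypothesis hQ : (\sum_(k <oo) (p k ^+ 2 + m k ^+ 2)%:E = Q%:E)%E.
Let A k := p k ^+ 2 + m k ^+ 2.
Let A0 k : 0 <= A k.
Proof. by rewrite addr_ge0 ?sqr_ge0. Qed.
Let am k := `|m k|.
Variables (ap an gn : R).
Hypothesis hap : apos p m Q = ap%:E.
Hypothesis han : aneg p m Q = an%:E.
Hypothesis hgn : (\sum_(k <oo) (Num.max (- m k) 0)%:E = gn%:E)%E.
Let kst := (an - ap) / pi.
Let mn k := Num.max (- m k) 0.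
Let mn0 k : 0 <= mn k. Proof. by rewrite le_max lexx orbT. Qed.

(** For fixed [k] the denominator grows like [s^2]. Uniformly it is at least [e^2 / 4]: either
    [s^2 A k >= 1/4], or the zero is so far away that [dist2] itself is at least 1/4. The radius
    [e s] of the circle is what protects against zeros close to [i s]. *)
Lemma defect_le e eta : 0 < e -> e <= 1 -> 0 < eta -> exists2 s0, 1 <= s0 & forall s, s0 <= s ->
  (\sum_(k <oo) (2 * mn k / Num.max (dist2 (p k) (m k) 0 s) ((e * s) ^+ 2 * A k))%:E <= eta%:E)%E.
Proof.
move=> e0 e1 eta0.
have X0 s k : 1 <= s -> 0 < Num.max (dist2 (p k) (m k) 0 s) ((e * s) ^+ 2 * A k).
  by move=> s1; apply: dist2_max_gt0; rewrite mulr_gt0//; lra.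
have e20 : 0 < e ^+ 2 by rewrite exprn_gt0.
apply: (@tannery R _ (fun k => 8 / e ^+ 2 * mn k) (fun k => 2 * mn k / (e ^+ 2 * A k))) => //.
- by move=> s k s1; rewrite divr_ge0 ?(ltW (X0 s k s1))// mulr_ge0.
- by move=> k; rewrite mulr_ge0// divr_ge0// ltW.
- under eq_eseriesr do rewrite EFinM.
  rewrite nneseriesZl; last by move=> k _; rewrite lee_fin.
  by rewrite hgn ltry.
- move=> s k s1; rewrite (mulrC 2) (mulrC _ (mn k)) -mulrA ler_wpM2l//.
  rewrite ler_pdivrMr ?X0// mulrAC ler_pdivlMr//.
  suff : e ^+ 2 / 4 <= Num.max (dist2 (p k) (m k) 0 s) ((e * s) ^+ 2 * A k) by lra.
  rewrite le_max; have [h|h] := leP (1 / 4) (s ^+ 2 * A k).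
    by apply/orP; right; have := ler_wpM2l (ltW e20) h; rewrite exprMn; lra.
  apply/orP; left; apply: (@le_trans _ _ (1 / 4)).
    by rewrite ler_pM2r//; rewrite expr_le1// ltW.
  have h1 : (m k * s) ^+ 2 <= 1 / 4.
    apply: (le_trans _ (ltW h)); rewrite exprMn mulrC ler_wpM2l ?sqr_ge0//.
    by rewrite /A lerDr sqr_ge0.
  have h2 : `|m k * s| <= 1 / 2.
    rewrite -(@ler_pXn2r _ 2)// ?nnegrE; [|lra].
    rewrite real_normK ?num_real//; lra.
  move: h2; rewrite ler_norml => /andP[h2 _].
  have h3 : (1 / 2) ^+ 2 <= (1 + m k * s) ^+ 2 by rewrite ler_pXn2r// ?nnegrE; lra.
  rewrite (_ : dist2 _ _ _ _ = (1 + m k * s) ^+ 2 + (p k * s) ^+ 2); last by rewrite dist2E; ring.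
  have := sqr_ge0 (p k * s); lra.
- move=> s k s1; have s0 : 0 < s by lra.
  have [Ak|Ak] := eqVneq (A k) 0.
    have -> : mn k = 0.
      move/eqP: Ak; rewrite /A paddr_eq0 ?sqr_ge0// !sqrf_eq0 => /andP[_ /eqP h].
      by rewrite /mn h oppr0 maxxx.
    by rewrite mulr0 !mul0r.
  have Ap : 0 < A k by rewrite lt0r Ak A0.
  rewrite -!(mulrA (2 * mn k)) ler_wpM2l ?mulr_ge0// -invfM lef_pV2 ?posrE ?X0// ?mulr_gt0//.
  rewrite le_max; apply/orP; right; rewrite exprMn mulrAC.
  rewrite ler_wpM2r// ler_wpM2l ?(ltW e20)// expr2 ler_peMr// ltW//.
Qed.

Lemma lpot_lower_imag e eta : 0 < e -> e <= 1 / 4 -> 0 < eta ->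
  exists2 s0, 1 <= s0 & forall Y, s0 <= Y -> exists x y,
    [/\ (Y / 2) ^+ 2 <= x ^+ 2 + y ^+ 2, x ^+ 2 + y ^+ 2 <= ((1 + 2 * e) * Y) ^+ 2 &
    ((Y * (kst + 2 * gn - eta))%:E <= lpot p m Q x y)%E].
Proof.
(* The three thirds pay for [hgt], for the defect and for the error in Jensen's inequality. *)
move=> e0 e4 eta0; have eta3 : 0 < eta / 3 by rewrite divr_gt0.
have [s1 s11 h1] := hgt_cvg hQ hap han eta3.
have e1 : e <= 1 by lra.
have [s2 s21 h2] := defect_le e0 e1 eta3.
exists (s1 + s2); first lra.
move=> Y hY; have Y1 : 1 <= Y by lra.
have Y0 : 0 < Y by lra.
have r0 : 0 < e * Y by rewrite mulr_gt0.
(* Since [e <= 1/4], the outer radius is at most [Y / 2], so the point found has modulus at least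
   [Y / 2]. *)
have r12 : e * Y < 2 * e * Y by lra.
have {}h1 : `|hgt p m Q 0 Y - kst| <= eta / 3 by apply: h1; lra.
have {}h2 := h2 Y (ltac:(lra)).
have X0 k := dist2_max_gt0 p m 0 Y k r0.
have J0 k : 0 <= jens (dist2 (p k) (m k) 0 Y) ((e * Y) ^+ 2 * A k).
  by apply: jens_ge0; rewrite ?dist2_ge0 ?X0// mulr_ge0 ?sqr_ge0.
have d0 k : 0 <= 2 * mn k / Num.max (dist2 (p k) (m k) 0 Y) ((e * Y) ^+ 2 * A k).
  by rewrite divr_ge0 ?(ltW (X0 k))// mulr_ge0.
have t0 k : 0 <= rtheta (dist2 (p k) (am k) 0 Y) by rewrite rtheta_ge0// dist2_gt0 ?normr_ge0.
have rr0 : 0 <= (e * Y) ^+ 2 / 2 by rewrite divr_ge0 ?sqr_ge0.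
have Y20 : 0 <= 2 * Y by lra.
have main : (\sum_(k <oo) (jens (dist2 (p k) (m k) 0 Y) ((e * Y) ^+ 2 * A k))%:E
    + (2 * Y * gn)%:E <= gsum p am 0 Y + ((e * Y) ^+ 2 / 2 * Q)%:E + (Y * (eta / 3))%:E)%E.
  apply: (@le_trans _ _ (gsum p am 0 Y + ((e * Y) ^+ 2 / 2 * Q)%:E + Y%:E *
     \sum_(k <oo) (2 * mn k / Num.max (dist2 (p k) (m k) 0 Y) ((e * Y) ^+ 2 * A k))%:E)%E); last first.
    by apply: leeD => //; rewrite EFinM; apply: lee_wpmul2l; rewrite ?lee_fin ?(ltW Y0).
  rewrite !EFinM -hQ -hgn -!EFinM.
  rewrite -!nneseriesZl; last 3 first.
  - by move=> k _; rewrite lee_fin.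
  - by move=> k _; exact: A0.
  - by move=> k _; exact: mn0.
  have u0 k : (0 <= ((e * Y) ^+ 2 / 2)%:E * (A k)%:E)%E by rewrite mule_ge0 ?lee_fin.
  have u1 k : (0 <= (2 * Y)%:E * (mn k)%:E)%E by rewrite mule_ge0 ?lee_fin.
  have u2 k : (0 <= Y%:E * (2 * mn k / Num.max (dist2 (p k) (m k) 0 Y) ((e * Y) ^+ 2 * A k))%:E)%E.
    by rewrite mule_ge0 ?lee_fin ?(ltW Y0).
  rewrite gsum_rtheta//.
  rewrite -!nneseriesD; do ?by move=> k _ _; rewrite ?adde_ge0 ?u0 ?u1 ?u2 ?lee_fin ?J0 ?t0.
  apply: lee_nneseries => [k _ _|k _]; first by rewrite adde_ge0 ?u1 ?lee_fin ?J0.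
  by rewrite -!EFinM -!EFinD lee_fin; exact: jens_reflect_le.
have G0 := gsum0_fin hQ Y0; rewrite -/am in G0.
have sJ0 : (0 <= \sum_(k <oo) (jens (dist2 (p k) (m k) 0 Y) ((e * Y) ^+ 2 * A k))%:E)%E.
  by apply: nneseries_ge0 => k _ _; rewrite lee_fin.
move: h1; rewrite /hgt -/am ler_norml => /andP[h1 _].
move: main sJ0.
case JE : (\sum_(k <oo) (jens (dist2 (p k) (m k) 0 Y) ((e * Y) ^+ 2 * A k))%:E)%E => [J| |].
- have eY0 : 0 < eta / 3 * Y by rewrite mulr_gt0.
  have [x [y [/andP[hl hr] hxy]]] := jensen hQ r0 r12 eY0 JE.
  move: G0 h1; case: (gsum p am 0 Y) => [g| |]//= _ h1.
  rewrite -!EFinD lee_fin => main _.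
  have hy : `|y - Y| <= 2 * e * Y.
    rewrite -(@ler_pXn2r _ 2)// ?nnegrE ?mulr_ge0 ?(ltW e0) ?(ltW Y0)//.
    rewrite real_normK ?num_real//; have := sqr_ge0 (x - 0); lra.
  have eY : e * Y <= Y / 4 by rewrite (mulrC _ 4^-1) -div1r ler_wpM2r// ltW.
  move: hy; rewrite ler_norml => /andP[hy1 hy2].
  exists x, y; split.
  + have : (Y / 2) ^+ 2 <= y ^+ 2 by rewrite ler_pXn2r// ?nnegrE; lra.
    have := sqr_ge0 x; lra.
  + have h3 : Y * (y - Y) <= Y * (2 * e * Y) by rewrite ler_wpM2l// ltW.
    rewrite subr0 in hr; lra.
  + apply: le_trans hxy; rewrite lee_fin.
    move: h1; rewrite lerBrDl ler_pdivlMr// => h1; lra.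
- move: G0; case: (gsum p am 0 Y) => [g| |]//=.
- by [].
Qed.

End Lower.

Variables (p m : nat -> R) (Q : R).
Hypothesis hQ : (\sum_(k <oo) (p k ^+ 2 + m k ^+ 2)%:E = Q%:E)%E.
Variables (ap an gn gp : R).
Hypothesis hap : apos p m Q = ap%:E.
Hypothesis han : aneg p m Q = an%:E.
Hypothesis hgn : (\sum_(k <oo) (Num.max (- m k) 0)%:E = gn%:E)%E.
Hypothesis hgp : (\sum_(k <oo) (Num.max (m k) 0)%:E = gp%:E)%E.

Let hQ' : (\sum_(k <oo) (p k ^+ 2 + (- m k) ^+ 2)%:E = Q%:E)%E.
Proof. by under eq_eseriesr do rewrite sqrrN. Qed.
Let hgp' : (\sum_(k <oo) (Num.max (- - m k) 0)%:E = gp%:E)%E.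
Proof. by under eq_eseriesr do rewrite opprK. Qed.
Let hap' : apos p (fun k => - m k) Q = ap%:E. Proof. by rewrite apos_conj. Qed.
Let han' : aneg p (fun k => - m k) Q = an%:E. Proof. by rewrite aneg_conj. Qed.

Lemma lpot_upper e : 0 < e -> exists2 r0, 1 <= r0 & forall x y,
  r0 ^+ 2 <= x ^+ 2 + y ^+ 2 ->
  (lpot p m Q x y <=
    (((an - ap) / pi + 2 * Num.max gn gp + e) * Num.sqrt (x ^+ 2 + y ^+ 2))%:E)%E.
Proof.
move=> e0.
have [r1 r11 h1] := lpot_upper_half hQ hap han hgn hgp e0.
have [r2 r21 h2] := lpot_upper_half hQ' hap' han' hgp' hgn e0.
exists (Num.max r1 r2); first by rewrite le_max r11.
have m1 : r1 <= Num.max r1 r2 by rewrite le_max lexx.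
have m2 : r2 <= Num.max r1 r2 by rewrite le_max lexx orbT.
have sq s : 1 <= s -> s <= Num.max r1 r2 -> s ^+ 2 <= Num.max r1 r2 ^+ 2.
  by move=> s1 sm; rewrite ler_pXn2r// nnegrE; lra.
move=> x y hxy; have [y0|/ltW y0] := leP 0 y.
  by apply: h1 => //; apply: le_trans hxy; exact: sq.
rewrite -lpot_conj maxC -[y ^+ 2]sqrrN; apply: h2; rewrite ?oppr_ge0 ?sqrrN//.
by apply: le_trans hxy; exact: sq.
Qed.

Lemma lpot_lower e eta : 0 < e -> e <= 1 / 4 -> 0 < eta ->
  exists2 s0, 1 <= s0 & forall Y, s0 <= Y -> exists x y,
    [/\ (Y / 2) ^+ 2 <= x ^+ 2 + y ^+ 2, x ^+ 2 + y ^+ 2 <= ((1 + 2 * e) * Y) ^+ 2 &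
    ((Y * ((an - ap) / pi + 2 * Num.max gn gp - eta))%:E <= lpot p m Q x y)%E].
Proof.
move=> e0 e4 eta0; have [gg|gg] := leP gp gn.
  by have [s0 s01 h] := lpot_lower_imag hQ hap han hgn e0 e4 eta0; exists s0.
have [s0 s01 h] := lpot_lower_imag hQ' hap' han' hgp' e0 e4 eta0; exists s0 => // Y hY.
have [x [y [h1 h2 h3]]] := h Y hY; exists x, (- y); rewrite sqrrN; split => //.
by rewrite -lpot_conj opprK.
Qed.

End LowerBound.

(** * Convergence of the product *)

Section PrimaryFactor.
Context {R : realType}.
Implicit Types (w : R[i]) (a b t x : R).

Lemma mean_value_bound (u u' : R -> R) M : (forall t, is_derive t 1 u (u' t)) ->
  (forall t, 0 <= t <= 1 -> `|u' t| <= M) -> `|u 1 - u 0| <= M.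
Proof.
move=> du hM.
have [|c c01] := @MVT_segment R u u' 0 1 ler01.
- apply: continuous_subspaceT => t; apply/differentiable_continuous/derivable1_diffP.
  exact: (@ex_derive _ _ _ _ _ _ _ (du t)).
- by rewrite subr0 mulr1 => ->; apply: hM; move: c01; rewrite in_itv.
Qed.

Let is_derive_expR_lin a t : is_derive t 1 (fun s => expR (s * a)) (expR (t * a) * a).
Proof.
have d : is_derive t 1 (fun s => s * a) a by apply: is_derive_eq; rewrite /GRing.scale /=; ring.
by apply: is_derive_eq; rewrite /GRing.scale /=; ring.
Qed.

Let is_derive_cos_lin a t : is_derive t 1 (fun s => cos (s * a)) (- sin (t * a) * a).
Proof.
have d : is_derive t 1 (fun s => s * a) a by apply: is_derive_eq; rewrite /GRing.scale /=; ring.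
by apply: is_derive_eq; rewrite /GRing.scale /=; ring.
Qed.

Let is_derive_sin_lin a t : is_derive t 1 (fun s => sin (s * a)) (cos (t * a) * a).
Proof.
have d : is_derive t 1 (fun s => s * a) a by apply: is_derive_eq; rewrite /GRing.scale /=; ring.
by apply: is_derive_eq; rewrite /GRing.scale /=; ring.
Qed.

(** Along the segment from 0 to [w], [E (t w)] has derivative [- t w^2 exp (t w)]. The mean value
    theorem is applied to the real part [u] and the imaginary part [v] separately. *)
Lemma primary_factor_bound w :
  `|complex.Re (primary_factor w) - 1| <= 2 * expR (1 + sqn w) * sqn w /\
  `|complex.Im (primary_factor w)| <= 2 * expR (1 + sqn w) * sqn w.
Proof.
case: w => a b; rewrite /sqn /=.
pose u t := expR (t * a) * ((1 - t * a) * cos (t * b) + t * b * sin (t * b)).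
pose v t := expR (t * a) * ((1 - t * a) * sin (t * b) - t * b * cos (t * b)).
have du t : is_derive t 1 u (- t * expR (t * a) * ((a ^+ 2 - b ^+ 2) * cos (t * b) - 2 * (a * b) * sin (t * b))).
  have d1 := is_derive_expR_lin a t; have d2 := is_derive_cos_lin b t.
  have d3 := is_derive_sin_lin b t.
  apply: is_derive_eq; rewrite /GRing.scale /=; ring.
have dv t : is_derive t 1 v (- t * expR (t * a) * ((a ^+ 2 - b ^+ 2) * sin (t * b) + 2 * (a * b) * cos (t * b))).
  have d1 := is_derive_expR_lin a t; have d2 := is_derive_cos_lin b t.
  have d3 := is_derive_sin_lin b t.
  apply: is_derive_eq; rewrite /GRing.scale /=; ring.
have bd t c1 c2 : 0 <= t <= 1 -> `|c1| <= 1 -> `|c2| <= 1 ->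
    `|- t * expR (t * a) * ((a ^+ 2 - b ^+ 2) * c1 + 2 * (a * b) * c2)| <=
    2 * expR (1 + (a ^+ 2 + b ^+ 2)) * (a ^+ 2 + b ^+ 2).
  move=> /andP[t0 t1] h1 h2; rewrite normrM normrM normrN.
  rewrite (ger0_norm t0) (ger0_norm (expR_ge0 _)).
  have -> : 2 * expR (1 + (a ^+ 2 + b ^+ 2)) * (a ^+ 2 + b ^+ 2) =
    expR (1 + (a ^+ 2 + b ^+ 2)) * (2 * (a ^+ 2 + b ^+ 2)) by ring.
  apply: (@le_trans _ _ (expR (1 + (a ^+ 2 + b ^+ 2)) *
    `|(a ^+ 2 - b ^+ 2) * c1 + 2 * (a * b) * c2|)).
    rewrite ler_wpM2r// -[leRHS]mul1r; apply: ler_pM; rewrite ?expR_ge0//.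
    rewrite ler_expR; apply: (@le_trans _ _ (t * `|a|)); first by rewrite ler_wpM2l// ler_norm.
    apply: (@le_trans _ _ `|a|); first by rewrite ler_piMl.
    have := sqr_ge0 (`|a| - 1); rewrite sqrrB real_normK ?num_real//.
    have := sqr_ge0 b; have := sqr_ge0 a; lra.
  apply: ler_wpM2l; first exact: expR_ge0.
  have h3 : `|(a ^+ 2 - b ^+ 2) * c1| <= a ^+ 2 + b ^+ 2.
    rewrite normrM -[leRHS]mulr1; apply: ler_pM => //.
    by rewrite ler_norml; apply/andP; have := sqr_ge0 a; have := sqr_ge0 b; split; lra.
  have h4 : `|2 * (a * b) * c2| <= a ^+ 2 + b ^+ 2.
    rewrite normrM -[leRHS]mulr1; apply: ler_pM => //.
    rewrite ler_norml; apply/andP; have := sqr_ge0 (a - b); have := sqr_ge0 (a + b).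
    split; lra.
  apply: (le_trans (ler_normD _ _)); lra.
have nc x : `|cos x| <= 1 by rewrite ler_norml cos_geN1 cos_le1.
have ns x : `|sin x| <= 1 by rewrite ler_norml sin_geN1 sin_le1.
split.
- have -> : (1 - a) * (expR a * cos b) - (0 - b) * (expR a * sin b) - 1 = u 1 - u 0.
    by rewrite /u !mul1r !mul0r expR0 ?cos0 ?sin0; ring.
  apply: (mean_value_bound du) => t ht; have := bd t (cos (t * b)) (- sin (t * b)) ht (nc _).
  by rewrite normrN mulrN; apply.
- have -> : (1 - a) * (expR a * sin b) + (0 - b) * (expR a * cos b) = v 1 - v 0.
    by rewrite /v !mul1r !mul0r expR0 ?cos0 ?sin0; ring.
  by apply: (mean_value_bound dv) => t ht; exact: bd.
Qed.

Lemma sqn_primary_factor w : sqn (primary_factor w) =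
  ((1 - complex.Re w) ^+ 2 + complex.Im w ^+ 2) * expR (2 * complex.Re w).
Proof.
rewrite /primary_factor sqnM; case: w => a b; rewrite /sqn /= sub0r sqrrN; congr (_ * _).
by rewrite !exprMn -mulrDr cos2Dsin2 mulr1 expRM_natl.
Qed.

End PrimaryFactor.

Section ProductConvergence.
Context {R : realType}.
Implicit Types (x y : R).

Lemma cvg_complex (f : nat -> R[i]) (a b : R) :
  complex.Re (f n) @[n --> \oo] --> a -> complex.Im (f n) @[n --> \oo] --> b ->
  (f n : R[i]^o) @[n --> \oo] --> (Complex a b : R[i]^o).
Proof.
move=> fa fb; apply/cvgrPdist_lt => -[e e'] /=; rewrite ltcE /= => /andP[/eqP -> e0].
have e20 : 0 < e / 2 by rewrite divr_gt0.
move/cvgrPdist_lt : fa => /(_ _ e20) fa; move/cvgrPdist_lt : fb => /(_ _ e20) fb.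
near=> n; rewrite normc_def ltcE /= eqxx /=.
have ha : `|a - complex.Re (f n)| < e / 2 by near: n.
have hb : `|b - complex.Im (f n)| < e / 2 by near: n.
case: (f n) ha hb => u v /=; set s := a - u; set t := b - v => ha hb.
have ns : 0 <= `|s| by []; have nt : 0 <= `|t| by [].
have hs : `|s| ^+ 2 < (e / 2) ^+ 2 by rewrite ltr_pXn2r// nnegrE ltW.
have ht : `|t| ^+ 2 < (e / 2) ^+ 2 by rewrite ltr_pXn2r// nnegrE ltW.
rewrite !real_normK ?num_real// in hs ht.
rewrite -(@ltr_pXn2r _ 2)// ?nnegrE ?sqrtr_ge0 ?(ltW e0)//.
rewrite sqr_sqrtr ?addr_ge0 ?sqr_ge0//; have := sqr_ge0 e; lra.
Unshelve. all: by end_near. Qed.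

Lemma cvg_of_increments (a A : nat -> R) (C Q : R) : 0 <= C -> (forall k, 0 <= A k) ->
  (\sum_(k <oo) (A k)%:E = Q%:E)%E -> (forall n, `|a n.+1 - a n| <= C * A n) -> cvgn a.
Proof.
move=> C0 A0 sA ha.
have cA : cvgn (series A) by apply: nnseries_is_cvg => //; rewrite sA ltry.
have cs : cvgn (series (telescope a)).
  apply: normed_cvg; apply: (@series_le_cvg _ _ (fun n => C * A n)).
  - by move=> n; exact: normr_ge0.
  - by move=> n; rewrite mulr_ge0.
  - exact: ha.
  - pose proof (is_cvg_seriesZ (k := C) cA) as h; exact: h.
rewrite (_ : a = cst (a 0%N) + series (telescope a)); last first.
  by apply/funext => n; rewrite [LHS]eq_sum_telescope.
by apply: is_cvgD => //; exact: is_cvg_cst.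
Qed.

Variables (q : nat -> R[i]) (Q : R).
Let p k := complex.Re (q k).
Let m k := complex.Im (q k).
Hypothesis hQ : (\sum_(k <oo) (p k ^+ 2 + m k ^+ 2)%:E = Q%:E)%E.
Let A k := p k ^+ 2 + m k ^+ 2.
Let A0 k : 0 <= A k. Proof. by rewrite addr_ge0 ?sqr_ge0. Qed.
Variable w : R[i].
Let x := complex.Re w.
Let y := complex.Im w.
Let P n := \prod_(0 <= k < n) primary_factor (w * q k).

Lemma sqn_factor k :
  sqn (primary_factor (w * q k)) = dist2 (p k) (m k) x y * expR (2 * (p k * x - m k * y)).
Proof.
rewrite sqn_primary_factor dist2E /p /m /x /y; case: w (q k) => [a b] [c d] /=.
by congr (_ * expR _); ring.
Qed.

(** This is [d <= exp (d - 1)], the nonnegativity of [rtheta] again; it bounds all partial products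
    by one constant. *)
Lemma sqn_factor_le k : sqn (primary_factor (w * q k)) <= expR (A k * sqn w).
Proof.
rewrite sqn_factor; set d := dist2 _ _ _ _.
have : d <= expR (d - 1) by have := expR_ge1Dx (d - 1); rewrite addrC subrK.
move=> /(ler_wpM2r (expR_ge0 (2 * (p k * x - m k * y)))); rewrite -expRD.
suff -> : d - 1 + 2 * (p k * x - m k * y) = A k * sqn w by [].
by rewrite /d dist2E /A /sqn -/x -/y; ring.
Qed.

Lemma sqn_factor_exp k : 0 < dist2 (p k) (m k) x y ->
  sqn (primary_factor (w * q k)) = expR (A k * sqn w - 2 * rtheta (dist2 (p k) (m k) x y)).
Proof.
rewrite sqn_factor; set d := dist2 _ _ _ _ => d0.
rewrite -[d in LHS]lnK ?posrE// -expRD; congr expR.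
rewrite /rtheta (_ : A k * sqn w = d - 1 + 2 * (p k * x - m k * y)); last first.
  by rewrite /d dist2E /A /sqn -/x -/y; ring.
by field.
Qed.

Let sA n := \sum_(0 <= k < n) A k.

Let sA_le n : sA n <= Q.
Proof.
rewrite -lee_fin -hQ /sA -sumEFin; apply: nneseries_lim_ge => k _ _.
by rewrite lee_fin.
Qed.

Let PS n : P n.+1 = P n * primary_factor (w * q n).
Proof. by rewrite /P big_nat_recr. Qed.

Let sqnP_le n : sqn (P n) <= expR (sA n * sqn w).
Proof.
rewrite /sA; elim: n => [|n IH]; first by rewrite /P !big_nil sqn1 mul0r expR0.
rewrite PS sqnM big_nat_recr//= (_ : _ * sqn w =
  (\sum_(0 <= k < n) A k) * sqn w + A n * sqn w); last by rewrite /A; ring.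
by rewrite expRD; apply: ler_pM; rewrite ?sqn_ge0// sqn_factor_le.
Qed.

Let M := 1 + expR (Q * sqn w).
Let compP_le n : `|complex.Re (P n)| <= M /\ `|complex.Im (P n)| <= M.
Proof.
have : sqn (P n) <= expR (Q * sqn w).
  by apply: (le_trans (sqnP_le n)); rewrite ler_expR ler_wpM2r ?sqn_ge0.
rewrite /M /sqn; move: (complex.Re _) (complex.Im _) => a b h.
have N (z : R) : `|z| <= 1 + z ^+ 2.
  have := sqr_ge0 (`|z| - 1); rewrite sqrrB real_normK ?num_real//; have := normr_ge0 z; lra.
by have := N a; have := N b; have := sqr_ge0 a; have := sqr_ge0 b; split; lra.
Qed.

Let K := 2 * expR (1 + sqn w * Q) * sqn w.
Let compE_le n : `|complex.Re (primary_factor (w * q n)) - 1| <= K * A n /\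
  `|complex.Im (primary_factor (w * q n))| <= K * A n.
Proof.
have AQ : A n <= Q.
  apply: le_trans (sA_le n.+1); rewrite /sA big_nat_recr//= lerDr.
  by rewrite sumr_ge0.
have hq : sqn (q n) = A n by [].
have : 2 * expR (1 + sqn (w * q n)) * sqn (w * q n) <= K * A n.
  rewrite sqnM hq /K mulrA ler_wpM2r// ler_wpM2r ?sqn_ge0// ler_wpM2l// ler_expR.
  by rewrite lerD2l ler_wpM2l ?sqn_ge0.
have [h1 h2] := primary_factor_bound (w * q n) => h.
by split; apply: le_trans h.
Qed.

Let cvgP : exists a b : R, complex.Re (P n) @[n --> \oo] --> a /\ complex.Im (P n) @[n --> \oo] --> b.
Proof.
have M0 : 0 <= M by rewrite addr_ge0 ?expR_ge0.
have K0 : 0 <= K by rewrite mulr_ge0 ?sqn_ge0 ?mulr_ge0 ?expR_ge0.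
have C0 : 0 <= 2 * M * K by rewrite mulr_ge0// mulr_ge0.
have B r i u v n : `|r| <= M -> `|i| <= M -> `|u| <= K * A n -> `|v| <= K * A n ->
    `|r * u + i * v| <= 2 * M * K * A n.
  move=> h1 h2 h3 h4; apply: (le_trans (ler_normD _ _)); rewrite !normrM.
  have := ler_pM (normr_ge0 _) (normr_ge0 _) h1 h3.
  have := ler_pM (normr_ge0 _) (normr_ge0 _) h2 h4; lra.
have c1 : cvgn (fun n => complex.Re (P n)).
  apply: (cvg_of_increments C0 A0 hQ) => n.
  have [h1 h2] := compP_le n; have [h3 h4] := compE_le n.
  rewrite PS; move: h1 h2 h3 h4; case: (P n) => r i; case: (primary_factor _) => u v /=.
  move=> h1 h2 h3 h4; rewrite (_ : _ - r = r * (u - 1) + - i * v); last by ring.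
  by apply: B; rewrite ?normrN.
have c2 : cvgn (fun n => complex.Im (P n)).
  apply: (cvg_of_increments C0 A0 hQ) => n.
  have [h1 h2] := compP_le n; have [h3 h4] := compE_le n.
  rewrite PS; move: h1 h2 h3 h4; case: (P n) => r i; case: (primary_factor _) => u v /=.
  move=> h1 h2 h3 h4; rewrite (_ : _ - i = r * v + i * (u - 1)); last by ring.
  by apply: B.
by move/cvg_ex : c1 => [a ha]; move/cvg_ex : c2 => [b hb]; exists a, b.
Qed.

(** Three cases. If a factor vanishes, both sides are -oo. If none does and [gsum] is finite, the
    limit passes through the exponential. If [gsum] is +oo, the partial products are forced to tend
    to 0. *)
Lemma lne_cmod_lim :
  (lne (cmod (lim ((fun n => P n : R[i]^o) @ \oo)))%:E = lpot p m Q x y)%E.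
Proof.
have [a [b [ha hb]]] := cvgP.
rewrite (cvg_lim (@norm_hausdorff _ _) (cvg_complex ha hb)).
have hs : sqn (P n) @[n --> \oo] --> a ^+ 2 + b ^+ 2.
  pose proof (cvgD (cvgM ha ha) (cvgM hb hb)) as h.
  rewrite !expr2; apply: cvg_trans h; apply: near_eq_cvg; near=> n.
  by rewrite /= /sqn !expr2.
set l := a ^+ 2 + b ^+ 2 in hs.
have l0 : 0 <= l by rewrite addr_ge0 ?sqr_ge0.
rewrite cmodE /lpot (_ : sqn _ = l)//.
have [[k dk]|] := pselect (exists k, dist2 (p k) (m k) x y <= 0).
  have -> : l = 0.
    apply/esym; apply: (cvg_unique (@norm_hausdorff _ _) _ hs).
    apply: cvg_near_cst; near=> n.
    have kn : (k < n)%N by near: n; exact: nbhs_infty_gt.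
    rewrite /P sqn_prod (bigD1_seq k) ?iota_uniq ?mem_index_iota//=.
    have -> : sqn (primary_factor (w * q k)) = 0.
      by rewrite sqn_factor; have /eqP -> : dist2 (p k) (m k) x y == 0; rewrite ?mul0r// eq_le dk dist2_ge0.
    by rewrite mul0r.
  rewrite sqrtr0 le0_lneNy//.
  rewrite /gsum (_ : (\sum_(_ <oo) _)%E = +oo%E) ?addeNy//.
  apply/eqP; rewrite eq_le leey /=.
  rewrite -(_ : theta (dist2 (p k) (m k) x y) = +oo%E); last by rewrite /theta dk.
  apply: le_trans (nneseries_lim_ge k.+1 _); last by move=> ? _ _; exact: theta_ge0.
  rewrite big_nat_recr//= leeDr// sume_ge0// => ? _; exact: theta_ge0.
move=> /forallNP d0'.
have d0 k : 0 < dist2 (p k) (m k) x y by rewrite ltNge; apply/negP; exact: d0'.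
pose T n := \sum_(0 <= k < n) rtheta (dist2 (p k) (m k) x y).
have PE n : sqn (P n) = expR (sA n * sqn w - 2 * T n).
  rewrite /P sqn_prod /sA /T mulr_suml mulr_sumr -sumrB expR_sum.
  by apply: eq_bigr => k _; rewrite sqn_factor_exp.
have hT : (T n)%:E @[n --> \oo] --> gsum p m x y.
  rewrite /gsum (_ : (fun n => _) = (fun n => \sum_(0 <= k < n) theta (dist2 (p k) (m k) x y))%E).
    by apply: is_cvg_nneseries => k _ _; exact: theta_ge0.
  by apply/funext => n; rewrite /T -sumEFin; apply: eq_bigr => k _; rewrite theta_pos.
have hA : sA n @[n --> \oo] --> Q.
  have : (fun n => (sA n)%:E) @ \oo --> (\sum_(k <oo) (A k)%:E)%E.
    rewrite (_ : (fun n => _) = (fun n => \sum_(0 <= k < n) (A k)%:E)%E).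
      by apply: is_cvg_nneseries => k _ _; rewrite lee_fin.
    by apply/funext => n; rewrite /sA -sumEFin.
  by rewrite hQ => /fine_cvgP[].
have := gsum_ge0 p m x y.
case gE : (gsum p m x y) hT => [g| |] hT g0 //.
  have {}hT : T n @[n --> \oo] --> g by move/fine_cvgP : hT => [].
  have lE : l = expR (Q * sqn w - 2 * g).
    apply: (cvg_unique (@norm_hausdorff _ _) hs).
    rewrite (_ : (fun n => _) = (fun n => expR (sA n * sqn w - 2 * T n))); last exact/funext.
    pose proof (cvgB (cvgM hA (cvg_cst (sqn w))) (cvgM (cvg_cst (2 : R)) hT)) as h.
    pose proof (continuous_cvg _ (@continuous_expR R _) h) as h'; exact: h'.
  have -> : Num.sqrt l = expR (Q * sqn w / 2 - g).
    rewrite lE (_ : Q * sqn w - 2 * g = 2 * (Q * sqn w / 2 - g)); last by field.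
    by rewrite expRM_natl sqrtr_sqr ger0_norm ?expR_ge0.
  by rewrite lne_EFin ?expR_gt0// expRK -EFinB.
suff -> : l = 0 by rewrite sqrtr0 le0_lneNy.
apply: contrapT => ln0; have lp : 0 < l by rewrite lt0r l0 andbT; apply/eqP.
(* With this threshold the squared moduli of the partial products are eventually at most
   [exp (ln l - 2)], which is less than their supposed limit [l]. *)
move/cvgeryP/cvgryPge : hT => /(_ ((Q * sqn w - ln l) / 2 + 1)) hT.
have : l <= expR (ln l - 2).
  apply: (cvgr_to_le hs).
  near=> n; rewrite PE ler_expR.
  have h1 : (Q * sqn w - ln l) / 2 + 1 <= T n by near: n.
  have := ler_wpM2r (sqn_ge0 w) (sA_le n); lra.
rewrite -{1}(lnK (x := l)) ?posrE// ler_expR; lra.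
Unshelve. all: by end_near. Qed.

End ProductConvergence.

(** * The balance formula *)

Section Sigma.
Context {R : realType}.
Implicit Types (r C x y : R) (f : R[i] -> R[i]).

Lemma max_modulus_ge f (w : R[i]) : ((cmod (f w))%:E <= max_modulus f (cmod w))%E.
Proof. by apply: ereal_sup_ubound; exists w. Qed.

Lemma cmod_real r : 0 <= r -> cmod r%:C%C = r.
Proof. by move=> r0; rewrite cmodE /sqn /= expr0n addr0 sqrtr_sqr ger0_norm. Qed.

Lemma max_modulus_ge0 f r : 0 <= r -> (0 <= max_modulus f r)%E.
Proof.
move=> r0; apply: le_trans (_ : (cmod (f r%:C%C))%:E <= _)%E.
  by rewrite lee_fin cmod_ge0.
by rewrite -[in leRHS](cmod_real r0); exact: max_modulus_ge.
Qed.

Lemma sigma_le f C r0 : 0 < r0 ->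
  (forall w, r0 <= cmod w -> (lne (cmod (f w))%:E <= (C * cmod w)%:E)%E) ->
  (sigma f <= C%:E)%E.
Proof.
move=> r00 h; apply: (@le_trans _ _ (ereal_sup ((fun r : R =>
    lne (max_modulus f r) / r%:E)%E @` [set r | r0 < r]))).
  by apply: ereal_inf_lbound; exists [set r | r0 < r] => //; exists r0; rewrite num_real.
apply: ge_ereal_sup => _ [r /= rr0 <-].
have r_gt0 := lt_trans r00 rr0.
rewrite inver gt_eqF// lee_pdivrMr// -EFinM.
have mm : (max_modulus f r <= (expR (C * r))%:E)%E.
  apply: ge_ereal_sup => _ [w /= wr <-].
  have := h w; rewrite wr => /(_ (ltW rr0)) hw.
  rewrite lee_fin; have [c0|c0] := leP (cmod (f w)) 0; first exact: le_trans c0 (expR_ge0 _).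
  by rewrite -[leLHS]lnK ?posrE// ler_expR -lee_fin -lne_EFin.
rewrite -[X in X%:E](expRK (C * r)) -lne_EFin ?expR_gt0// lee_lne//.
- by rewrite in_itv /= leey andbT max_modulus_ge0// ltW.
- by rewrite in_itv /= leey andbT lee_fin expR_ge0.
Qed.

Lemma growth_of_sigma_lt f C : (sigma f < C%:E)%E -> exists2 r0, 0 < r0 &
  forall w, r0 <= cmod w -> (lne (cmod (f w))%:E <= (C * cmod w)%:E)%E.
Proof.
move=> /ereal_inf_lt [_ [V [M [_ MV]] <-] hV].
exists (Num.max M 0 + 1); first by rewrite ltr_wpDl// le_max lexx orbT.
move=> w hw; set r := cmod w in hw *.
have [M1 M2] : M <= Num.max M 0 /\ 0 <= Num.max M 0 by rewrite !le_max !lexx orbT.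
have r0 : 0 < r by lra.
have : (lne (max_modulus f r) / r%:E <= C%:E)%E.
  apply/ltW; apply: le_lt_trans hV; apply: ereal_sup_ubound; exists r => //.
  by apply: MV; lra.
rewrite inver gt_eqF// lee_pdivrMr// -EFinM; apply: le_trans.
rewrite lee_lne ?max_modulus_ge//.
- by rewrite in_itv /= leey andbT lee_fin cmod_ge0.
- by rewrite in_itv /= leey andbT max_modulus_ge0// ltW.
Qed.

End Sigma.

Section Balance.
Context {R : realType}.
Implicit Types (r C x y : R).
Variables (p m : nat -> R) (Q : R) (f : R[i] -> R[i]).
Hypothesis hQ : (\sum_(k <oo) (p k ^+ 2 + m k ^+ 2)%:E = Q%:E)%E.
Hypothesis hf : forall w, lne (cmod (f w))%:E = lpot p m Q (complex.Re w) (complex.Im w).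

Lemma lpot_growth C : (sigma f < C%:E)%E -> exists2 r0, 0 < r0 &
  forall x y, r0 ^+ 2 <= x ^+ 2 + y ^+ 2 ->
    (lpot p m Q x y <= (C * Num.sqrt (x ^+ 2 + y ^+ 2))%:E)%E.
Proof.
move=> /growth_of_sigma_lt [r0 r00 h]; exists r0 => // x y hxy.
have := h (Complex x y); rewrite hf cmodE /sqn /=; apply.
by rewrite -(@ler_pXn2r _ 2)// ?nnegrE ?sqrtr_ge0 ?(ltW r00)// sqr_sqrtr// addr_ge0 ?sqr_ge0.
Qed.

(** The mean of log |Pi| over a circle about 0 is nonnegative because [Pi (0) = 1]. A negative type
    would make log |Pi| at most [C r0 < 0] outside a disc, contradicting [jensen] with error
    [- C r0 / 2]. *)
Lemma sigma_ge0 : (0 <= sigma f)%E.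
Proof.
rewrite leNgt; apply/negP => s0.
have [C C0 sC] : exists2 C : R, C < 0 & (sigma f < C%:E)%E.
  case: (sigma f) s0 => [s| |] //; last by exists (-1) => //; rewrite ltNyr.
  by rewrite lte_fin => s0; exists (s / 2); rewrite ?lte_fin; lra.
have [r0 r00 h] := lpot_growth sC.
have J0 k : 0 <= jens (dist2 (p k) (m k) 0 0) (r0 ^+ 2 * (p k ^+ 2 + m k ^+ 2)).
  apply: jens_ge0; rewrite ?dist2_ge0 ?dist2_max_gt0//.
  by rewrite mulr_ge0 ?addr_ge0 ?sqr_ge0.
have JQ : (\sum_(k <oo) (jens (dist2 (p k) (m k) 0 0) (r0 ^+ 2 * (p k ^+ 2 + m k ^+ 2)))%:E
    <= (r0 ^+ 2 / 2 * Q)%:E)%E.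
  rewrite EFinM -hQ -nneseriesZl; last by move=> k _; rewrite lee_fin addr_ge0 ?sqr_ge0.
  apply: lee_nneseries => [k _ _|k _]; first by rewrite lee_fin.
  rewrite -EFinM lee_fin (_ : dist2 _ _ _ _ = 1); last by rewrite dist2E; ring.
  by have := jens1 p m r0 k; have := lp_ge0 p m r0 k; lra.
have J0' : (0 <= \sum_(k <oo) (jens (dist2 (p k) (m k) 0 0) (r0 ^+ 2 * (p k ^+ 2 + m k ^+ 2)))%:E)%E.
  by apply: nneseries_ge0 => k _ _; rewrite lee_fin.
move: JQ J0'.
case JE : (\sum_(k <oo) (jens (dist2 (p k) (m k) 0 0) (r0 ^+ 2 * (p k ^+ 2 + m k ^+ 2)))%:E)%E
  => [J| |]//.
rewrite lee_fin => JQ _.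
have r02 : r0 < 2 * r0 by lra.
have e0 : 0 < - C * r0 / 2 by rewrite divr_gt0// mulr_gt0// oppr_gt0.
have [x [y [/andP[h1 h2] h3]]] := jensen hQ r00 r02 e0 JE.
rewrite !subr0 in h1.
have := le_trans h3 (h x y h1); rewrite lee_fin => h4.
have h5 : r0 <= Num.sqrt (x ^+ 2 + y ^+ 2).
  by rewrite -(@ler_pXn2r _ 2)// ?nnegrE ?sqrtr_ge0 ?(ltW r00)// sqr_sqrtr// addr_ge0 ?sqr_ge0.
have C0' : C <= 0 by exact: ltW.
have := ler_wnM2l C0' h5; have : 0 < - C * r0 by rewrite mulr_gt0// oppr_gt0.
rewrite expr0n /= in h4; lra.
Qed.

Section Finite.
Variables (ap an gn gp : R).
Hypothesis hap : apos p m Q = ap%:E.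
Hypothesis han : aneg p m Q = an%:E.
Hypothesis hgn : (\sum_(k <oo) (Num.max (- m k) 0)%:E = gn%:E)%E.
Hypothesis hgp : (\sum_(k <oo) (Num.max (m k) 0)%:E = gp%:E)%E.

Lemma sigmaE : sigma f = ((an - ap) / pi + 2 * Num.max gn gp)%:E.
Proof.
set Mx := _ / pi + _; apply/eqP; rewrite eq_le; apply/andP; split.
  apply/lee_addgt0Pr => e e0; rewrite -EFinD.
  have [r0 r01 h] := lpot_upper hQ hap han hgn hgp e0.
  have r00 : 0 < r0 by lra.
  apply: (sigma_le r00) => w hw; rewrite hf cmodE /sqn; apply: h.
  rewrite -/(sqn w) -sqr_cmod ler_pXn2r ?nnegrE ?cmod_ge0//; lra.
rewrite leNgt; apply/negP => sM; have := sigma_ge0.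
case sE : (sigma f) (sM) => [s| |] //; rewrite lte_fin lee_fin => sM' s0.
pose C := (s + Mx) / 2; have C0 : 0 <= C by rewrite /C; lra.
have CM : C < Mx by rewrite /C; lra.
have [r0 r00 h] : exists2 r0, 0 < r0 & forall x y, r0 ^+ 2 <= x ^+ 2 + y ^+ 2 ->
    (lpot p m Q x y <= (C * Num.sqrt (x ^+ 2 + y ^+ 2))%:E)%E.
  by apply: lpot_growth; rewrite sE lte_fin /C; lra.
clearbody C; pose d := Mx - C; have d0 : 0 < d by rewrite /d; lra.
(* The point given by [lpot_lower] may have modulus [(1 + 2 e) Y]. This choice keeps the excess
   [2 e C Y] below [d Y / 2], which together with the loss [d Y / 4] is less than [d Y]. *)
pose e := d / (4 * (C + d + 1)).
have W0 : 0 < 4 * (C + d + 1) by lra.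
have e0 : 0 < e by rewrite divr_gt0.
have e4 : e <= 1 / 4 by rewrite ler_pdivrMr//; lra.
have eC : 2 * (e * C) <= d / 2.
  have : e * (4 * (C + d + 1)) = d by rewrite /e divfK ?gt_eqF.
  have := mulr_gt0 e0 d0; lra.
have eta0 : 0 < d / 4 by lra.
have [s1 s11 hl] := lpot_lower hQ hap han hgn hgp e0 e4 eta0.
have [x [y [h1 h2 h3]]] := hl (s1 + 2 * r0) (ltac:(lra)).
set Y := s1 + 2 * r0 in h1 h2 h3; have Y0 : 0 < Y by rewrite /Y; lra.
have Yr : r0 <= Y / 2 by rewrite /Y; lra.
have := h x y; move=> /(_ _)/(le_trans h3).
have -> : r0 ^+ 2 <= x ^+ 2 + y ^+ 2.
  by apply: le_trans h1; rewrite ler_pXn2r// nnegrE; lra.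
move=> /(_ isT); rewrite lee_fin -/Mx.
have h4 : Num.sqrt (x ^+ 2 + y ^+ 2) <= (1 + 2 * e) * Y.
  have Z : 0 <= (1 + 2 * e) * Y by rewrite mulr_ge0//; lra.
  by rewrite -(@ler_pXn2r _ 2)// ?nnegrE ?sqrtr_ge0// sqr_sqrtr// addr_ge0 ?sqr_ge0.
have h5 := ler_wpM2l C0 h4.
have h6 := ler_wpM2l (ltW Y0) eC.
have : 0 < Y * d by rewrite mulr_gt0.
have Md : Y * Mx = Y * C + Y * d by rewrite /d; ring.
lra.
Qed.

End Finite.

(** The case split is on the right hand side. If it is infinite, [gam_aneg_fin] prevents [sigma] and
    [apos] from both being finite. If it is finite, [apos_le] makes [apos] finite, and [sigmaE]
    gives the value of [sigma]. *)
Lemma sigma_balance :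
  (sigma f + (pi^-1)%:E * apos p m Q =
   2%:E * maxe (\sum_(k <oo) (Num.max (- m k) 0)%:E) (\sum_(k <oo) (Num.max (m k) 0)%:E)
   + (pi^-1)%:E * aneg p m Q)%E.
Proof.
have pV : 0 < pi^-1 :> R by rewrite invr_gt0 pi_gt0.
have s0 := sigma_ge0.
have n0 : (0 <= \sum_(k <oo) (Num.max (- m k) 0)%:E)%E.
  by apply: nneseries_ge0 => k _ _; rewrite lee_fin le_max lexx orbT.
have p0 : (0 <= \sum_(k <oo) (Num.max (m k) 0)%:E)%E.
  by apply: nneseries_ge0 => k _ _; rewrite lee_fin le_max lexx orbT.
have ge0 := aneg_ge0 p m Q; have ap0 := apos_ge0 p m Q.
have gm0 : (0 <= gam m)%E by apply: nneseries_ge0 => k _ _; rewrite lee_fin.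
have B := apos_le hQ; have G := gamE m.
have F C : (sigma f < C%:E)%E -> (apos p m Q < +oo)%E -> (gam m < +oo)%E /\ (aneg p m Q < +oo)%E.
  move=> sC; have [r0 r00 h] : exists2 r0, 0 < r0 & forall x y, r0 ^+ 2 <= x ^+ 2 + y ^+ 2 ->
      (lpot p m Q x y <= (Num.max C 0 * Num.sqrt (x ^+ 2 + y ^+ 2))%:E)%E.
    by apply: lpot_growth; apply: lt_le_trans sC _; rewrite lee_fin le_max lexx.
  apply: (gam_aneg_fin hQ _ h); last exact: ltW.
  by rewrite le_max lexx orbT.
have nNy (u : \bar R) : (0 <= u)%E -> u != -oo%E by move=> u0; rewrite -ltNye (lt_le_trans _ u0).
have pM (u : \bar R) : (0 <= u)%E -> ((pi^-1)%:E * u)%E != -oo%E.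
  by move=> u0; apply: nNy; rewrite mule_ge0// lee_fin ltW.
set gn := (\sum_(k <oo) _)%E in n0 G *; set gp := (\sum_(k <oo) _)%E in p0 G *.
have m0 : (0 <= maxe gn gp)%E by rewrite le_max n0.
have RHSy : gam m = +oo%E \/ aneg p m Q = +oo%E ->
    (2%:E * maxe gn gp + (pi^-1)%:E * aneg p m Q = +oo)%E.
  move=> [g|->]; last first.
    by rewrite gt0_muley ?lte_fin// addey// nNy// mule_ge0.
  suff -> : maxe gn gp = +oo%E by rewrite gt0_muley ?lte_fin// addye// pM.
  apply/eqP; rewrite eq_le leey /= le_max.
  by clear m0; move: G n0 p0; rewrite g; clearbody gn gp; case: gn => [?| |]; case: gp => [?| |].
have LHSy : apos p m Q = +oo%E \/ sigma f = +oo%E -> (sigma f + (pi^-1)%:E * apos p m Q = +oo)%E.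
  move=> [->|->]; first by rewrite gt0_muley ?lte_fin// addey// nNy.
  by rewrite addye// pM.
have [infty|fin] := pselect (gam m = +oo%E \/ aneg p m Q = +oo%E).
  rewrite RHSy//; apply: LHSy.
  case sE : (sigma f) s0 => [s| |]// _; last by right.
  left; apply: contrapT => /eqP; rewrite -ltey => apf.
  have sC : (sigma f < (s + 1)%:E)%E by rewrite sE lte_fin; lra.
  have [h1 h2] := F _ sC apf; case: infty => h; first by rewrite h in h1.
  by rewrite h in h2.
have gy : gam m <> +oo%E by move=> h; apply: fin; left.
have ny : aneg p m Q <> +oo%E by move=> h; apply: fin; right.
move: B; case anE : (aneg p m Q) ge0 ny => [an| |]// _ _; move: G gy.
case gE : (gam m) (gm0) => [g| |]// _.
case gnE : gn n0 => [n| |]//; case gpE : gp p0 => [k| |]// _ _ _ _.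
rewrite -EFinM -EFinD; case apE : (apos p m Q) ap0 => [ap| |]// _ _.
rewrite (sigmaE apE anE gnE gpE) -EFin_max -!EFinM -!EFinD.
by congr EFin; rewrite mulrBl; ring.
Qed.

End Balance.

(** * From the zeros to their reciprocals *)

Section Reciprocals.
Context {R : realType}.
Implicit Types (z : nat -> R[i]) (N : option nat).

(* An index out of range gets the reciprocal 0, whose primary factor is 1. *)
Definition recip N z k : R[i] := if in_range N k then (z k)^-1 else 0.

Lemma sqn_inv (w : R[i]) : sqn w^-1 = (sqn w)^-1.
Proof.
have [->|w0] := eqVneq w 0; first by rewrite invr0 /sqn /= expr0n addr0 invr0.
have s0 : sqn w != 0 by rewrite sqn_eq0.
by apply: (mulfI s0); rewrite -sqnM !mulfV// sqn1.
Qed.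

Lemma Im_inv (w : R[i]) : complex.Im w^-1 = - complex.Im w / sqn w.
Proof. by case: w => a b; rewrite /sqn /= mulNr. Qed.

Lemma primary_factor0 : primary_factor (0 : R[i]) = 1.
Proof.
rewrite /primary_factor subr0 mul1r /cexp /= expR0 cos0 sin0 !mul1r.
by [].
Qed.

Lemma canonical_productE N z (w : R[i]) : canonical_product N z w =
  lim ((fun n => \prod_(0 <= k < n) primary_factor (w * recip N z k) : R[i]^o) @ \oo).
Proof.
apply: (f_equal (fun g : nat -> R[i]^o => lim (g @ \oo))); apply/funext => n.
rewrite big_mkcond; apply: eq_bigr => k _; rewrite /recip.
by case: ifP => // _; rewrite mulr0 primary_factor0.
Qed.

Lemma sum_recip_fin N z : genus_one_zeros N z -> exists Q : R,
  (\sum_(k <oo) (complex.Re (recip N z k) ^+ 2 + complex.Im (recip N z k) ^+ 2)%:E = Q%:E)%E.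
Proof.
move=> [_]; rewrite eseries_mkcond.
rewrite (_ : (\sum_(k <oo) (if in_range N k then _ else _))%E =
  (\sum_(k <oo) (sqn (recip N z k))%:E)%E); last first.
  apply: eq_eseriesr => k _; rewrite /recip; case: ifP => _.
    by rewrite sqn_inv sqr_cmod.
  by rewrite /sqn /= expr0n addr0.
have : (0 <= \sum_(k <oo) (sqn (recip N z k))%:E)%E.
  by apply: nneseries_ge0 => k _ _; rewrite lee_fin sqn_ge0.
rewrite /sqn; case: (\sum_(_ <oo) _)%E => [Q| |]// _ _.
by exists Q.
Qed.

(** Inversion exchanges the half planes, so the zeros of the upper one have reciprocals with
    negative imaginary part. Real zeros contribute 0. *)
Lemma gamma_plusE N z : gamma_plus N z =
  (\sum_(k <oo) (Num.max (- complex.Im (recip N z k)) 0)%:E)%E.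
Proof.
rewrite /gamma_plus eseries_mkcond; apply: eq_eseriesr => k _; rewrite /recip.
case: (in_range N k) => /=; last by rewrite oppr0 maxxx.
rewrite Im_inv mulNr opprK normrN; have s0 := sqn_ge0 (z k).
have [h|h] := ltP 0 (complex.Im (z k)).
  by have h0 := divr_ge0 (ltW h) s0; rewrite ger0_norm// max_l.
by rewrite max_r// mulr_le0_ge0// invr_ge0.
Qed.

Lemma gamma_minusE N z : gamma_minus N z =
  (\sum_(k <oo) (Num.max (complex.Im (recip N z k)) 0)%:E)%E.
Proof.
rewrite /gamma_minus eseries_mkcond; apply: eq_eseriesr => k _; rewrite /recip.
case: (in_range N k) => /=; last by rewrite maxxx.
rewrite Im_inv; have s0 := sqn_ge0 (z k).
have [h|h] := ltP (complex.Im (z k)) 0.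
  have h0 : 0 <= - complex.Im (z k) / sqn (z k) by rewrite divr_ge0// oppr_ge0 ltW.
  by rewrite ger0_norm// max_l.
by rewrite max_r// mulr_le0_ge0 ?invr_ge0// oppr_le0.
Qed.

Section Alpha.
Variables (p m : nat -> R) (Q : R) (f : R[i] -> R[i]).
Hypothesis hf : forall w, lne (cmod (f w))%:E = lpot p m Q (complex.Re w) (complex.Im w).

Lemma alphaE : alpha f = ((pi^-1)%:E * apos p m Q)%E.
Proof.
rewrite /alpha; congr (_ * _)%E; apply: eq_integral => t _.
rewrite /log_plus hf /= -/(lpos p m Q t).
(* Division by [t^2] in the extended reals and multiplication by the real inverse are compared only
   for [t != 0]; at 0 both integrands vanish because the potential does. *)
have [->|t0] := eqVneq t 0; first by rewrite lpos0 !mul0e.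
by rewrite inver sqrf_eq0 (negbTE t0).
Qed.

Lemma alpha_invE : alpha_inv f = ((pi^-1)%:E * aneg p m Q)%E.
Proof.
rewrite /alpha_inv; congr (_ * _)%E; apply: eq_integral => t _.
rewrite /log_minus hf /= -/(lneg p m Q t).
have [->|t0] := eqVneq t 0; first by rewrite lneg0 !mul0e.
by rewrite inver sqrf_eq0 (negbTE t0).
Qed.

End Alpha.
End Reciprocals.

Theorem theorem3 (R : realType) (N : option nat) (z : nat -> R[i])
    (hz : genus_one_zeros N z) :
  (sigma (canonical_product N z) + alpha (canonical_product N z)
   = 2%:E * maxe (gamma_plus N z) (gamma_minus N z)
     + alpha_inv (canonical_product N z))%E.
Proof.
have [Q hQ] := sum_recip_fin hz.
have hf w : lne (cmod (canonical_product N z w))%:E =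
    lpot (fun k => complex.Re (recip N z k)) (fun k => complex.Im (recip N z k)) Q
      (complex.Re w) (complex.Im w).
  by rewrite canonical_productE; exact: lne_cmod_lim.
rewrite (alphaE hf) (alpha_invE hf) gamma_plusE gamma_minusE.
exact: sigma_balance.
Qed.
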